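(* Let $G_n$ be the random geometric graph described in the context, and let $\chi$ denote chromatic number. Then: 1. If $nr^d \le n^{-\alpha}$ for some fixed $\alpha>0$ (for all $n$), then with probability one, $\chi(G_n)\in\{k(n),k(n)+1\}$ for all but finitely many $n$, where $k(n):=\left\lfloor \frac{\ln n}{\ln(1/(nr^d))}+\frac12\right\rfloor$ (so $k(n)$ is the integer $k\ge 0$ with $n^{-1/(k-1/2)}\le nr^d< n^{-1/(k+1/2)}$, interpreting the lower bound as vacuous for $k=0$). 2. If $n^{-\varepsilon}\ll nr^d\ll \ln n$ for every fixed $\varepsilon>0$, then $\chi(G_n)\big/\left(\ln n/\ln\left(\frac{\ln n}{nr^d}\right)\right)\to 1$ almost surely. 3. If $\frac{\sigma n r^d}{\ln n}\to t\in(0,\infty)$, then $\frac{\chi(G_n)}{\sigma n r^d}\to f_\chi(t)$ almost surely, where $f_\chi(t):=\sup_{\varphi\in\mathcal F}\xi(\varphi,t)$. The function $f_\chi$ depends only on $d$ and $\|\cdot\|$, is continuous and non-increasing on $(0,\infty)$, satisfies $f_\chi(t)\to \frac{\mathrm{vol}(B)}{2^d\delta}$ as $t\to\infty$ and $f_\chi(t)\to\infty$ as $t\downarrow 0$. 4. If $nr^d\gg \ln n$ (and $r\to 0$), then $\frac{\chi(G_n)}{\sigma n r^d}\to \frac{\mathrm{vol}(B)}{2^d\delta}$ almost surely.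
   Context: Standing setup: $d\ge1$ is fixed and $\|\cdot\|$ is a fixed norm on $\mathbb R^d$; $B=\{x:\|x\|<1\}$ and $B(x;\rho)=\{y:\|x-y\|<\rho\}$; $\mathrm{vol}$ is Lebesgue measure. For $K>0$ let $N(K)$ be the maximum number of pairwise disjoint translates of $B$ with centres in $(0,K)^d$; the packing density is $\delta:=\lim_{K\to\infty}N(K)\mathrm{vol}(B)/K^d\in(0,1]$. $\nu$ is a probability distribution on $\mathbb R^d$ with a bounded density $f$, and $\sigma:=\sup\{s:\mathrm{vol}(\{x:f(x)>s\})>0\}$ (essential supremum of $f$, assumed finite). $X_1,X_2,\dots$ are i.i.d. with law $\nu$; $r=r(n)>0$ with $r(n)\to0$. $G_n$ has vertex set $\{1,\dots,n\}$, with $i\ne j$ adjacent iff $\|X_i-X_j\|\le r(n)$. Weighted integral: $H(x)=x\ln x-x+1$ for $x>0$. For a nonnegative bounded measurable $\varphi$ with $0<\int\varphi<\infty$ and $0<t<\infty$, let $s=s(\varphi,t)$ be the unique $s\ge0$ with $\int_{\mathbb R^d}H(e^{s\varphi(x)})\,dx=1/t$, and set $\xi(\varphi,t):=\int\varphi(x)e^{s\varphi(x)}dx$; also $\xi(\varphi,\infty):=\int\varphi$; $\xi(\varphi,t)=0$ if $\int\varphi=0$, and $\xi(\varphi,t)=\infty$ if $\int\varphi=\infty$. A set $S\subseteq\mathbb R^d$ is well-spread if $\|v-w\|>1$ for all distinct $v,w\in S$. A nonnegative measurable $\varphi$ is feasible if $\sum_{v\in S}\varphi(v)\le1$ for every well-spread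 $S$; $\mathcal F$ is the set of feasible functions. *)

(* Defs.v *)
From mathcomp Require Import all_boot all_order all_algebra.
From mathcomp Require Import all_classical all_reals all_analysis.
Set Implicit Arguments.
Unset Strict Implicit.
Unset Printing Implicit Defensive.
Import Order.TTheory GRing.Theory Num.Theory.
Import numFieldNormedType.Exports.
Local Open Scope classical_set_scope.
Local Open Scope ring_scope.

(* ---------- R^d, modelled as d.-tuple R (with its product Borel sigma-algebra) ---------- *)
Section Rd.
Context {R : realType} {d : nat}.

Definition vadd (x y : d.-tuple R) : d.-tuple R := [tuple tnth x i + tnth y i | i < d].
Definition vsub (x y : d.-tuple R) : d.-tuple R := [tuple tnth x i - tnth y i | i < d].
Definition vscale (a : R) (x : d.-tuple R) : d.-tuple R := [tuple a * tnth x i | i < d].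
Definition vzero : d.-tuple R := [tuple (0 : R) | i < d].

Definition is_norm (nrm : d.-tuple R -> R) : Prop :=
  [/\ (forall x, nrm x = 0 -> x = vzero),
      (forall a x, nrm (vscale a x) = `|a| * nrm x) &
      (forall x y, nrm (vadd x y) <= nrm x + nrm y)].

(* vol is Lebesgue measure on the Borel sets of R^d: the measure giving every
   closed box its usual volume (such a measure exists and is unique). *)
Definition is_lebesgue (vol : set (d.-tuple R) -> \bar R) : Prop :=
  forall a b : d.-tuple R, (forall i, tnth a i <= tnth b i) ->
    vol [set x | forall i, tnth a i <= tnth x i <= tnth b i] =
    (\prod_(i < d) (tnth b i - tnth a i))%:E.

Definition unit_ball (nrm : d.-tuple R -> R) : set (d.-tuple R) := [set x | nrm x < 1].
Definition nball (nrm : d.-tuple R -> R) (c : d.-tuple R) (rho : R) : set (d.-tuple R) :=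
  [set y | nrm (vsub c y) < rho].

Definition packable (nrm : d.-tuple R -> R) (K : R) (m : nat) : Prop :=
  exists c : 'I_m -> d.-tuple R,
    (forall j k, 0 < tnth (c j) k < K) /\
    (forall j j', j != j' -> nball nrm (c j) 1 `&` nball nrm (c j') 1 = set0).
Definition Npack (nrm : d.-tuple R -> R) (K : R) : R :=
  sup [set (m%:R : R) | m in packable nrm K].

Definition packing_density (nrm : d.-tuple R -> R) (vol : set (d.-tuple R) -> \bar R) : R :=
  lim ((Npack nrm K * fine (vol (unit_ball nrm)) / K ^+ d) @[K --> +oo]).

Definition ess_sup_density (vol : set (d.-tuple R) -> \bar R) (f : d.-tuple R -> R) : R :=
  sup [set s : R | (0 < vol [set x | (s < f x)%R])%E].

Definition well_spread (nrm : d.-tuple R -> R) (S : set (d.-tuple R)) : Prop :=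
  forall v w, S v -> S w -> v <> w -> nrm (vsub v w) > 1.

Definition feasible (nrm : d.-tuple R -> R) (phi : d.-tuple R -> R) : Prop :=
  [/\ (forall x, 0 <= phi x), measurable_fun setT phi &
      (forall S, well_spread nrm S -> (\esum_(v in S) (phi v)%:E <= 1%:E)%E)].

Definition Hfun (x : R) : R := x * ln x - x + 1.

Variable vol : {measure set (d.-tuple R) -> \bar R}.

(* s(phi,t): the unique s >= 0 with  int H(e^{s phi}) = 1/t *)
Definition s_param (phi : d.-tuple R -> R) (t : R) : R :=
  xget 0 [set s : R | 0 <= s /\
    (\int[vol]_x (Hfun (expR (s * phi x)))%:E = (t^-1)%:E)%E].

Definition xi (phi : d.-tuple R -> R) (t : R) : \bar R :=
  let I := (\int[vol]_x (phi x)%:E)%E in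
  if I == 0%E then 0%E
  else if I == +oo%E then +oo%E
  else (\int[vol]_x (phi x * expR (s_param phi t * phi x))%:E)%E.

Definition f_chi (nrm : d.-tuple R -> R) (t : R) : \bar R :=
  ereal_sup [set xi phi t | phi in feasible nrm].

End Rd.

Definition colorable (n : nat) (adj : rel 'I_n) (k : nat) : bool :=
  [exists c : {ffun 'I_n -> 'I_k}, [forall i, [forall j, adj i j ==> (c i != c j)]]].

(* least k such that a proper k-colouring exists (n colours always suffice for a
   loopless graph on n vertices, so the default value n is never spuriously hit) *)
Definition chromatic (n : nat) (adj : rel 'I_n) : nat :=
  \big[minn/n]_(k < n.+1 | colorable adj k) k.

Definition rgg_adj {R : realType} {d : nat} (nrm : d.-tuple R -> R)
  (x : nat -> d.-tuple R) (r : R) (n : nat) : rel 'I_n :=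
  fun i j => (i != j) && (nrm (vsub (x i) (x j)) <= r).

Definition mutually_independent {R : realType} {d0 : measure_display} {Omega : measurableType d0}
  {d1 : measure_display} {T : measurableType d1}
  (P : probability Omega R) (X : nat -> Omega -> T) : Prop :=
  forall (s : seq nat) (A : nat -> set T), uniq s -> (forall i, measurable (A i)) ->
    P (\big[setI/setT]_(i <- s) (X i @^-1` A i)) = (\prod_(i <- s) P (X i @^-1` A i))%E.

Arguments rgg_adj {R d} nrm x r n.
Arguments chromatic n adj : clear implicits.
Arguments colorable n adj k : clear implicits.

(* Main.v *)
(* Lower bounds.  If [phi] is feasible, then for every [x] the points of a stable set
   of the graph give a well-spread set after rescaling by [r], so that
   [\sum_i phi ((X_i - x) / r) <= chi].  There are of order [r ^- d] disjoint regions of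
   nearly maximal density.  Tilting the law of the points by [expR (s * phi)] in one of
   them costs a probability governed by the entropy integral in the definition of [xi],
   and by negative association one of the regions pays this price and sees
   a weight close to [xi phi t * sigma n r ^ d].

   Upper bounds.  Cut space into cells of side [eps * r].  By a multiplicative-weights
   form of linear programming duality, a grid of cells with given occupation numbers is
   covered by about as many stable sets of cells as the largest total weight over dual
   feasible cell functions; these are feasible functions up to a dilation, and it is
   enough to control finitely many of them, with a Chernoff bound for each.  Corridors
   between large boxes, placed in several shifted positions, reduce the colouring of the
   whole space to that of separate boxes.

   The function [f_chi] is studied through [xi phi t = inf_(s > 0) (1 / t + Lam s) / s] with
   [Lam s = \int (expR (s * phi) - 1)]: it satisfies [f_chi (t / l) <= l f_chi t] for [l >= 1],
   and [\int phi <= f_chi], where the supremum of [\int phi] is computed by averaging [phi]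
   over an optimal packing.

   In the two sparser regimes, the maximum degree of the graph bounds [chi] from above,
   and points lying in a common cube of side proportional to [r] bound it from below. *)
Require Import Defs.
From mathcomp Require Import all_boot all_order all_algebra.
From mathcomp Require Import all_classical all_reals all_analysis.
From mathcomp Require Import measurable_realfun.
From mathcomp Require Import ring lra zify.
Set Implicit Arguments.
Unset Strict Implicit.
Unset Printing Implicit Defensive.
Import Order.TTheory GRing.Theory Num.Theory.
Import numFieldNormedType.Exports.
Local Open Scope classical_set_scope.
Local Open Scope ring_scope.

(** * Expectations over independent labels *)

(** Every random quantity estimated below depends only on which of finitely many cells contains each
    point, so the probability theory reduces to finite weighted sums over sequences of labels. Three
    obstacles shape the rest. The density may approach its essential supremum only on a set without
    interior, so good regions are found by showing that fine grids cut any measurable set into cells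
    almost wholly inside or outside it. The points may spread over all of space, so a union bound
    over window positions has infinitely many terms; each tail bound therefore carries the mass of
    its window as a factor, and these masses have a finite sum. Outside the dense regime the upper
    bounds fail with a probability that may decay only like a small power of [n], too slowly for
    Borel-Cantelli; the graph grows with [n] and with the radius, so one event at the end of a block
    [j ^ a <= n < (j + 1) ^ a] controls the whole block. As the radii are an arbitrary sequence
    tending to 0, such an event must treat all radii below a threshold at once. *)

Section IidExpectation.
Context {R : realType} {K : finType}.
Implicit Types (p w u : K -> R) (F G : seq K -> R).

(** Expectation over independent labels as an iterated finite sum: peeling off the first label turns
    each estimate into an induction on [n]. [iid_transfer] links it to the random points. *)
Fixpoint iidE p (n : nat) F : R :=
  if n is m.+1 then \sum_k p k * iidE p m (fun s => F (k :: s)) else F [::].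

Lemma eq_iidE p n F G : (forall s, size s = n -> F s = G s) ->
  iidE p n F = iidE p n G.
Proof.
elim: n F G => [|n IH] F G FG /=; first exact: FG.
apply: eq_bigr => k _; congr (_ * _); apply: IH => s sn.
by apply: FG; rewrite /= sn.
Qed.

Lemma le_iidE p n F G : (forall k, 0 <= p k) ->
  (forall s, size s = n -> F s <= G s) -> iidE p n F <= iidE p n G.
Proof.
move=> p0; elim: n F G => [|n IH] F G FG /=; first exact: FG.
apply: ler_sum => k _; apply: ler_wpM2l => //; apply: IH => s sn.
by apply: FG; rewrite /= sn.
Qed.

Lemma iidEZ p n c F : iidE p n (fun s => c * F s) = c * iidE p n F.
Proof.
elim: n F => [|n IH] F //=.
by rewrite mulr_sumr; apply: eq_bigr => k _; rewrite IH mulrCA.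
Qed.

Lemma iidED p n F G :
  iidE p n (fun s => F s + G s) = iidE p n F + iidE p n G.
Proof.
elim: n F G => [|n IH] F G //=.
by rewrite -big_split; apply: eq_bigr => k _; rewrite IH mulrDr.
Qed.

Lemma iidE_cst p n c : \sum_k p k = 1 -> iidE p n (fun=> c) = c.
Proof.
by move=> p1; elim: n => [|n IH] //=; rewrite IH -mulr_suml p1 mul1r.
Qed.

Lemma iidE_ge0 p n F : (forall k, 0 <= p k) -> (forall s, 0 <= F s) ->
  0 <= iidE p n F.
Proof.
move=> p0; elim: n F => [|n IH] F F0 //=.
by apply: sumr_ge0 => k _; rewrite mulr_ge0 ?IH.
Qed.

Lemma iidE_prod p n g :
  iidE p n (fun s => \prod_(k <- s) g k) = (\sum_k p k * g k) ^+ n.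
Proof.
elim: n => [|n IH] /=; first by rewrite big_nil expr0.
rewrite exprS mulr_suml; apply: eq_bigr => k _.
by under eq_iidE do rewrite big_cons; rewrite iidEZ IH mulrA.
Qed.

(** Size biasing: one label is marked by [a], and the other [n.-1] contribute a full factor each. *)
Lemma iidE_sum_prod p n a g :
  iidE p n (fun s => (\sum_(k <- s) a k) * \prod_(k <- s) g k) =
  n%:R * (\sum_k p k * a k * g k) * (\sum_k p k * g k) ^+ n.-1.
Proof.
elim: n => [|n IH] /=; first by rewrite big_nil !mul0r.
pose Z := \sum_k p k * g k.
transitivity (\sum_k (p k * a k * g k * Z ^+ n +
   p k * g k * (n%:R * (\sum_k p k * a k * g k) * Z ^+ n.-1))).
  apply: eq_bigr => k _.
  transitivity (p k * iidE p n (fun s => a k * g k * \prod_(j <- s) g j +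
    g k * ((\sum_(j <- s) a j) * \prod_(j <- s) g j))).
    by congr (_ * _); apply: eq_iidE => s _; rewrite !big_cons; ring.
  by rewrite iidED !iidEZ iidE_prod IH -/Z; ring.
rewrite big_split /= -!mulr_suml -/Z.
case: n {IH} => [|n] /=; first by rewrite expr0 !mulr1 !mul0r mulr0 addr0 mul1r.
by rewrite exprS -[n.+2%:R]natr1; ring.
Qed.

Lemma iidE_tilt p n (g : K -> R) F : \sum_k p k * g k != 0 ->
  iidE p n (fun s => F s * \prod_(k <- s) g k) =
  (\sum_k p k * g k) ^+ n *
  iidE (fun k => p k * g k / (\sum_k p k * g k)) n F.
Proof.
set Z := \sum_k _ => Z0.
elim: n F => [|n IH] F /=; first by rewrite big_nil expr0 mulr1 mul1r.
rewrite mulr_sumr; apply: eq_bigr => k _.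
under eq_iidE do rewrite big_cons mulrCA.
by rewrite iidEZ IH exprS; field.
Qed.

Lemma iidE_centered_sum p n u : \sum_k p k = 1 -> \sum_k p k * u k = 0 ->
  iidE p n (fun s => \sum_(k <- s) u k) = 0.
Proof.
move=> p1 pu; elim: n => [|n IH] /=; first by rewrite big_nil.
rewrite -[RHS]pu; apply: eq_bigr => k _; congr (_ * _).
by under eq_iidE do rewrite big_cons; rewrite iidED iidE_cst// IH addr0.
Qed.

Lemma iidE_centered_sum_sqr p n u : \sum_k p k = 1 -> \sum_k p k * u k = 0 ->
  iidE p n (fun s => (\sum_(k <- s) u k) ^+ 2) =
  n%:R * \sum_k p k * u k ^+ 2.
Proof.
move=> p1 pu; elim: n => [|n IH] /=.
  by rewrite big_nil expr0n mul0r.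
transitivity (\sum_k (p k * u k ^+ 2 + p k * (n%:R * \sum_k p k * u k ^+ 2))).
  apply: eq_bigr => k _; rewrite -mulrDr; congr (_ * _).
  transitivity (iidE p n (fun s => u k ^+ 2 +
      ((u k *+ 2) * \sum_(j <- s) u j + (\sum_(j <- s) u j) ^+ 2))).
    by apply: eq_iidE => s _; rewrite big_cons; ring.
  by rewrite !iidED iidEZ iidE_cst// IH iidE_centered_sum// mulr0 add0r.
by rewrite big_split /= -mulr_suml p1 mul1r -natr1 mulrDl mul1r addrC.
Qed.

Lemma iidE_chebyshev p n w (a : R) : (forall k, 0 <= p k) -> \sum_k p k = 1 -> 0 < a ->
  iidE p n (fun s => (a <= `|\sum_(k <- s) w k - n%:R * \sum_k p k * w k|)%R%:R)
  <= n%:R * (\sum_k p k * w k ^+ 2) / a ^+ 2.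
Proof.
move=> p0 p1 a0; set m := \sum_k p k * w k.
pose u k := w k - m.
have pu : \sum_k p k * u k = 0.
  by rewrite /u; under eq_bigr do rewrite mulrBr;
     rewrite big_split /= sumrN -mulr_suml p1 mul1r subrr.
have pu2 : \sum_k p k * u k ^+ 2 <= \sum_k p k * w k ^+ 2.
  have -> : \sum_k p k * u k ^+ 2 =
    \sum_k (p k * w k ^+ 2 + ((- (m *+ 2)) * (p k * w k) + p k * m ^+ 2)).
    by apply: eq_bigr => k _; rewrite /u; ring.
  rewrite !big_split /= -mulr_sumr -mulr_suml p1 -/m.
  have := sqr_ge0 m; nra.
rewrite ler_pdivlMr ?exprn_gt0// mulrC.
apply: (le_trans (y := n%:R * \sum_k p k * u k ^+ 2)); last first.
  by rewrite ler_wpM2l.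
rewrite -iidE_centered_sum_sqr// -iidEZ.
apply: le_iidE => // s sn.
have -> : \sum_(k <- s) w k - n%:R * m = \sum_(k <- s) u k.
  rewrite /u big_split /= sumrN; congr (_ - _).
  by rewrite big_const_seq count_predT sn iter_addr_0 mulr_natl.
have [h|h] := lerP a; last by rewrite mulr0 sqr_ge0.
by rewrite mulr1 -[leRHS]real_normK ?num_real// lerXn2r ?nnegrE// ltW.
Qed.

(** Cramer's lower bound. Under the tilted weights the sum has mean [m] and, as [w <= 1], variance
    at most [m], so the condition on [a] lets Chebyshev keep half of the mass within [a] of [m].
    Undoing the tilt there costs at most [expR (s * (m + a))]. *)
Lemma iidE_tilted_lower p n w (s a : R) :
  (forall k, 0 <= p k) -> \sum_k p k = 1 ->
  (forall k, 0 <= w k <= 1) -> 0 <= s -> 0 < a ->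
  let Z := \sum_k p k * expR (s * w k) in
  let m := n%:R * ((\sum_k p k * w k * expR (s * w k)) / Z) in
  m *+ 2 <= a ^+ 2 ->
  Z ^+ n * expR (- (s * (m + a))) / 2 <=
  iidE p n (fun l => (m - a <= \sum_(k <- l) w k)%R%:R).
Proof.
move=> p0 p1 w01 s0 a0 Z m ma.
have Z1 : 1 <= Z.
  rewrite -p1; apply: ler_sum => k _; rewrite -[leLHS]mulr1 ler_wpM2l//.
  by rewrite -expR0 ler_expR mulr_ge0//; case/andP: (w01 k).
have Z0 : Z != 0 by rewrite gt_eqF// (lt_le_trans _ Z1).
have Zpos : 0 < Z by rewrite (lt_le_trans _ Z1).
pose q k := p k * expR (s * w k) / Z.
have q0 k : 0 <= q k by rewrite /q divr_ge0 ?mulr_ge0 ?expR_ge0 ?(ltW Zpos).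
have q1 : \sum_k q k = 1 by rewrite /q -mulr_suml divff.
have qw : \sum_k q k * w k = (\sum_k p k * w k * expR (s * w k)) / Z.
  by rewrite mulr_suml; apply: eq_bigr => k _; rewrite /q; ring.
have cheb := iidE_chebyshev n w q0 q1 a0.
rewrite qw -/m in cheb.
have var : n%:R * (\sum_k q k * w k ^+ 2) <= m.
  rewrite /m -qw ler_wpM2l//; apply: ler_sum => k _.
  rewrite ler_wpM2l// expr2 -[leRHS]mulr1.
  by case/andP: (w01 k) => ? ?; rewrite ler_wpM2l.
have {cheb} : iidE q n (fun l => (a <= `|\sum_(k <- l) w k - m|)%R%:R) <= 2^-1.
  apply: (le_trans cheb); rewrite ler_pdivrMr ?exprn_gt0//.
  by rewrite (le_trans var)//; move: ma; rewrite mulr2n; lra.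
move=> cheb.
have half : 2^-1 <= iidE q n (fun l => (`|\sum_(k <- l) w k - m| < a)%R%:R).
  have : iidE q n (fun l => (a <= `|\sum_(k <- l) w k - m|)%R%:R +
     (`|\sum_(k <- l) w k - m| < a)%R%:R) = 1.
    rewrite -[RHS](iidE_cst n 1 q1); apply: eq_iidE => l _.
    by rewrite ltNge; case: (_ <= _); rewrite ?addr0 ?add0r.
  rewrite iidED => e; lra.
rewrite -mulrA mulrCA.
have tilt := @iidE_tilt p n (fun k => expR (s * w k))
  (fun l => (`|\sum_(k <- l) w k - m| < a)%R%:R) Z0.
rewrite -/Z -/q in tilt.
apply: (le_trans (y := expR (- (s * (m + a))) *
   iidE p n (fun l => (`|\sum_(k <- l) w k - m| < a)%R%:R *
        \prod_(k <- l) expR (s * w k)))).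
  by rewrite tilt ler_wpM2l ?expR_ge0// ler_wpM2l ?exprn_ge0 ?(ltW Zpos).
rewrite -iidEZ; apply: le_iidE => // l _.
have [h|h] := ltrP; last by rewrite mul0r mulr0 ler0n.
move: (h); rewrite distrC ltr_distlC => /andP [h1 h2].
have -> : (m - a <= \sum_(k <- l) w k) by rewrite ltW//; lra.
rewrite mul1r -expR_sum -expRD -expR0 ler_expR -mulr_sumr.
by rewrite addrC subr_le0 ler_wpM2l//; lra.
Qed.

(** Exponential Markov inequality with an extra factor: as [t > 0], some label has nonzero weight,
    so the number of such labels may be inserted. Size biasing turns it into [n] times their mass,
    which makes the bound summable over infinitely many windows. *)
Lemma iidE_upper_tail p n w (s t : R) :
  (forall k, 0 <= p k) -> \sum_k p k = 1 ->
  (forall k, 0 <= w k <= 1) -> 0 <= s -> 0 < t ->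
  iidE p n (fun l => (t <= \sum_(k <- l) w k)%R%:R) <=
  n%:R * (\sum_(k | w k != 0) p k) * expR s *
  expR (n%:R * (\sum_k p k * (expR (s * w k) - 1)) - s * t).
Proof.
move=> p0 p1 w01 s0 t0.
pose Z := \sum_k p k * expR (s * w k).
have w0 k : 0 <= w k by case/andP: (w01 k).
have Z1 : 1 <= Z.
  rewrite -p1; apply: ler_sum => k _; rewrite -[leLHS]mulr1 ler_wpM2l//.
  by rewrite -expR0 ler_expR mulr_ge0.
have ZE : Z = 1 + \sum_k p k * (expR (s * w k) - 1).
  under [in RHS]eq_bigr do rewrite mulrBr mulr1.
  by rewrite big_split /= sumrN p1 -/Z; ring.
pose a k : R := (w k != 0)%:R.
apply: (le_trans (y := expR (- (s * t)) *
   iidE p n (fun l => (\sum_(k <- l) a k) * \prod_(k <- l) expR (s * w k)))).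
  rewrite -iidEZ; apply: le_iidE => // l _.
  have a0 : 0 <= \sum_(k <- l) a k by apply: sumr_ge0 => k _; rewrite ler0n.
  have [h|h] := lerP t; last first.
    by rewrite mulr_ge0 ?expR_ge0// mulr_ge0// prodr_ge0// => k _; exact: expR_ge0.
  have a1 : 1 <= \sum_(k <- l) a k.
    have : has (fun k => w k != 0) l.
      apply/negPn/negP => /hasPn hl; suff : \sum_(k <- l) w k = 0 by lra.
      by rewrite big_seq big1// => k /hl; rewrite negbK => /eqP.
    elim: l {h a0} => //= k l IH; rewrite big_cons.
    have h0 : 0 <= \sum_(k <- l) a k by apply: sumr_ge0 => j _; rewrite ler0n.
    move=> /orP [wk|/IH h]; first by rewrite (_ : a k = 1) ?lerDl// /a wk.
    by rewrite (le_trans h)// lerDr ler0n.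
  rewrite mulrCA -[leLHS]mulr1 ler_pM// -expR_sum -expRD -expR0 ler_expR -mulr_sumr.
  by rewrite addrC subr_ge0 ler_wpM2l.
rewrite iidE_sum_prod -/Z.
have -> : expR (n%:R * (\sum_k p k * (expR (s * w k) - 1)) - s * t) =
  expR (- (s * t)) * expR (n%:R * (\sum_k p k * (expR (s * w k) - 1))).
  by rewrite -expRD addrC.
rewrite [leRHS]mulrCA ler_wpM2l ?expR_ge0//.
have Zn : Z ^+ n.-1 <= expR (n%:R * (\sum_k p k * (expR (s * w k) - 1))).
  rewrite expRM_natl.
  apply: (le_trans (y := Z ^+ n)); first by rewrite ler_weXn2l// leq_pred.
  by rewrite lerXn2r ?nnegrE ?expR_ge0 ?(le_trans _ Z1)// ZE expR_ge1Dx.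
rewrite ler_pM//.
- by rewrite mulr_ge0// sumr_ge0// => k _; rewrite !mulr_ge0 ?ler0n ?expR_ge0.
- by rewrite exprn_ge0// (le_trans _ Z1).
rewrite -mulrA ler_wpM2l// mulr_suml [leRHS]big_mkcond /=.
apply: ler_sum => k _; rewrite /a; case: (w k != 0); last by rewrite mulr0 mul0r.
rewrite mulr1 ler_wpM2l// ler_expR -[leRHS]mulr1 ler_wpM2l//.
by case/andP: (w01 k).
Qed.

Lemma iidE_lower_tail p n w (s t : R) : (forall k, 0 <= p k) -> 0 <= s ->
  iidE p n (fun l => (\sum_(k <- l) w k <= t)%R%:R) <=
  expR (s * t) * (\sum_k p k * expR (- (s * w k))) ^+ n.
Proof.
move=> p0 s0; rewrite -iidE_prod -iidEZ; apply: le_iidE => // l _.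
have [h|h] := lerP (\sum_(k <- l) w k) t; last first.
  by rewrite mulr_ge0 ?expR_ge0// prodr_ge0// => k _; exact: expR_ge0.
rewrite -expR_sum -expRD -expR0 ler_expR sumrN -mulr_sumr subr_ge0.
by rewrite ler_wpM2l.
Qed.

Lemma iidE_binomial p (A : pred K) n k : \sum_j p j = 1 ->
  iidE p n (fun l => (count A l == k)%:R) =
  'C(n, k)%:R * (\sum_(j | A j) p j) ^+ k * (1 - \sum_(j | A j) p j) ^+ (n - k).
Proof.
move=> p1; set q := \sum_(j | A j) p j.
have p1A : \sum_(j | ~~ A j) p j = 1 - q.
  by rewrite -p1 [in RHS](bigID A) /= -/q [q + _]addrC addrK.
elim: n k => [|n IH] k /=.
  by case: k => [|k]; rewrite ?bin0 ?expr0 ?mulr1// bin0n/= !mul0r.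
rewrite (bigID A) /=.
have -> : \sum_(j | A j) p j * iidE p n (fun s => ((A j + count A s)%N == k)%:R) =
  q * iidE p n (fun s => ((count A s).+1 == k)%:R).
  by rewrite mulr_suml; apply: eq_bigr => j ->; under eq_iidE do rewrite add1n.
have -> : \sum_(j | ~~ A j) p j * iidE p n (fun s => ((A j + count A s)%N == k)%:R) =
  (1 - q) * iidE p n (fun s => (count A s == k)%:R).
  by rewrite -p1A mulr_suml; apply: eq_bigr => j /negbTE ->; under eq_iidE do rewrite add0n.
case: k => [|k].
  by rewrite IH iidE_cst// !bin0 !subn0 exprS; ring.
under eq_iidE do rewrite eqSS.
rewrite !IH binS natrD.
have [kn|nk] := ltnP k n; first by rewrite subSS -(subnSK kn) !exprS; ring.
by rewrite subSS (@bin_small n k.+1)// exprS; ring.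
Qed.

(** * Negative association for disjoint regions *)

Section NegativeAssociation.
Context {J : finType} (p : K -> R) (reg : K -> option J) (k0 : K).
Hypotheses (p0 : forall k, 0 <= p k) (p1 : \sum_k p k = 1).

(** A label belongs to at most one region, so it lowers at most one factor below its bound. Hence
    the deficits [a j0 - f j0 k] and [b - F k] have product zero, and the mean of a product falls
    short of the product of the means by exactly the product of the mean deficits. *)
Let le_sum_prod (f : J -> K -> R) (a : J -> R) :
  (forall j k, 0 <= f j k <= a j) ->
  (forall j k, reg k != Some j -> f j k = a j) ->
  \sum_k p k * \prod_j f j k <= \prod_j \sum_k p k * f j k.
Proof.
move=> fa fE.
have [+ _] := (index_enum_uniq J, tt); elim: (index_enum J) => [|j0 js IH] /=.
  by move=> _; under eq_bigr do rewrite big_nil mulr1; rewrite big_nil p1.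
move=> /andP [j0js /IH {}IH].
under eq_bigr do rewrite big_cons.
rewrite big_cons.
pose F k := \prod_(j <- js) f j k; pose b := \prod_(j <- js) a j.
have f0 j k : 0 <= f j k by case/andP: (fa j k).
have fle j k : f j k <= a j by case/andP: (fa j k).
have Fb k : F k <= b by apply: ler_prod.
have orth k : (a j0 - f j0 k) * (b - F k) = 0.
  have [e|ne] := eqVneq (reg k) (Some j0); last by rewrite fE// subrr mul0r.
  suff -> : F k = b by rewrite subrr mulr0.
  rewrite /F /b !big_seq; apply: eq_bigr => j jj; apply: fE.
  by rewrite e; apply: contraNneq j0js => -[->].
have E : \sum_k p k * (f j0 k * F k) =
   a j0 * (\sum_k p k * F k) + b * (\sum_k p k * f j0 k) - a j0 * b.
  rewrite -[a j0 * b]mul1r -p1 mulr_suml !mulr_sumr -sumrN -!big_split /=.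
  apply: eq_bigr => k _; apply/eqP; rewrite -subr_eq0; apply/eqP.
  by rewrite -[RHS](mulr0 (p k)) -(orth k); ring.
rewrite E.
have m1 : \sum_k p k * f j0 k <= a j0.
  rewrite -[leRHS]mul1r -p1 mulr_suml; apply: ler_sum => k _.
  by rewrite ler_wpM2l.
have m2 : \sum_k p k * F k <= b.
  rewrite -[leRHS]mul1r -p1 mulr_suml; apply: ler_sum => k _.
  by rewrite ler_wpM2l.
have m0 : 0 <= \sum_k p k * f j0 k.
  by apply: sumr_ge0 => k _; rewrite mulr_ge0.
apply: (le_trans (y := (\sum_k p k * f j0 k) * (\sum_k p k * F k))).
  nra.
by rewrite ler_wpM2l.
Qed.

(** The label [k0] lies in no region and makes every [F j] largest. Averaging over the later labels
    first leaves functions of one label that still depend only on their own region, so the one-label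
    inequality applies. *)
Lemma iidE_neg_assoc n (F : J -> seq K -> R) : reg k0 = None ->
  (forall j s, 0 <= F j s) ->
  (forall j s1 k s2, F j (s1 ++ k :: s2) <= F j (s1 ++ k0 :: s2)) ->
  (forall j s1 k s2, reg k != Some j ->
     F j (s1 ++ k :: s2) = F j (s1 ++ k0 :: s2)) ->
  iidE p n (fun s => \prod_j F j s) <= \prod_j iidE p n (F j).
Proof.
move=> rk0; elim: n F => [|n IH] F F0 Fle Feq //=.
apply: (le_trans (y := \sum_k p k * \prod_j iidE p n (fun s => F j (k :: s)))).
  apply: ler_sum => k _; rewrite ler_wpM2l//; apply: IH => //.
  - by move=> j s1 k' s2; apply: (Fle j (k :: s1)).
  - by move=> j s1 k' s2; apply: (Feq j (k :: s1)).
apply: (le_sum_prod (a := fun j => iidE p n (fun s => F j (k0 :: s)))).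
- move=> j k; rewrite iidE_ge0//=; apply: le_iidE => // s _.
  exact: (Fle j [::]).
- by move=> j k rk; apply: eq_iidE => s _; apply: (Feq j [::]).
Qed.

End NegativeAssociation.

End IidExpectation.

(** * Covering by stable sets *)

(* Multiplicative-weights argument: the potential [\sum_q expR (- a x_q / N_q)],
   with [x_q] the number of chosen sets containing [q], shrinks by a factor
   [expR (- a / ((1 + k) c))] when one adds a set of maximal current weight.
   It replaces both linear programming duality and the rounding of an optimal
   fractional cover. *)
Section GreedyCover.
Context {R : realType} {C : finType} (stab : pred {set C}).
Hypothesis stab0 : stab (@finset.set0 C).

Let potential (a : R) (N : C -> R) (l : seq {set C}) : R :=
  \sum_q expR (- (a * (count (fun S : {set C} => q \in S) l)%:R / N q)).

Let potential_step (a k c : R) (N : C -> R) : 0 < a -> 0 < k -> 0 < c ->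
  (forall q, a / k <= N q) ->
  (forall phi : C -> R, (forall q, 0 <= phi q) ->
     (forall S, stab S -> \sum_(q in S) phi q <= 1) ->
     \sum_q phi q * N q <= c) ->
  forall l, exists2 S, stab S &
    potential a N (S :: l) <= expR (- (a / (c * (1 + k)))) * potential a N l.
Proof.
move=> a0 k0 c0 Na dual l.
have N0 q : 0 < N q by rewrite (lt_le_trans _ (Na q))// divr_gt0.
pose w q := expR (- (a * (count (fun S : {set C} => q \in S) l)%:R / N q)).
pose M (S : {set C}) := \sum_(q in S) w q / N q.
have w0 q : 0 < w q by exact: expR_gt0.
have M0 S : 0 <= M S by apply: sumr_ge0 => q _; rewrite divr_ge0 ?ltW.
have [S sS Smax] : exists2 S, stab S & forall S', stab S' -> M S' <= M S.
  by case: (arg_maxP M stab0) => S sS h; exists S.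
exists S => //; set Phi := potential a N l.
have Phi0 : 0 <= Phi by apply: sumr_ge0 => q _; exact: expR_ge0.
(* Otherwise the current weights, divided by [N] and by a number strictly between the maximum and
   [Phi / c], would be dual feasible with value above [c]. *)
have MS : Phi / c <= M S.
  rewrite leNgt; apply/negP => lt.
  pose M' := (M S + Phi / c) / 2.
  have M'1 : M S <= M' by rewrite /M'; lra.
  have M'2 : M' < Phi / c by rewrite /M'; lra.
  have M'0 : 0 < M' by rewrite /M'; have := M0 S; lra.
  have : \sum_q (w q / N q / M') * N q <= c.
    apply: dual => [q|S' sS']; first by apply: divr_ge0; [apply: divr_ge0|]; apply: ltW.
    by rewrite -mulr_suml ler_pdivrMr// mul1r (le_trans (Smax _ sS')).
  have -> : \sum_q (w q / N q / M') * N q = Phi / M'.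
    rewrite /Phi /potential mulr_suml; apply: eq_bigr => q _; rewrite -/(w q).
    by field; rewrite !gt_eqF.
  rewrite ler_pdivrMr// leNgt => /negP; apply.
  by move: M'2; rewrite ltr_pdivlMr// mulrC.
apply: (le_trans (y := Phi * (1 - a / (c * (1 + k))))); last first.
  by rewrite mulrC ler_wpM2r//; have := expR_ge1Dx (- (a / (c * (1 + k)))).
have k10 : 0 < 1 + k by lra.
have -> : Phi * (1 - a / (c * (1 + k))) = Phi - Phi / c * (a / (1 + k)).
  by field; rewrite !gt_eqF.
apply: (le_trans (y := Phi - M S * (a / (1 + k)))); last first.
  by rewrite lerB// ler_wpM2r// divr_ge0// ltW.
rewrite /Phi /potential /M mulr_suml [X in _ - X]big_mkcond -sumrB; apply: ler_sum => q _ /=.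
case: (q \in S); last by rewrite add0n subr0.
rewrite -/(w q) natrD mulrDr mulrDl opprD expRD -/(w q).
set y := a / N q.
have y0 : 0 < y by rewrite divr_gt0.
(* Here the lower bound on [N] enters: it allows the uniform factor [1 - y / (1 + k)] in place of
   [1 - y / (1 + y)]. *)
have yk : y <= k by rewrite ler_pdivrMr// mulrC -ler_pdivrMr.
have ey : expR (- (a * 1 / N q)) <= 1 - y / (1 + k).
  rewrite mulr1 -/y expRN.
  apply: (le_trans (y := (1 + y)^-1)).
    by rewrite lef_pV2 ?posrE ?expR_gt0 ?expR_ge1Dx//; lra.
  have -> : (1 + y)^-1 = 1 - y / (1 + y) by field; rewrite gt_eqF//; lra.
  by rewrite lerB// ler_pM2l// lef_pV2 ?posrE; lra.
apply: (le_trans (y := (1 - y / (1 + k)) * w q)); first by rewrite ler_wpM2r// ltW.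
by rewrite le_eqVlt; apply/orP; left; apply/eqP; rewrite /y; field; rewrite !gt_eqF.
Qed.

(** After about [(1 + k) ^+ 2 * c] steps the potential is at most [expR (- a)]; so is each of its
    terms, which says that [q] is covered [N q] times. *)
Lemma greedy_cover (eta : R) : 0 < eta -> exists2 n0 : R, 0 <= n0 &
  forall (N : C -> R) (c : R), 0 < c -> (forall q, n0 <= N q) ->
  (forall phi : C -> R, (forall q, 0 <= phi q) ->
     (forall S, stab S -> \sum_(q in S) phi q <= 1) ->
     \sum_q phi q * N q <= c) ->
  exists l : seq {set C},
    [/\ (size l)%:R <= (1 + eta) * c + 1, all stab l &
        forall q, N q <= (count (fun S : {set C} => q \in S) l)%:R].
Proof.
move=> eta0; pose k := Num.min 1 (eta / 3).
have k0 : 0 < k by rewrite lt_min ltr01 divr_gt0.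
have k1 : k <= 1 by rewrite ge_min lexx.
have k2 : k <= eta / 3 by rewrite ge_min lexx orbT.
(* Ensures [#|C| <= a * k], so that one surplus factor [1 + k] in the number of steps absorbs the
   initial potential [#|C|]. *)
pose a : R := #|C|%:R / k + 1.
have a0 : 0 < a by rewrite ltr_wpDl// divr_ge0// ltW.
exists (a / k); first by rewrite divr_ge0 ?ltW.
move=> N c c0 Na dual.
have N0 q : 0 < N q by rewrite (lt_le_trans _ (Na q))// divr_gt0.
have step T : exists l, [/\ size l = T, all stab l &
    potential a N l <= #|C|%:R * expR (- (a / (c * (1 + k)))) ^+ T].
  elim: T => [|T [l [sl al pl]]].
    exists [::]; split => //; rewrite expr0 mulr1 /potential.
    under eq_bigr do rewrite /= mulr0 mul0r oppr0 expR0.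
    by rewrite sumr_const.
  have [S sS pS] := potential_step a0 k0 c0 Na dual l.
  exists (S :: l); split => /=; [by rewrite sl|by rewrite sS|].
  apply: (le_trans pS); rewrite exprS mulrCA.
  by rewrite ler_wpM2l ?expR_ge0.
pose x := c * (1 + k) ^+ 2.
have x0 : 0 <= x by rewrite mulr_ge0 ?sqr_ge0 ?ltW.
have [l [sl al pl]] := step (Num.truncn x).+1.
have /andP [tr1 tr2] := truncn_itv x0.
exists l; split => //.
  have kk : k * k <= k by rewrite ger_pMr.
  have k2e : (1 + k) ^+ 2 <= 1 + eta.
    have -> : (1 + k) ^+ 2 = 1 + (2 * k + k * k) by ring.
    lra.
  by rewrite sl -natr1 lerD2r (le_trans tr1)// /x mulrC ler_wpM2r// ltW.
move=> q; rewrite -(@ler_pM2l _ (a / N q)) ?divr_gt0//.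
have -> : a / N q * N q = a by field; rewrite gt_eqF.
suff : expR (- (a * (count (fun S : {set C} => q \in S) l)%:R / N q)) <= expR (- a).
  by rewrite ler_expR lerN2 => h; rewrite (le_trans h)// mulrAC.
apply: (le_trans (y := potential a N l)).
  by rewrite /potential (bigD1 q)//= lerDl sumr_ge0// => j _; exact: expR_ge0.
apply: (le_trans pl).
apply: (le_trans (y := expR #|C|%:R * expR (- (a / (c * (1 + k)))) ^+ (Num.truncn x).+1)).
  rewrite ler_wpM2r ?exprn_ge0 ?expR_ge0//.
  by have := expR_ge1Dx (#|C|%:R : R); lra.
rewrite -expRM_natl -expRD ler_expR.
have k10 : 0 < 1 + k by lra.
have : x * (a / (c * (1 + k))) <= (Num.truncn x).+1%:R * (a / (c * (1 + k))).
  by rewrite ler_wpM2r ?(ltW tr2)// divr_ge0 ?mulr_ge0 ?ltW.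
have -> : x * (a / (c * (1 + k))) = a * (1 + k).
  by rewrite /x; field; rewrite !gt_eqF.
have : #|C|%:R <= a * k.
  by rewrite /a mulrDl divfK ?gt_eqF// mul1r lerDl ltW.
by rewrite mulrN; lra.
Qed.

End GreedyCover.

(** * Boxes and Lebesgue measure *)

Section Boxes.
Context {R : realType} {d : nat}.
Notation V := (d.-tuple R).
Implicit Types (x y a b : V) (A : set V).

Definition cbox a b : set V :=
  [set x | forall i, tnth a i <= tnth x i <= tnth b i].

Definition cube x (h : R) : set V :=
  [set y | forall i, tnth x i <= tnth y i < tnth x i + h].

Definition vcst (c : R) : V := [tuple c | i < d].

Lemma tnth_vadd x y i : tnth (vadd x y) i = tnth x i + tnth y i.
Proof. by rewrite tnth_mktuple. Qed.

Lemma tnth_vsub x y i : tnth (vsub x y) i = tnth x i - tnth y i.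
Proof. by rewrite tnth_mktuple. Qed.

Lemma tnth_vscale c x i : tnth (vscale c x) i = c * tnth x i.
Proof. by rewrite tnth_mktuple. Qed.

Lemma tnth_vcst c i : tnth (vcst c) i = c.
Proof. by rewrite tnth_mktuple. Qed.

Lemma measurable_coords (B : 'I_d -> set R) : (forall i, measurable (B i)) ->
  measurable [set x : V | forall i, B i (tnth x i)].
Proof.
move=> mB.
rewrite (_ : [set x | _] =
  \bigcap_(i in [set: 'I_d]) ((fun x : V => tnth x i) @^-1` B i)); last first.
  by apply/seteqP; split => x /= h i => [_|]; exact: h.
apply: fin_bigcap_measurable => // i _.
by rewrite -[_ @^-1` _]setTI; exact: measurable_tnth.
Qed.

Lemma measurable_cbox a b : measurable (cbox a b).
Proof.
rewrite (_ : cbox a b = [set x | forall i, `[tnth a i, tnth b i]%classic (tnth x i)]).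
  exact: (measurable_coords (B := fun i => `[tnth a i, tnth b i]%classic)).
by apply/seteqP; split => x /= h i; move: (h i); rewrite /= in_itv.
Qed.

Lemma measurable_cube x h : measurable (cube x h).
Proof.
rewrite (_ : cube x h =
  [set y | forall i, `[tnth x i, tnth x i + h[%classic (tnth y i)]).
  exact: (measurable_coords (B := fun i => `[tnth x i, tnth x i + h[%classic)).
by apply/seteqP; split => y /= hy i; move: (hy i); rewrite /= in_itv.
Qed.

(** Induction principle: the half-spaces [b <= tnth x i] generate the product sigma-algebra, because
    rays generate the Borel sets of the line. *)
Lemma measurable_coord_ind (S : set (set V)) : sigma_algebra setT S ->
  (forall i (b : R), S [set x | b <= tnth x i]) ->
  forall A, measurable A -> S A.
Proof.
move=> sS Sray.
suff cl i (B : set R) : measurable B -> S ((fun x : V => tnth x i) @^-1` B).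
  apply: smallest_sub => //.
  apply: (big_ind (fun U => U `<=` S)) => // [U W US WS|i _].
    by rewrite subUset.
  by move=> B [C mC <-]; rewrite setTI; exact: cl.
pose S' := [set B : set R | S ((fun x : V => tnth x i) @^-1` B)].
have [S0 SC SU] := sS.
have sS' : sigma_algebra setT S'.
  split => /=.
  - by rewrite /S' /= preimage_set0.
  - by move=> C SC'; rewrite /S' /= setTD preimage_setC -setTD; exact: SC.
  - by move=> F SF; rewrite /S' /= preimage_bigcup; exact: SU.
move=> mB; suff : S' B by [].
have {mB} : (@RGenCInfty.G R).-sigma.-measurable B by rewrite -RGenCInfty.measurableE.
move: B; apply: smallest_sub => // _ [b ->]; rewrite /S' /=.
have := Sray i b; congr S; apply/seteqP; split => y /=; by rewrite in_itv /= andbT.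
Qed.

(** Closed boxes form a generating pi-system; through this uniqueness, [is_lebesgue], which speaks
    only of boxes, determines [vol]. *)
Lemma eq_measure_cbox (m1 m2 : {measure set V -> \bar R}) :
  (forall a b, (forall i, tnth a i <= tnth b i) -> m1 (cbox a b) = m2 (cbox a b)) ->
  (forall n : nat, m1 (cbox (vcst (- n%:R)) (vcst n%:R)) < +oo)%E ->
  forall A, measurable A -> m1 A = m2 A.
Proof.
move=> m12 mfin.
pose G : set (set V) := [set A | exists a b, A = cbox a b].
apply: (@measure_unique _ _ _ G (fun n : nat => cbox (vcst (- n%:R)) (vcst n%:R))).
- apply/seteqP; split => [A|].
    apply: measurable_coord_ind; first exact: smallest_sigma_algebra.
    move=> i b.
    rewrite (_ : [set x | _] = \bigcup_n cbox
        [tuple if j == i then Num.max b (- n%:R) else - n%:R | j < d] (vcst n%:R)).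
      have [_ _] := smallest_sigma_algebra setT G; apply => n.
      by apply: sub_sigma_algebra; eexists; eexists; reflexivity.
    apply/seteqP; split => x /=.
      move=> bx.
      pose s := \sum_j `|tnth x j|.
      have xs j : `|tnth x j| <= (Num.truncn s).+1%:R.
        apply: (le_trans (y := s)).
          by rewrite /s (bigD1 j)//= lerDl sumr_ge0.
        have s0 : 0 <= s by apply: sumr_ge0.
        by case/andP: (truncn_itv s0) => _ /ltW.
      exists (Num.truncn s).+1 => // j; rewrite tnth_vcst tnth_mktuple.
      have /ler_normlP [h1 h2] := xs j.
      case: (eqVneq j i) => [->|_]; last by apply/andP; split => //; lra.
      by rewrite ge_max bx /=; have /ler_normlP [h3 h4] := xs i; apply/andP; split => //; lra.
    by move=> [n _ /(_ i)]; rewrite tnth_mktuple eqxx ge_max => /andP [/andP [-> _] _].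
  apply: smallest_sub; first exact: sigma_algebra_measurable.
  by move=> _ [a [b ->]]; exact: measurable_cbox.
- move=> _ _ [a [b ->]] [a' [b' ->]].
  exists [tuple Num.max (tnth a i) (tnth a' i) | i < d].
  exists [tuple Num.min (tnth b i) (tnth b' i) | i < d].
  apply/seteqP; split => x /=.
    move=> [h1 h2] i; rewrite !tnth_mktuple ge_max le_min.
    by have /andP [-> ->] := h1 i; have /andP [-> ->] := h2 i.
  move=> h; split => i; move: (h i); rewrite !tnth_mktuple ge_max le_min;
    by move=> /andP [/andP [h1 h2] /andP [h3 h4]]; apply/andP; split.
- by move=> n; exists (vcst (- n%:R)), (vcst n%:R).
- apply/seteqP; split => // x _.
  pose s := \sum_j `|tnth x j|.
  exists (Num.truncn s).+1 => // j; rewrite !tnth_vcst -ler_norml.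
  apply: (le_trans (y := s)).
    by rewrite /s (bigD1 j)//= lerDl sumr_ge0.
  have s0 : 0 <= s by apply: sumr_ge0.
  by case/andP: (truncn_itv s0) => _ /ltW.
- move=> _ [a [b ->]].
  have [ab|/existsNP [i /negP]] := pselect (forall i, tnth a i <= tnth b i); first exact: m12.
  rewrite -ltNge => ba.
  suff -> : cbox a b = set0 by rewrite !measure0.
  by apply/seteqP; split => x //= /(_ i); lra.
- exact: mfin.
Qed.

Lemma measurable_affine x (c : R) :
  measurable_fun [set: V] (fun y : V => vscale c (vsub y x)).
Proof.
apply/measurable_fun_tnthP => i.
rewrite (_ : _ \o _ = fun y : V => c * (tnth y i - tnth x i)); last first.
  by apply/funext => y; rewrite /= tnth_vscale tnth_vsub.
apply: measurable_funM => //; apply: measurable_funB => //.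
exact: measurable_tnth.
Qed.

Section Lebesgue.
Variable vol : {measure set V -> \bar R}.
Hypothesis hvol : is_lebesgue vol.

Lemma vol_cbox a b : (forall i, tnth a i <= tnth b i) ->
  vol (cbox a b) = (\prod_(i < d) (tnth b i - tnth a i))%:E.
Proof. exact: hvol. Qed.

Lemma vol_affine x (r : R) A : 0 < r -> measurable A ->
  vol ((fun y => vscale r^-1 (vsub y x)) @^-1` A) = ((r ^+ d)%:E * vol A)%E.
Proof.
move=> r0 mA.
have mT := measurable_affine x r^-1.
have rd0 : 0 <= r ^+ d by rewrite exprn_ge0 ?ltW.
have := @eq_measure_cbox (pushforward vol (fun y => vscale r^-1 (vsub y x)))
  (mscale (NngNum rd0) vol) _ _ A mA.
suff pre a b : (fun y => vscale r^-1 (vsub y x)) @^-1` (cbox a b) =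
   cbox (vadd x (vscale r a)) (vadd x (vscale r b)).
  apply.
  - move=> a b ab; rewrite /pushforward /mscale /=.
    transitivity (vol (cbox (vadd x (vscale r a)) (vadd x (vscale r b)))).
      by congr (vol _); exact: pre.
    rewrite [RHS](_ : _ = ((r ^+ d)%:E * vol (cbox a b))%E)// !vol_cbox//.
    - rewrite -EFinM -[in r ^+ d](card_ord d) -prodr_const -big_split /=; congr EFin.
      by apply: eq_bigr => i _; rewrite !tnth_vadd !tnth_vscale; ring.
    - by move=> i; rewrite !tnth_vadd !tnth_vscale lerD2l ler_pM2l.
  - move=> n; rewrite [ltLHS](_ : _ = vol
      (cbox (vadd x (vscale r (vcst (- n%:R)))) (vadd x (vscale r (vcst n%:R))))).
    - rewrite vol_cbox ?ltry// => i.
    by rewrite !tnth_vadd !tnth_vscale !tnth_vcst lerD2l ler_pM2l//; have := ler0n R n; lra.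
    by congr (vol _); exact: pre.
apply/seteqP; split => y /= h i; move: (h i); rewrite !tnth_vadd !tnth_vscale tnth_vsub.
  rewrite ler_pdivlMl// ler_pdivrMl// => /andP [? ?]; apply/andP; split; lra.
by rewrite ler_pdivlMl// ler_pdivrMl// => /andP [? ?]; apply/andP; split; lra.
Qed.

(** The half-open cube lies in a closed box of side [h] and contains closed boxes of every smaller
    side, so continuity of [y ^+ d] fixes its volume. *)
Lemma vol_cube x (h : R) : 0 < h -> vol (cube x h) = (h ^+ d)%:E.
Proof.
move=> h0.
have volc y (e : R) : 0 <= e -> vol (cbox y (vadd y (vcst e))) = (e ^+ d)%:E.
  move=> e0; rewrite vol_cbox.
    rewrite -[in RHS](card_ord d) -prodr_const; congr EFin; apply: eq_bigr => i _.
    by rewrite tnth_vadd tnth_vcst; ring.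
  by move=> i; rewrite tnth_vadd tnth_vcst; lra.
have le : (vol (cube x h) <= (h ^+ d)%:E)%E.
  rewrite -(volc x h (ltW h0)); apply: le_measure; rewrite ?inE.
  - exact: measurable_cube.
  - exact: measurable_cbox.
  by move=> y hy i; have /andP [-> /ltW] := hy i; rewrite tnth_vadd tnth_vcst.
apply/eqP; rewrite eq_le le /=.
have fin : vol (cube x h) \is a fin_num.
  by rewrite ge0_fin_numE// (le_lt_trans le) ?ltry.
rewrite -(fineK fin) lee_fin leNgt; apply/negP => lt.
have cont : {for h, continuous (fun y : R => y ^+ d)} by exact: exprn_continuous.
have : \forall y \near h, fine (vol (cube x h)) < y ^+ d by exact: cvgr_gt cont _ lt.
move=> /nbhs_ballP [e /= e0 He].
pose y := h - Num.min (e / 2) (h / 2).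
have m0 : 0 < Num.min (e / 2) (h / 2) by rewrite lt_min !divr_gt0.
have me : Num.min (e / 2) (h / 2) <= e / 2 by rewrite ge_min lexx.
have mh : Num.min (e / 2) (h / 2) <= h / 2 by rewrite ge_min lexx orbT.
have y0 : 0 <= y by rewrite /y; lra.
have := He y; rewrite /ball /= /y opprB addrCA subrr addr0 gtr0_norm// => /(_ _)/wrap[].
  by lra.
rewrite -/y ltNge -lee_fin fineK// -(volc x y y0) => /negP; apply.
apply: le_measure; rewrite ?inE.
- exact: measurable_cbox.
- exact: measurable_cube.
move=> z hz i; have /andP [-> ] := hz i; rewrite tnth_vadd tnth_vcst /= => h1.
by rewrite (le_lt_trans h1)// ltrD2l /y; lra.
Qed.

End Lebesgue.
End Boxes.

(** * Cubes mostly filled by a measurable set *)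

Section DenseCubes.
Context {R : realType} {d : nat}.
Notation V := (d.-tuple R).
Implicit Types (x y a b : V) (A B : set V).

Lemma measure_bigcup_finType d1 (T : measurableType d1)
    (m : {measure set T -> \bar R}) (I : finType) (F : I -> set T) :
  (forall i, measurable (F i)) -> trivIset setT F ->
  m (\bigcup_i F i) = (\sum_i m (F i))%E.
Proof.
move=> mF tF; rewrite measure_fin_bigcup//; last exact: finite_finset.
rewrite (_ : [set: I] = [set` index_enum I]); last first.
  by apply/seteqP; split => i //= _; rewrite mem_index_enum.
by rewrite -fsbig_seq// index_enum_uniq.
Qed.

Lemma mine_lel (x y : \bar R) : (mine x y <= x)%E.
Proof. by rewrite ge_min lexx. Qed.

Lemma mine_ler (x y : \bar R) : (mine x y <= y)%E.
Proof. by rewrite ge_min lexx orbT. Qed.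

Lemma measure_subset d1 (T : measurableType d1) (m : {measure set T -> \bar R})
    (A B : set T) : measurable A -> measurable B -> A `<=` B -> (m A <= m B)%E.
Proof. by move=> mA mB AB; apply: le_measure; rewrite ?inE. Qed.

Definition corner {m : nat} a (h : R) (z : {ffun 'I_d -> 'I_m}) : V :=
  [tuple tnth a i + h * (z i)%:R | i < d].

Lemma corner_trivIset m a (h : R) : 0 < h ->
  trivIset setT (fun z : {ffun 'I_d -> 'I_m} => cube (corner a h z) h).
Proof.
move=> h0; apply/trivIsetP => z z' _ _ zz'.
apply/seteqP; split => x //= -[hx hx'].
have [i] : exists i, z i != z' i.
  by apply/existsP; apply: contraNT zz'; rewrite negb_exists => /forallP e;
     apply/eqP/ffunP => i; apply/eqP; rewrite -[_ == _]negbK; exact: e.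
rewrite -val_eqE neq_ltn /=.
have := hx i; have := hx' i; rewrite !tnth_mktuple.
move=> /andP [h1 h2] /andP [h3 h4] /orP [] lt.
  have : h * (z i).+1%:R <= h * (z' i)%:R by rewrite ler_pM2l// ler_nat.
  by rewrite -natr1 mulrDr mulr1; lra.
have : h * (z' i).+1%:R <= h * (z i)%:R by rewrite ler_pM2l// ler_nat.
by rewrite -natr1 mulrDr mulr1; lra.
Qed.

Lemma bigcup_corner m a (h : R) : 0 < h ->
  \bigcup_(z in [set: {ffun 'I_d -> 'I_m}]) cube (corner a h z) h =
  cube a (h * m%:R).
Proof.
move=> h0; apply/seteqP; split => x /=.
  move=> [z _ hz] i; have := hz i; rewrite tnth_mktuple => /andP [h1 h2].
  have z0 : 0 <= h * (z i)%:R by rewrite mulr_ge0// ltW.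
  have zm : h * (z i).+1%:R <= h * m%:R by rewrite ler_pM2l// ler_nat.
  by move: zm; rewrite -natr1 mulrDr mulr1 => zm; apply/andP; split; lra.
move=> hx.
have ub i : (Num.truncn ((tnth x i - tnth a i) / h) < m)%N.
  have /andP [h1 h2] := hx i.
  have u0 : 0 <= (tnth x i - tnth a i) / h by rewrite divr_ge0 ?subr_ge0// ltW.
  have /andP [t1 t2] := truncn_itv u0.
  rewrite -(ltr_nat R) (le_lt_trans t1)// ltr_pdivrMr// mulrC; lra.
exists [ffun i => Ordinal (ub i)] => // i.
rewrite tnth_mktuple ffunE /=.
have /andP [h1 h2] := hx i.
have u0 : 0 <= (tnth x i - tnth a i) / h by rewrite divr_ge0 ?subr_ge0// ltW.
have /andP [] := truncn_itv u0.
rewrite ler_pdivlMr// ltr_pdivrMr// -natr1; set t := _%:R => t1 t2.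
by apply/andP; split; lra.
Qed.

Variable vol : {measure set V -> \bar R}.
Hypothesis hvol : is_lebesgue vol.

(** * Vanishing impurity of fine grids *)

Section Impurity.
Variable L : R.
Hypothesis L0 : 0 < L.

(* [h * ncells h] lies between [2 * L] and [2 * L + h], so the cells of side [h]
   with lower corner [(- L, .., - L)] cover [[- L, L)^d] *)
Let ncells (h : R) : nat := (Num.truncn (2 * L / h)).+1.

Let ncells_bounds (h : R) : 0 < h ->
  2 * L <= h * (ncells h)%:R <= 2 * L + h.
Proof.
move=> h0; have u0 : 0 <= 2 * L / h by rewrite divr_ge0 ?mulr_ge0 ?ltW.
have /andP [] := truncn_itv u0; rewrite /ncells.
rewrite ler_pdivlMr// ltr_pdivrMr// -natr1; set t := (Num.truncn _)%:R => t1 t2.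
by apply/andP; split; lra.
Qed.

Let cell (h : R) (z : {ffun 'I_d -> 'I_(ncells h)}) : set V :=
  cube (corner (vcst (- L)) h z) h.

Let mcell h z : measurable (@cell h z). Proof. exact: measurable_cube. Qed.

(** The volume on the minority side, cell by cell: when it is small, most cells are almost inside
    [A] or almost outside. *)
Let impurity (h : R) A : \bar R :=
  (\sum_(z : {ffun 'I_d -> 'I_(ncells h)})
     mine (vol (A `&` cell z)) (vol (cell z `\` A)))%E.

(** One cube of finite volume containing the cells of every grid with [h < 1]. *)
Let Q : set V := cube (vcst (- L)) (2 * L + 1).

Let sum_cell_le (h : R) B : 0 < h < 1 -> measurable B ->
  (\sum_(z : {ffun 'I_d -> 'I_(ncells h)}) vol (B `&` cell z) <= vol (B `&` Q))%E.
Proof.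
move=> /andP [h0 h1] mB.
rewrite -measure_bigcup_finType; first last.
- by apply: trivIset_setIl; exact: corner_trivIset.
- by move=> z; exact: measurableI.
apply: le_measure; rewrite ?inE.
- by apply: fin_bigcup_measurable => // z _; exact: measurableI.
- by apply: measurableI => //; exact: measurable_cube.
rewrite -setI_bigcupr; apply: setIS.
rewrite /cell bigcup_corner// => x hx i; have := hx i.
by rewrite tnth_vcst; have /andP [] := ncells_bounds h0 => ? ? /andP [? ?]; apply/andP; split; lra.
Qed.

Let volQ : (vol Q < +oo)%E.
Proof. by have L0' := L0; rewrite /Q vol_cube ?ltry//; lra. Qed.

(** These sets form a sigma-algebra containing the half-spaces, so all measurable sets are among
    them. The argument plays the part of the Lebesgue density theorem. *)
Let pure : set (set V) := [set A | measurable A /\ forall e : R, 0 < e ->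
  exists2 h0 : R, 0 < h0 & forall h, 0 < h < h0 -> (impurity h A <= e%:E)%E].

Let pure_setC A : pure A -> pure (~` A).
Proof.
move=> [mA pA]; split; first exact: measurableC.
move=> e e0; have [h0 h00 H] := pA e e0; exists h0 => // h hh.
rewrite (le_trans _ (H h hh))//; apply: lee_sum => z _.
by rewrite [~` A `&` _]setIC -setDE [X in mine _ (vol X)]setDE setCK [X in mine _ (vol X)]setIC minC.
Qed.

Let impurityU h A B : measurable A -> measurable B ->
  (impurity h (A `|` B) <= impurity h A + impurity h B)%E.
Proof.
move=> mA mB; rewrite /impurity -big_split /=; apply: lee_sum => z _.
have mc := mcell z.
have step1 : (vol (cell z `\` (A `|` B)) <= vol (cell z `\` A))%E.
  apply: measure_subset; [by apply: measurableD => //; exact: measurableU|exact: measurableD|].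
  by move=> x [cx nx]; split => // Ax; apply: nx; left.
have step2 : (vol (cell z `\` (A `|` B)) <= vol (cell z `\` B))%E.
  apply: measure_subset; [by apply: measurableD => //; exact: measurableU|exact: measurableD|].
  by move=> x [cx nx]; split => // Ax; apply: nx; right.
have step3 : (vol ((A `|` B) `&` cell z) <= vol (A `&` cell z) + vol (B `&` cell z))%E.
  rewrite setIUl measureU2//; exact: measurableI.
case: (leP (vol (A `&` cell z)) (vol (cell z `\` A))) => hA; last first.
  rewrite (le_trans (mine_ler _ _))// (le_trans step1)// leeDl//.
case: (leP (vol (B `&` cell z)) (vol (cell z `\` B))) => hB.
  by rewrite (le_trans (mine_lel _ _)).
by rewrite (le_trans (mine_ler _ _))// (le_trans step2)// leeDr// measure_ge0.
Qed.

Let pureU A B : pure A -> pure B -> pure (A `|` B).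
Proof.
move=> [mA pA] [mB pB]; split; first exact: measurableU.
move=> e e0; have e20 : 0 < e / 2 by rewrite divr_gt0.
have [h1 h10 H1] := pA _ e20; have [h2 h20 H2] := pB _ e20.
exists (Num.min h1 h2); first by rewrite lt_min h10.
move=> h; rewrite lt_min => /and3P [h0 hh1 hh2].
rewrite (le_trans (impurityU _ _ _))// (splitr e) EFinD leeD//.
  by apply: H1; rewrite h0.
by apply: H2; rewrite h0.
Qed.

Let pure0 : pure set0.
Proof.
split => // e e0; exists 1 => // h _; rewrite /impurity big1 ?lee_fin ?ltW// => z _.
by rewrite set0I measure0; apply/min_idPl; exact: measure_ge0.
Qed.

(** A finite partial union is pure, and what it misses inside [Q] has volume tending to 0 by
    continuity from above. *)
Let pure_bigcup (F : (set V)^nat) : (forall n, pure (F n)) -> pure (\bigcup_n F n).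
Proof.
move=> pF; have mF n : measurable (F n) by have [] := pF n.
have mU : measurable (\bigcup_n F n) by exact: bigcup_measurable.
split => // e e0; have e20 : 0 < e / 2 by rewrite divr_gt0.
pose G n : set V := \big[setU/set0]_(i < n) F i.
have pG n : pure (G n).
  by rewrite /G; elim/big_ind : _ => //; exact: pureU.
have mG n : measurable (G n) by have [] := pG n.
pose D n := ((\bigcup_n F n) `\` G n) `&` Q.
have mD n : measurable (D n).
  by apply: measurableI; [exact: measurableD|exact: measurable_cube].
have D0 : (vol \o D) n @[n --> \oo] --> vol (\bigcap_n D n).
  apply: nonincreasing_cvg_mu => //.
  - apply: le_lt_trans volQ; apply: measure_subset => //; first exact: measurable_cube.
    by move=> x [].
  - exact: bigcapT_measurable.
  - move=> n m nm; apply/subsetPset => x [[Ux nGx] Qx]; split => //; split => //.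
    by apply: contra_not nGx; apply: (subset_bigsetU_cond (P := xpredT)).
have {}D0 : (vol \o D) n @[n --> \oo] --> 0%E.
  suff D00 : \bigcap_n D n = set0 by rewrite D00 measure0 in D0.
  apply/seteqP; split => x //= Dx; have [[[n _ Fx] _] _] := Dx 0%N I.
  have [[_ nG] _] := Dx n.+1 I; apply: nG.
  by rewrite /G big_ord_recr /=; right.
have [n Hn] : exists n, (vol (D n) <= (e / 2)%:E)%E.
  have : \forall n \near \oo, ((vol \o D) n < (e / 2)%:E)%E.
    by apply: (D0 [set u | (u < (e / 2)%:E)%E]); apply: open_ereal_lt'; rewrite lte_fin.
  by move=> [n _ H]; exists n; apply: ltW; exact: H (leqnn n).
have [_ /(_ _ e20) [h1 h10 H1]] := pG n.
exists (Num.min h1 1); first by rewrite lt_min h10 ltr01.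
move=> h; rewrite lt_min => /and3P [h0 hh1 hh2].
rewrite (splitr e) EFinD; apply: (le_trans (y := impurity h (G n) + vol (D n))%E); last first.
  by apply: leeD => //; apply: H1; rewrite h0.
apply: (le_trans (y := impurity h (G n) +
   \sum_(z : {ffun 'I_d -> 'I_(ncells h)}) vol (((\bigcup_n F n) `\` G n) `&` cell z))%E); last first.
  by rewrite leeD2l//; apply: sum_cell_le; [rewrite h0|exact: measurableD].
rewrite /impurity -big_split /=; apply: lee_sum => z _.
have mc := mcell z.
have GU : G n `<=` \bigcup_n F n.
  by rewrite /G => x; rewrite -bigcup_mkord => -[i _ Fx]; exists i.
rewrite {2}/mine; case: ltP => hA.
  rewrite (le_trans (mine_lel _ _))//.
  apply: le_trans (measureU2 _ _ _); [|exact: measurableI|by apply: measurableI => //; exact: measurableD].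
  apply: le_measure; rewrite ?inE.
  - exact: measurableI.
  - by apply: measurableU; apply: measurableI => //; exact: measurableD.
  move=> x [Ux cx]; have [Gx|nGx] := pselect (G n x); [by left|by right].
rewrite (le_trans (mine_ler _ _))//.
apply: (le_trans (y := vol (cell z `\` G n))); last by rewrite leeDl// measure_ge0.
apply: measure_subset; [exact: measurableD|exact: measurableD|].
by move=> x [cx nU]; split => // Gx; apply: nU; exact: GU.
Qed.

(** Only cells crossing the bounding hyperplane contribute. They lie in a slab of thickness [2 * h]
    and cross-section at most [C]. *)
Let pure_ray i (b : R) : pure [set x | b <= tnth x i].
Proof.
split.
  rewrite (_ : [set x | _] = (fun x : V => tnth x i) @^-1` `[b, +oo[%classic).
    by rewrite -[_ @^-1` _]setTI; exact: measurable_tnth.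
  by apply/seteqP; split => x /=; rewrite in_itv /= andbT.
move=> e e0; pose C := (2 * L + 1) ^+ d.-1.
have L0' := L0.
have C0 : 0 < C by rewrite exprn_gt0//; lra.
pose h0 := Num.min 1 (e / (2 * C)).
have h00 : 0 < h0 by rewrite lt_min ltr01 divr_gt0// mulr_gt0.
exists h0 => // h /andP [hp]; rewrite lt_min => /andP [h1 he].
pose lo : V := [tuple if j == i then b - h else - L | j < d].
pose hi : V := [tuple if j == i then b + h else L + 1 | j < d].
have mlh : measurable (cbox lo hi) by exact: measurable_cbox.
pose slab : set V := [set x | b - h <= tnth x i <= b + h].
have mslab : measurable slab.
  rewrite (_ : slab = (fun x : V => tnth x i) @^-1` `[b - h, b + h]%classic).
    by rewrite -[_ @^-1` _]setTI; exact: measurable_tnth.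
  by apply/seteqP; split => x /=; rewrite in_itv.
apply: (le_trans (y := vol (slab `&` Q))).
  have hh : 0 < h < 1 by rewrite hp.
  apply: le_trans (sum_cell_le hh mslab).
  apply: lee_sum => z _.
  have mc := mcell z.
  pose zi : R := - L + h * (z i)%:R.
  have czi x : cell z x -> zi <= tnth x i < zi + h.
    by move=> /(_ i); rewrite tnth_mktuple tnth_vcst.
  have [h2|h2] := lerP b zi.
    rewrite (le_trans (mine_ler _ _))// [X in vol X](_ : _ = set0) ?measure0//.
    apply/seteqP; split => x //= -[cx]; apply; have /andP [? ?] := czi _ cx; lra.
  have [h3|h3] := lerP (zi + h) b.
    rewrite (le_trans (mine_lel _ _))// [X in vol X](_ : _ = set0) ?measure0//.
    by apply/seteqP; split => x //= -[bx cx]; have /andP [? ?] := czi _ cx; lra.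
  rewrite (le_trans (mine_lel _ _))//; apply: le_measure; rewrite ?inE.
  - apply: measurableI => //.
    rewrite (_ : [set x | _] = (fun x : V => tnth x i) @^-1` `[b, +oo[%classic).
      by rewrite -[_ @^-1` _]setTI; exact: measurable_tnth.
    by apply/seteqP; split => x /=; rewrite in_itv /= andbT.
  - exact: measurableI.
  move=> x [_ cx]; split => //; have /andP [? ?] := czi _ cx.
  by apply/andP; split; lra.
apply: (le_trans (y := vol (cbox lo hi))).
  apply: le_measure; rewrite ?inE//; first by apply: measurableI => //; exact: measurable_cube.
  move=> x [sx Qx] j; rewrite !tnth_mktuple.
  case: eqVneq => [->//|_]; have := Qx j; rewrite tnth_vcst => /andP [? ?].
  by apply/andP; split; lra.
rewrite vol_cbox//; last first.
  by move=> j; rewrite !tnth_mktuple; case: eqVneq => _; lra.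
rewrite lee_fin (bigD1 i)//= !tnth_mktuple eqxx.
rewrite (eq_bigr (fun=> 2 * L + 1)); last first.
  by move=> j /negbTE ji; rewrite !tnth_mktuple ji; lra.
rewrite prodr_const.
have -> : #|[pred j : 'I_d | j != i]| = d.-1.
  by rewrite cardC1 card_ord.
rewrite -/C; move: he; rewrite ltr_pdivlMr ?mulr_gt0//.
have -> : b + h - (b - h) = 2 * h by ring.
by move=> he; lra.
Qed.

Lemma impurity_cvg A : measurable A -> pure A.
Proof.
apply: measurable_coord_ind; last exact: pure_ray.
by split; [exact: pure0|move=> B pB; rewrite setTD; exact: pure_setC|exact: pure_bigcup].
Qed.

Lemma dense_cubes_in A (kappa : R) : measurable A -> 0 < kappa ->
  (0 < vol (A `&` cube (vcst (- L)) (2 * L)))%E ->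
  exists2 c : R, 0 < c & exists2 h0 : R, 0 < h0 & forall h, 0 < h < h0 ->
  exists (M : nat) (x : 'I_M -> V),
    [/\ c <= M%:R * h ^+ d,
        (forall j, (vol (cube (x j) h `\` A) <= (kappa * h ^+ d)%:E)%E) &
        trivIset setT (fun j => cube (x j) h)].
Proof.
move=> mA k0 vA; set Q0 := cube _ _ in vA.
have L0' := L0.
have mQ0 : measurable Q0 by exact: measurable_cube.
have finA : vol (A `&` Q0) \is a fin_num.
  rewrite ge0_fin_numE//; apply: (le_lt_trans (y := vol Q0)).
    by apply: measure_subset => //; exact: measurableI.
  by rewrite /Q0 vol_cube ?ltry//; lra.
pose v := fine (vol (A `&` Q0)).
have v0 : 0 < v by rewrite fine_gt0// vA /= -ge0_fin_numE.
(* Then [(1 + kappa^-1) * eta = v / 2]: the bad cells hold at most half of the volume [v]. *)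
pose eta := v / 2 / (1 + kappa^-1).
have ki : 0 < kappa^-1 by rewrite invr_gt0.
have eta0 : 0 < eta by rewrite !divr_gt0//; lra.
have [_ /(_ _ eta0) [h0 h00 H]] := impurity_cvg mA.
exists (v / 2); first by rewrite divr_gt0.
exists (Num.min h0 1); first by rewrite lt_min h00 ltr01.
move=> h /andP [hp]; rewrite lt_min => /andP [hh0 hh1].
have {}H : (impurity h A <= eta%:E)%E by apply: H; rewrite hp.
have hd0 : 0 < h ^+ d by rewrite exprn_gt0.
pose gd := [set z : {ffun 'I_d -> 'I_(ncells h)} |
   `[< (vol (cell z `\` A) <= (kappa * h ^+ d)%:E)%E >]]%SET.
exists #|gd|, (fun j => corner (vcst (- L)) h (enum_val j)); split; last 2 first.
- by move=> j; have := enum_valP j; rewrite inE => /asboolP.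
- apply/trivIsetP => j j' _ _ jj'.
  have /trivIsetP := @corner_trivIset (ncells h) (vcst (- L)) h hp.
  by apply => //; apply: contra_neq jj' => /enum_val_inj.
have cellE z : vol (@cell h z) = (h ^+ d)%:E by rewrite /cell vol_cube.
have vle : (v%:E <= \sum_(z : {ffun 'I_d -> 'I_(ncells h)}) vol (A `&` cell z))%E.
  rewrite fineK// -measure_bigcup_finType; first last.
  - by apply: trivIset_setIl; exact: corner_trivIset.
  - by move=> z; exact: measurableI.
  apply: measure_subset; [exact: measurableI| |].
    by apply: fin_bigcup_measurable => // z _; exact: measurableI.
  rewrite -setI_bigcupr; apply: setIS; rewrite /cell bigcup_corner// => x hx i.
  have := hx i; rewrite !tnth_vcst; have /andP [] := ncells_bounds hp => ? ? /andP [? ?].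
  by apply/andP; split; lra.
(* In a bad cell the part outside [A] exceeds [kappa * h ^+ d], so the part inside is at most
   [1 + kappa^-1] times the smaller of the two. *)
have bound z : (vol (A `&` @cell h z) <= (if z \in gd then h ^+ d else 0)%:E +
   (1 + kappa^-1)%:E * mine (vol (A `&` cell z)) (vol (cell z `\` A)))%E.
  have m0 : (0 <= mine (vol (A `&` @cell h z)) (vol (cell z `\` A)))%E.
    by rewrite le_min !measure_ge0.
  have leh : (vol (A `&` cell z) <= (h ^+ d)%:E)%E.
    by rewrite -(cellE z); apply: measure_subset => //; exact: measurableI.
  case: ifPn => zg.
    by rewrite (le_trans leh)// leeDl// mule_ge0// lee_fin; lra.
  rewrite add0e; move: zg; rewrite inE => /asboolPn /negP; rewrite -ltNge => zg.
  case: (leP (vol (A `&` cell z)) (vol (cell z `\` A))) => hA.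
    by rewrite -[leLHS]mul1e lee_wpmul2r ?measure_ge0// lee_fin; lra.
  apply: (le_trans leh); apply: (le_trans (y := ((1 + kappa^-1)%:E * (kappa * h ^+ d)%:E)%E)).
    rewrite -EFinM lee_fin mulrA mulrDl mul1r mulVf ?gt_eqF//.
    by rewrite mulrDl mul1r lerDr mulr_ge0// ltW.
  by rewrite lee_wpmul2l ?(ltW zg)// lee_fin; lra.
have : (v%:E <= (#|gd|%:R * h ^+ d)%:E + (1 + kappa^-1)%:E * eta%:E)%E.
  apply: (le_trans vle); apply: (le_trans (lee_sum _ (fun z _ => bound z))).
  rewrite big_split /= leeD//.
    by rewrite sumEFin lee_fin -big_mkcond /= sumr_const mulr_natl.
  rewrite -ge0_sume_distrr; last by move=> z _; rewrite le_min !measure_ge0.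
  by rewrite lee_wpmul2l// lee_fin; lra.
rewrite -EFinM -EFinD lee_fin.
have -> : (1 + kappa^-1) * eta = v / 2.
  by rewrite /eta mulrC divfK// gt_eqF//; lra.
lra.
Qed.

End Impurity.

Lemma dense_cubes A (kappa : R) : measurable A -> 0 < kappa -> (0 < vol A)%E ->
  exists2 c : R, 0 < c & exists2 h0 : R, 0 < h0 & forall h, 0 < h < h0 ->
  exists (M : nat) (x : 'I_M -> V),
    [/\ c <= M%:R * h ^+ d,
        (forall j, (vol (cube (x j) h `\` A) <= (kappa * h ^+ d)%:E)%E) &
        trivIset setT (fun j => cube (x j) h)].
Proof.
move=> mA k0 vA.
pose B (n : nat) := A `&` cube (vcst (- n.+1%:R)) (2 * n.+1%:R).
have mB n : measurable (B n) by apply: measurableI => //; exact: measurable_cube.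
suff [n vB] : exists n, (0 < vol (B n))%E.
  by apply: (dense_cubes_in (L := n.+1%:R)).
apply: contrapT => /forallNP B0.
suff : vol A = 0%E by move=> A0; rewrite A0 ltxx in vA.
apply/eqP; rewrite eq_le measure_ge0 andbT.
apply: (@le_trans _ _ (\sum_(0 <= i <oo) vol (B i))%E).
  rewrite [X in vol X](_ : _ = \bigcup_n B n).
    by apply: le_mu_bigcup => //; exact: bigcup_measurable.
  apply/seteqP; split => [x Ax|x [n _ []]//].
  pose s := \sum_j `|tnth x j|.
  have s0 : 0 <= s by apply: sumr_ge0.
  exists (Num.truncn s) => //; split => // i; rewrite tnth_vcst.
  have xs : `|tnth x i| < (Num.truncn s).+1%:R.
    apply: (le_lt_trans (y := s)); last by case/andP: (truncn_itv s0).
    by rewrite /s (bigD1 i)//= lerDl sumr_ge0.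
  by move: xs; rewrite ltr_norml => /andP [? ?]; apply/andP; split; lra.
rewrite eseries0// => i _ _; apply/eqP; rewrite eq_le measure_ge0 andbT.
by rewrite leNgt; apply/negP/B0.
Qed.

End DenseCubes.

(** * The weighted integral *)

Section ExpInequalities.
Context {R : realType}.
Implicit Types (x y : R).

Lemma HfunE y : Hfun (expR y) = y * expR y - expR y + 1.
Proof. by rewrite /Hfun expRK mulrC. Qed.

Lemma expR_sub1_le y : expR y - 1 <= y * expR y.
Proof.
have : expR (- y) * expR y = 1 by rewrite -expRD addNr expR0.
have := expR_ge1Dx (- y); have := expR_gt0 y; nra.
Qed.

(** Quadratic growth is what makes the entropy integral reach every positive value. *)
Lemma Hfun_expR_ge y : 0 <= y -> y ^+ 2 / 4 <= Hfun (expR y).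
Proof.
move=> y0; rewrite HfunE.
have -> : expR y = expR (y / 2) ^+ 2 by rewrite expr2 -expRD; congr expR; lra.
have := expR_sub1_le (y / 2); have := expR_ge1Dx (y / 2).
set E := expR _ => E1 E2.
have : 0 <= (y / 2) * E * (E - 1 - y / 2) by rewrite !mulr_ge0//; lra.
nra.
Qed.

Lemma Hfun_expR_le y : 0 <= y -> Hfun (expR y) <= y * expR y.
Proof. by move=> y0; rewrite HfunE; have := expR_ge1Dx y; lra. Qed.

Lemma Hfun_expR_lip x y : 0 <= x <= y ->
  0 <= Hfun (expR y) - Hfun (expR x) <= (1 + y) * expR y * (y - x).
Proof.
move=> /andP [x0 xy]; rewrite !HfunE.
have Ey := expR_gt0 y; have Ex := expR_gt0 x.
have m : expR x <= expR y by rewrite ler_expR.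
have E1 : expR y * (1 + (x - y)) <= expR x.
  rewrite (_ : expR x = expR y * expR (x - y)) ?ler_wpM2l ?expR_ge1Dx// ?ltW//.
  by rewrite -expRD; congr expR; ring.
have E2 : expR x * (1 + (y - x)) <= expR y.
  rewrite (_ : expR y = expR x * expR (y - x)) ?ler_wpM2l ?expR_ge1Dx// ?ltW//.
  by rewrite -expRD; congr expR; ring.
apply/andP; split.
  have [y1|y1] := lerP 1 y; first by nra.
  have [x1|x1] := lerP 1 x; by nra.
have [x1|x1] := lerP 1 x; first by nra.
by nra.
Qed.

End ExpInequalities.

(** A Lipschitz bound is obtained pointwise under the integral sign, and replaces a continuity
    theorem for integrals with a parameter. *)
Lemma lipschitz_IVT {R : realType} (G : R -> R) (S K v : R) : 0 <= S -> 0 < K ->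
  (forall s u, 0 <= s <= u -> u <= S -> `|G u - G s| <= K * (u - s)) ->
  G 0 <= v <= G S -> exists2 s, 0 <= s <= S & G s = v.
Proof.
move=> S0 K0 lip /andP [v0 vS].
have [|||s] := @IVT R G 0 S v; [done| | |by rewrite in_itv/=; exists s].
  apply/subspace_continuousP => x /=; rewrite in_itv /= => /andP [x0 xS].
  apply/cvgrPdist_le => e e0; rewrite near_withinE; apply/nbhs_ballP.
  exists (e / K) => /=; first by rewrite divr_gt0.
  move=> y; rewrite /ball /= ltr_pdivlMr// in_itv /= => xy /andP [y0 yS].
  apply: le_trans (ltW xy); rewrite mulrC.
  have [le|lt] := lerP x y.
    by change (`|G x - G y| <= K * (y - x)); rewrite distrC; apply: lip; rewrite ?x0.
  by change (`|G x - G y| <= K * (x - y)); apply: lip => //; rewrite y0 ltW.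
by rewrite ge_min v0 /= le_max vS orbT.
Qed.

Section Xi.
Context {R : realType} {d : nat}.
Notation V := (d.-tuple R).
Variable vol : {measure set V -> \bar R}.

Section OneFunction.
Variable phi : V -> R.
Hypothesis mphi : measurable_fun setT phi.
Hypothesis phi01 : forall x, 0 <= phi x <= 1.
Hypothesis Iphi : vol.-integrable setT (EFin \o phi).

Let phi0 x : 0 <= phi x. Proof. by case/andP: (phi01 x). Qed.

Let phi1 x : phi x <= 1. Proof. by case/andP: (phi01 x). Qed.

(** The logarithm of the moment generating function of the sum of [phi] over a Poisson process of
    intensity [vol]. [tilted_mean] is its derivative, and [tilted_entropy] the relative entropy of
    the tilt, that is, the Legendre transform at that mean. *)
Definition logmgf (s : R) : R := (\int[vol]_x (expR (s * phi x) - 1))%R.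
Definition tilted_mean (s : R) : R := (\int[vol]_x (phi x * expR (s * phi x)))%R.
Definition tilted_entropy (s : R) : R := (\int[vol]_x Hfun (expR (s * phi x)))%R.

Lemma integrable_dominated (g : V -> R) (C : R) : measurable_fun setT g ->
  (forall x, `|g x| <= C * phi x) -> vol.-integrable setT (EFin \o g).
Proof.
move=> mg gC.
have IC : vol.-integrable setT (fun x => C%:E * (EFin \o phi) x)%E.
  exact: integrableZl.
apply: (@le_integrable _ _ _ vol setT measurableT (EFin \o g) _ _ _ IC).
- exact: measurableT_comp.
- move=> x _; by rewrite /= lee_fin (le_trans (gC x))// ler_norm.
Qed.

Let measurable_exp (s : R) : measurable_fun setT (fun x => expR (s * phi x)).
Proof. by apply: measurableT_comp => //; exact: measurable_funM. Qed.

Let expR_le s x : 0 <= s -> expR (s * phi x) <= expR s.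
Proof. by move=> s0; rewrite ler_expR ler_piMr. Qed.

Let expR_ge1 s x : 0 <= s -> 1 <= expR (s * phi x).
Proof. by move=> s0; rewrite -expR0 ler_expR mulr_ge0. Qed.

Lemma integrable_logmgf s : 0 <= s ->
  vol.-integrable setT (EFin \o (fun x => expR (s * phi x) - 1)).
Proof.
move=> s0; apply: (integrable_dominated (C := s * expR s)).
  exact: measurable_funB.
move=> x; have e1 := expR_ge1 x s0.
rewrite ger0_norm ?subr_ge0// (le_trans (expR_sub1_le _))// mulrAC.
by rewrite ler_wpM2r// ler_wpM2l// expR_le.
Qed.

Lemma integrable_tilted_mean s : 0 <= s ->
  vol.-integrable setT (EFin \o (fun x => phi x * expR (s * phi x))).
Proof.
move=> s0; apply: (integrable_dominated (C := expR s)).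
  exact: measurable_funM.
move=> x; rewrite ger0_norm ?mulr_ge0 ?expR_ge0// mulrC.
by rewrite ler_wpM2r// expR_le.
Qed.

Lemma integrable_tilted_entropy s : 0 <= s ->
  vol.-integrable setT (EFin \o (fun x => Hfun (expR (s * phi x)))).
Proof.
move=> s0; apply: (integrable_dominated (C := s * expR s)).
  rewrite (_ : (fun x => _) =
    (fun x => s * phi x * expR (s * phi x) - expR (s * phi x) + 1)); last first.
    by apply/funext => x; rewrite HfunE.
  apply: measurable_funD => //; apply: measurable_funB => //.
  by apply: measurable_funM => //; exact: measurable_funM.
move=> x; have sp : 0 <= s * phi x by rewrite mulr_ge0.
rewrite ger0_norm; last by rewrite (le_trans _ (Hfun_expR_ge sp))// divr_ge0// sqr_ge0.
rewrite (le_trans (Hfun_expR_le sp))// mulrAC.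
by rewrite ler_wpM2r// ler_wpM2l// expR_le.
Qed.

Lemma tilted_identity s : 0 <= s -> s * tilted_mean s = logmgf s + tilted_entropy s.
Proof.
move=> s0; rewrite -RintegralZl//; last exact: integrable_tilted_mean.
rewrite -RintegralD//; [|exact: integrable_logmgf|exact: integrable_tilted_entropy].
by apply: eq_Rintegral => x _; rewrite HfunE; ring.
Qed.

(** Tangent inequality for [expR (u * phi x)] at [u = s], integrated. It makes the parameter in the
    definition of [xi] a minimiser. *)
Lemma tilted_convex s u : 0 <= s -> 0 <= u ->
  u * tilted_mean s <= logmgf u + tilted_entropy s.
Proof.
move=> s0 u0; rewrite -RintegralZl//; last exact: integrable_tilted_mean.
rewrite -RintegralD//; [|exact: integrable_logmgf|exact: integrable_tilted_entropy].
apply: le_Rintegral => //.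
- by apply: (@integrableZl _ _ _ vol setT _ u (EFin \o _)) => //; exact: integrable_tilted_mean.
- apply: (@integrableD _ _ _ vol setT measurableT (EFin \o _) (EFin \o _)); [exact: integrable_logmgf|exact: integrable_tilted_entropy].
move=> x _; rewrite HfunE.
have -> : expR (u * phi x) = expR (s * phi x) * expR ((u - s) * phi x).
  by rewrite -expRD; congr expR; ring.
have : expR (s * phi x) * (1 + (u - s) * phi x) <=
    expR (s * phi x) * expR ((u - s) * phi x).
  by rewrite ler_wpM2l ?expR_ge0// expR_ge1Dx.
lra.
Qed.

Lemma logmgf_ge s : 0 <= s -> s * (\int[vol]_x phi x)%R <= logmgf s.
Proof.
move=> s0; rewrite -RintegralZl//; apply: le_Rintegral => //.
- exact: (@integrableZl _ _ _ vol setT _ s (EFin \o phi)).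
- exact: integrable_logmgf.
by move=> x _; have := expR_ge1Dx (s * phi x); lra.
Qed.

Lemma logmgf_le s : 0 <= s -> logmgf s <= s * expR s * (\int[vol]_x phi x)%R.
Proof.
move=> s0; rewrite -RintegralZl//; apply: le_Rintegral => //.
- exact: integrable_logmgf.
- exact: (@integrableZl _ _ _ vol setT _ (s * expR s) (EFin \o phi)).
move=> x _; rewrite (le_trans (expR_sub1_le _))// mulrAC.
by rewrite ler_wpM2r// ler_wpM2l// expR_le.
Qed.

Lemma logmgf_ge0 s : 0 <= s -> 0 <= logmgf s.
Proof. by move=> s0; apply: Rintegral_ge0 => x _; rewrite subr_ge0 expR_ge1. Qed.

Let tilted_entropy_lip s u : 0 <= s <= u ->
  0 <= tilted_entropy u - tilted_entropy s <=
    (1 + u) * expR u * (\int[vol]_x phi x)%R * (u - s).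
Proof.
move=> /andP [s0 su]; have u0 := le_trans s0 su.
have Is := integrable_tilted_entropy s0; have Iu := integrable_tilted_entropy u0.
rewrite -RintegralB//.
have lip x : 0 <= Hfun (expR (u * phi x)) - Hfun (expR (s * phi x)) <=
    ((1 + u) * expR u * (u - s)) * phi x.
  have sup : 0 <= s * phi x <= u * phi x by rewrite mulr_ge0// ler_wpM2r.
  have /andP [-> /= h] := Hfun_expR_lip sup.
  apply: (le_trans h); rewrite -mulrBl mulrA ler_wpM2r//.
  rewrite ler_wpM2r ?subr_ge0// ler_pM ?expR_ge0 ?expR_le//.
    by rewrite addr_ge0// mulr_ge0.
  by rewrite lerD2l ler_piMr.
apply/andP; split; first by apply: Rintegral_ge0 => x _; case/andP: (lip x).
rewrite mulrAC -RintegralZl//; apply: le_Rintegral => //.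
- exact: (@integrableB _ _ _ vol setT measurableT (EFin \o _) (EFin \o _)).
- exact: (@integrableZl _ _ _ vol setT _ _ (EFin \o phi)).
by move=> x _; case/andP: (lip x).
Qed.

Hypothesis I0 : 0 < (\int[vol]_x phi x)%R.

Let int_sqr_gt0 : 0 < (\int[vol]_x (phi x ^+ 2))%R.
Proof.
rewrite lt_neqAle Rintegral_ge0 ?andbT; last by move=> x _; exact: sqr_ge0.
apply/eqP => e0; move: I0; apply/negP; rewrite -leNgt.
have I2 : vol.-integrable setT (EFin \o (fun x => phi x ^+ 2)).
  apply: (integrable_dominated (C := 1)); first exact: measurable_funX.
  by move=> x; rewrite ger0_norm ?sqr_ge0// expr2 ler_wpM2r.
have : ae_eq vol setT (EFin \o (fun x => phi x ^+ 2)) (cst 0%E).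
  apply/ae_eq_integral_abs => //; first by case/integrableP: I2.
  rewrite -[RHS]/(0%:E) e0 /Rintegral fineK ?integrable_fin_num//.
  by apply: eq_integral => x _ /=; rewrite ger0_norm// sqr_ge0.
move=> ae0.
have ae1 : ae_eq vol setT (EFin \o phi) (cst 0%E).
  apply: filterS ae0 => x /= h _; have := h I => -[] /eqP.
  by rewrite sqrf_eq0 => /eqP ->.
rewrite /Rintegral (@ae_eq_integral _ _ _ vol setT (cst 0%E) (EFin \o phi))//.
  by rewrite integral_cst// mul0e.
by case/integrableP: Iphi.
Qed.

Lemma tilted_entropy_onto (v : R) : 0 < v ->
  exists2 s, 0 < s & tilted_entropy s = v.
Proof.
move=> v0; set I2 := (\int[vol]_x (phi x ^+ 2))%R.
have GE s : 0 <= s -> s ^+ 2 / 4 * I2 <= tilted_entropy s.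
  move=> s0; rewrite -RintegralZl//.
    apply: le_Rintegral => //.
    - apply: (integrable_dominated (C := s ^+ 2 / 4)).
        by apply: measurable_funM => //; exact: measurable_funX.
      move=> x; rewrite ger0_norm; last by rewrite !mulr_ge0 ?sqr_ge0.
      by rewrite ler_wpM2l ?divr_ge0 ?sqr_ge0// expr2 ler_piMr.
    - exact: integrable_tilted_entropy.
    by move=> x _; rewrite mulrAC -exprMn Hfun_expR_ge// mulr_ge0.
  apply: (integrable_dominated (C := 1)); first exact: measurable_funX.
  by move=> x; rewrite ger0_norm ?sqr_ge0// expr2 ler_wpM2r.
have G0 : tilted_entropy 0 = 0.
  rewrite /tilted_entropy.
  under eq_Rintegral do rewrite mul0r expR0 /Hfun ln1 mulr0 sub0r addNr.
  by rewrite Rintegral_cst// mul0r.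
have I20 : 0 < I2 by exact: int_sqr_gt0.
(* At this point the lower bound [S ^+ 2 / 4 * I2] already equals [v]. *)
pose S := 2 * Num.sqrt (v / I2).
have S0 : 0 <= S by rewrite mulr_ge0// sqrtr_ge0.
have [|||s /andP [s0 _] sv] := @lipschitz_IVT R tilted_entropy S
    ((1 + S) * expR S * (\int[vol]_x phi x)%R) v S0.
- by rewrite !mulr_gt0 ?expR_gt0//; lra.
- move=> s u /andP [s0 su] uS.
  have u0 := le_trans s0 su.
  have /andP [h1 h2] := tilted_entropy_lip (introT andP (conj s0 su)).
  rewrite ger0_norm// (le_trans h2)// ler_wpM2r ?subr_ge0// ler_wpM2r ?(ltW I0)//.
  by rewrite ler_pM ?expR_ge0 ?ler_expR ?lerD2l// addr_ge0.
- rewrite G0 (ltW v0) /=; apply: le_trans (GE _ S0).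
  rewrite exprMn sqr_sqrtr ?divr_ge0 ?(ltW v0) ?(ltW I20)//.
  rewrite le_eqVlt; apply/orP; left; apply/eqP; field.
  by rewrite gt_eqF.
exists s => //; rewrite lt_neqAle s0 andbT; apply/eqP => e0.
by move: v0; rewrite -sv -e0 G0 ltxx.
Qed.

(** [s_param] would default to 0 if the entropy equation had no solution, so existence comes first;
    the solution is positive because the entropy at 0 vanishes while [t^-1 > 0]. *)
Lemma xi_spec (t : R) : 0 < t -> exists2 s, 0 < s &
  tilted_entropy s = t^-1 /\ xi vol phi t = (tilted_mean s)%:E.
Proof.
move=> t0; have ti0 : 0 < t^-1 by rewrite invr_gt0.
have intE g : vol.-integrable setT (EFin \o g) ->
   (\int[vol]_x (g x)%:E)%E = (\int[vol]_x g x)%R%:E.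
  by move=> Ig; rewrite /Rintegral fineK// integrable_fin_num.
have ex : [set s : R | 0 <= s /\
    (\int[vol]_x (Hfun (expR (s * phi x)))%:E = (t^-1)%:E)%E] !=set0.
  have [s s0 sv] := tilted_entropy_onto ti0.
  exists s; split; first exact: ltW.
  rewrite (intE (fun x => Hfun (expR (s * phi x)))).
    by rewrite -/(tilted_entropy s) sv.
  by apply: integrable_tilted_entropy; exact: ltW.
have := @xgetPex _ 0 _ ex; rewrite -/(s_param vol phi t).
set s := s_param vol phi t => -[s0 sv].
move: sv; rewrite (intE (fun x => Hfun (expR (s * phi x)))); last exact: integrable_tilted_entropy.
rewrite -/(tilted_entropy s) => -[sv].
exists s.
  rewrite lt_neqAle s0 andbT; apply/eqP => e0.
  move: ti0; rewrite -sv -e0 /tilted_entropy.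
  under eq_Rintegral do rewrite mul0r expR0 /Hfun ln1 mulr0 sub0r addNr.
  by rewrite Rintegral_cst// mul0r ltxx.
split => //; rewrite /xi (intE phi)//.
rewrite eqe gt_eqF//= -/s (intE (fun x => phi x * expR (s * phi x)))//.
exact: integrable_tilted_mean.
Qed.

End OneFunction.

Section XiBounds.
Variable phi : V -> R.
Hypothesis mphi : measurable_fun setT phi.
Hypothesis phi01 : forall x, 0 <= phi x <= 1.
Hypothesis Iphi : vol.-integrable setT (EFin \o phi).

Let I := (\int[vol]_x phi x)%R.

Lemma xi_int0 t : I = 0 -> xi vol phi t = 0%E.
Proof.
move=> I0; rewrite /xi.
have -> : (\int[vol]_x (phi x)%:E)%E = I%:E.
  by rewrite /I /Rintegral fineK// integrable_fin_num.
by rewrite I0 eqxx.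
Qed.

Let I_ge0 : 0 <= I.
Proof. by apply: Rintegral_ge0 => x _; case/andP: (phi01 x). Qed.

Let I_cases : I = 0 \/ 0 < I.
Proof. by move: I_ge0; rewrite le_eqVlt => /predU1P[<-|]; [left|right]. Qed.

Lemma xi_attained t : 0 < t -> 0 < I ->
  exists2 s, 0 < s & xi vol phi t = ((t^-1 + logmgf phi s) / s)%:E.
Proof.
move=> t0 I0; have [s s0 [e1 e2]] := xi_spec mphi phi01 Iphi I0 t0.
exists s => //; rewrite e2; congr EFin.
have := tilted_identity mphi phi01 Iphi (ltW s0); rewrite e1 => e.
by rewrite addrC -e mulrC mulKf// gt_eqF.
Qed.

(** With [xi_attained], this presents [xi phi t] as a minimum of functions affine in [t^-1];
    monotonicity and scaling follow by keeping the minimiser of one argument for the other. *)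
Lemma xi_le t u : 0 < t -> 0 < u ->
  (xi vol phi t <= ((t^-1 + logmgf phi u) / u)%:E)%E.
Proof.
move=> t0 u0; have [I0|I0] := I_cases.
  rewrite xi_int0// lee_fin divr_ge0 ?ltW// ltr_wpDr ?invr_gt0//.
  by apply: logmgf_ge0 => //; exact: ltW.
have [s s0 [e1 ->]] := xi_spec mphi phi01 Iphi I0 t0.
rewrite lee_fin ler_pdivlMr// mulrC addrC -e1.
by apply: tilted_convex => //; exact: ltW.
Qed.

Lemma xi_ge_int t : 0 < t -> (I%:E <= xi vol phi t)%E.
Proof.
move=> t0; have [I0|I0] := I_cases; first by rewrite xi_int0// I0.
have [s s0 ->] := xi_attained t0 I0.
rewrite lee_fin ler_pdivlMr// mulrC.
apply: (le_trans (logmgf_ge mphi phi01 Iphi (ltW s0))).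
by rewrite lerDr invr_ge0 ltW.
Qed.

Lemma xi_scale t (l : R) : 0 < t -> 1 <= l ->
  (xi vol phi (t / l) <= l%:E * xi vol phi t)%E.
Proof.
move=> t0 l1; have l0 : 0 < l by rewrite (lt_le_trans _ l1).
have [I0|I0] := I_cases; first by rewrite !xi_int0// mule0.
have [s s0 ->] := xi_attained t0 I0.
apply: (le_trans (xi_le _ s0)); first by rewrite divr_gt0.
rewrite -EFinM lee_fin mulrA ler_wpM2r ?invr_ge0 ?(ltW s0)// invf_div mulrDr.
by rewrite lerD2l ler_peMl// logmgf_ge0// ltW.
Qed.

Lemma xi_anti s t : 0 < s -> s <= t -> (xi vol phi t <= xi vol phi s)%E.
Proof.
move=> s0 st; have t0 := lt_le_trans s0 st.
have [I0|I0] := I_cases; first by rewrite !xi_int0.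
have [u u0 ->] := xi_attained s0 I0.
apply: (le_trans (xi_le t0 u0)).
by rewrite lee_fin ler_wpM2r ?invr_ge0 ?(ltW u0)// lerD2r lef_pV2 ?posrE.
Qed.

End XiBounds.
End Xi.

(** * Norms and feasible functions *)

Section Norm.
Context {R : realType} {d : nat}.
Notation V := (d.-tuple R).
Variable nrm : V -> R.
Hypothesis hnrm : is_norm nrm.
Implicit Types x y : V.

Lemma nrm_scale (a : R) x : nrm (vscale a x) = `|a| * nrm x.
Proof. by case: hnrm. Qed.

Lemma nrm_add x y : nrm (vadd x y) <= nrm x + nrm y.
Proof. by case: hnrm. Qed.

Lemma nrm_eq0 x : nrm x = 0 -> x = vzero.
Proof. by case: hnrm => h _ _; exact: h. Qed.

Lemma tnth_vzero i : tnth (vzero : V) i = 0.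
Proof. by rewrite tnth_mktuple. Qed.

Lemma nrm0 : nrm vzero = 0.
Proof.
rewrite (_ : vzero = vscale 0 vzero) ?nrm_scale ?normr0 ?mul0r//.
by apply: eq_from_tnth => i; rewrite tnth_vscale tnth_vzero mul0r.
Qed.

Lemma nrm_subC x y : nrm (vsub x y) = nrm (vsub y x).
Proof.
rewrite (_ : vsub x y = vscale (-1) (vsub y x)) ?nrm_scale ?normrN1 ?mul1r//.
by apply: eq_from_tnth => i; rewrite tnth_vscale !tnth_vsub; ring.
Qed.

Lemma nrm_ge0 x : 0 <= nrm x.
Proof.
have := nrm_add x (vscale (-1) x); rewrite nrm_scale normrN1 mul1r.
rewrite (_ : vadd _ _ = vzero) ?nrm0; first lra.
by apply: eq_from_tnth => i; rewrite tnth_vadd tnth_vscale tnth_vzero; ring.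
Qed.

Lemma nrm_sub_trans y x z : nrm (vsub x z) <= nrm (vsub x y) + nrm (vsub y z).
Proof.
rewrite (_ : vsub x z = vadd (vsub x y) (vsub y z)) ?nrm_add//.
by apply: eq_from_tnth => i; rewrite tnth_vadd !tnth_vsub; ring.
Qed.

Definition nrm_upper : R := \sum_i nrm [tuple (j == i)%:R | j < d] + 1.

Lemma nrm_upper_gt0 : 0 < nrm_upper.
Proof. by rewrite ltr_wpDl// sumr_ge0// => i _; exact: nrm_ge0. Qed.

Lemma nrm_le_upper x (B : R) : (forall i, `|tnth x i| <= B) -> 0 <= B ->
  nrm x <= nrm_upper * B.
Proof.
move=> xB B0.
pose pre (s : seq 'I_d) : V := [tuple if j \in s then tnth x j else 0 | j < d].
have step s : uniq s ->
   nrm (pre s) <= (\sum_(i <- s) nrm [tuple (j == i)%:R | j < d]) * B.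
  elim: s => [_|i s IH /= /andP [nis us]].
    rewrite (_ : pre [::] = vzero); first by rewrite nrm0 big_nil mul0r.
    by apply: eq_from_tnth => j; rewrite !tnth_mktuple.
  rewrite big_cons mulrDl.
  rewrite (_ : pre (i :: s) =
      vadd (vscale (tnth x i) [tuple (j == i)%:R | j < d]) (pre s)).
    apply: (le_trans (nrm_add _ _)); rewrite lerD ?IH// nrm_scale mulrC.
    by rewrite ler_wpM2l ?nrm_ge0.
  apply: eq_from_tnth => j; rewrite tnth_vadd tnth_vscale !tnth_mktuple inE.
  case: (eqVneq j i) => [->|ji] /=; first by rewrite mulr1 (negbTE nis) addr0.
  by rewrite mulr0 add0r.
have -> : x = pre (index_enum 'I_d).
  by apply: eq_from_tnth => j; rewrite tnth_mktuple mem_index_enum.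
apply: (le_trans (step _ (index_enum_uniq _))).
by rewrite ler_wpM2r// /nrm_upper lerDl.
Qed.

(** Tuples are read as row vectors, whose unit sphere for the maximum norm is compact; the constant
    is the least value of [nrm] there. *)
Lemma nrm_lower : (0 < d)%N ->
  exists2 c : R, 0 < c & forall x i, c * `|tnth x i| <= nrm x.
Proof.
move=> d0.
pose tup (v : 'rV[R]_d) : V := [tuple v ord0 i | i < d].
have coord_le (v : 'rV[R]_d) i : `|v ord0 i| <= `|v|.
  rewrite [leRHS]/Num.norm /= mx_normrE; apply/bigmax_geP; right => /=.
  by exists (ord0, i).
pose f v := nrm (tup v).
have flip u v : `|f u - f v| <= nrm_upper * `|u - v|.
  have bnd u' v' : f u' - f v' <= nrm_upper * `|u' - v'|.
    rewrite lerBlDr; apply: (le_trans (y := nrm (vsub (tup u') (tup v')) + f v')).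
      rewrite /f {1}(_ : tup u' = vadd (vsub (tup u') (tup v')) (tup v')) ?nrm_add//.
      by apply: eq_from_tnth => i; rewrite tnth_vadd tnth_vsub; ring.
    rewrite lerD2r; apply: nrm_le_upper => // i.
    by rewrite tnth_vsub !tnth_mktuple; have := coord_le (u' - v') i; rewrite !mxE.
  by rewrite ler_norml bnd andbT lerNl opprB distrC bnd.
have cf : continuous f.
  move=> v; apply/(@cvgrPdist_le _ _ _ (nbhs v) (nbhs_filter v)) => e e0; apply/nbhs_ballP.
  exists (e / nrm_upper) => /=; first by rewrite divr_gt0// nrm_upper_gt0.
  move=> u; rewrite -ball_normE /= ltr_pdivlMr ?nrm_upper_gt0// => uv.
  by apply: (le_trans (flip _ _)); rewrite mulrC ltW.
pose A : set 'rV[R]_d := [set v | `|v| = 1].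
have A0 : A !=set0.
  exists (const_mx 1); rewrite /A /=.
  have : mx_norm (const_mx 1 : 'rV[R]_d) != 0.
    apply/eqP => /mx_norm_eq0 /matrixP /(_ ord0 (Ordinal d0)).
    by rewrite !mxE => /eqP; rewrite oner_eq0.
  by move=> /mx_norm_neq0 [i e]; rewrite [LHS]e mxE normr1.
have cA : compact A.
  apply: bounded_closed_compact.
    by exists 1; split => // M M1 v; rewrite /A /= => ->; exact: ltW.
  apply: (@closed_comp _ _ (fun v : 'rV[R]_d => `|v|) [set 1]).
    by move=> v _; exact: norm_continuous.
  exact: closed_eq.
have [c /set_mem cA1 cmin] := @EVT_min_rV R d f A A0 cA (continuous_subspaceT cf).
have fc0 : 0 < f c.
  rewrite lt_neqAle nrm_ge0 andbT; apply/eqP => /esym /nrm_eq0 c0.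
  move: cA1; rewrite /A /= (_ : c = 0) ?normr0; first by move/eqP; rewrite eq_sym oner_eq0.
  apply/matrixP => i j; rewrite mxE ord1.
  by have := congr1 (fun v => tnth v j) c0; rewrite tnth_mktuple tnth_vzero.
exists (f c) => // x i.
pose v : 'rV[R]_d := \row_j tnth x j.
have tv : tup v = x by apply: eq_from_tnth => j; rewrite tnth_mktuple mxE.
have xi : `|tnth x i| <= `|v| by have := coord_le v i; rewrite mxE.
have [v0|v0] := eqVneq `|v| 0.
  by have := nrm_ge0 x; move: xi; rewrite v0 normr_le0 => /eqP ->; rewrite normr0 mulr0.
have vp : 0 < `|v| by rewrite lt_neqAle eq_sym v0 normr_ge0.
have : f c <= f (`|v|^-1 *: v).
  by apply: cmin; apply/mem_set; rewrite /A /= normrZ normfV normr_id mulVf.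
have -> : f (`|v|^-1 *: v) = `|v|^-1 * nrm x.
  have iv : 0 <= `|v|^-1 by rewrite invr_ge0.
  rewrite -tv -[X in _ = X * _](ger0_norm iv) -nrm_scale; congr nrm.
  by apply: eq_from_tnth => j; rewrite tnth_vscale !tnth_mktuple !mxE.
rewrite ler_pdivlMl// => h; apply: le_trans h.
by rewrite mulrC ler_wpM2r// ltW.
Qed.

Section Feasible.
Variable phi : V -> R.
Hypothesis fphi : feasible nrm phi.

Lemma feasible_ge0 x : 0 <= phi x.
Proof. by case: fphi. Qed.

Lemma feasible_sum_seq (s : seq V) : uniq s ->
  (forall v w, v \in s -> w \in s -> v != w -> 1 < nrm (vsub v w)) ->
  \sum_(v <- s) phi v <= 1.
Proof.
move=> us ws; case: fphi => [p0 _ /(_ [set` s])].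
rewrite esum_fset; last 2 first.
- exact: finite_seq.
- by move=> v _; rewrite lee_fin.
rewrite -fsbig_seq// sumEFin lee_fin; apply => v w /= vs wsx vw.
by apply: ws => //; apply/eqP.
Qed.

Lemma feasible_sum (I : finType) (P : pred I) (v : I -> V) :
  (forall i j, P i -> P j -> i != j -> 1 < nrm (vsub (v i) (v j))) ->
  \sum_(i | P i) phi (v i) <= 1.
Proof.
move=> sep; pose s := [seq v i | i <- enum P].
have -> : \sum_(i | P i) phi (v i) = \sum_(x <- s) phi x.
  by rewrite big_map big_enum.
have inj : {in P &, injective v}.
  move=> i j Pi Pj vij; apply/eqP; apply: contraT => ij.
  have := sep i j Pi Pj ij; rewrite vij (_ : vsub _ _ = vzero) ?nrm0 ?ltr10//.
  by apply: eq_from_tnth => k; rewrite tnth_vsub tnth_vzero subrr.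
apply: feasible_sum_seq.
  rewrite map_inj_in_uniq ?enum_uniq// => i j; rewrite !mem_enum; exact: inj.
move=> _ _ /mapP [i + ->] /mapP [j + ->]; rewrite !mem_enum => Pi Pj vij.
by apply: sep => //; apply: contra_neq vij => ->.
Qed.

Lemma feasible_le1 x : phi x <= 1.
Proof.
have := @feasible_sum_seq [:: x]; rewrite big_seq1; apply => // v w.
by rewrite !inE => /eqP -> /eqP ->; rewrite eqxx.
Qed.

Lemma feasible_01 x : 0 <= phi x <= 1.
Proof. by rewrite feasible_ge0 feasible_le1. Qed.

Lemma feasible_measurable : measurable_fun setT phi.
Proof. by case: fphi. Qed.

Lemma feasible_dominated (psi : V -> R) : measurable_fun setT psi ->
  (forall x, 0 <= psi x <= phi x) -> feasible nrm psi.
Proof.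
move=> mpsi le; split => // [x|S wS]; first by case/andP: (le x).
case: fphi => _ _ /(_ S wS); apply: le_trans; apply: le_esum => v _.
by rewrite lee_fin; case/andP: (le v).
Qed.

End Feasible.

Lemma feasible_of_sum (phi : V -> R) : measurable_fun setT phi ->
  (forall x, 0 <= phi x) ->
  (forall s : seq V, uniq s ->
     (forall v w, v \in s -> w \in s -> v != w -> 1 < nrm (vsub v w)) ->
     \sum_(v <- s) phi v <= 1) -> feasible nrm phi.
Proof.
move=> mphi p0 H; split => // S wS.
apply: ge_ereal_sup => _ [X [fX XS] <-].
have [s us Xs] : exists2 s : seq V, uniq s & X = [set` s].
  have /finite_seqP [s ->] := fX.
  by exists (undup s); [exact: undup_uniq|apply/seteqP; split => x /=; rewrite mem_undup].
rewrite Xs -fsbig_seq// sumEFin lee_fin; apply: H => // v w vs ws /eqP vw.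
by apply: wS => //; apply: XS; rewrite Xs.
Qed.

End Norm.

(** * Packings and the limit function *)

Lemma le_right_limit {R : realType} (F : R -> R) (a x : R) :
  {for x, continuous F} -> (forall y, x < y -> a <= F y) -> a <= F x.
Proof.
move=> cF H; rewrite leNgt; apply/negP => lt.
have : \forall y \near x, F y < a by exact: cvgr_lt cF _ lt.
move=> /nbhs_ballP [e /= e0 He].
have e20 : 0 < e / 2 by rewrite divr_gt0.
have := He (x + e / 2); rewrite /ball /= opprD addrA subrr add0r normrN gtr0_norm//.
have h1 : e / 2 < e by lra.
by move=> /(_ h1); rewrite ltNge H// ltrDl.
Qed.

Section Packing.
Context {R : realType} {d : nat}.
Notation V := (d.-tuple R).
Variable nrm : V -> R.
Hypothesis hnrm : is_norm nrm.
Hypothesis d0 : (0 < d)%N.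
Implicit Types x y : V.

(** The midpoint of two centres closer than 2 lies in both unit balls. *)
Lemma packableP (K : R) (m : nat) : packable nrm K m <->
  exists c : 'I_m -> V, (forall j k, 0 < tnth (c j) k < K) /\
    (forall j j', j != j' -> 2 <= nrm (vsub (c j) (c j'))).
Proof.
split=> -[c [cK sep]]; exists c; split => // j j' jj'.
  rewrite leNgt; apply/negP => lt.
  have : (nball nrm (c j) 1 `&` nball nrm (c j') 1) (vscale 2^-1 (vadd (c j) (c j'))).
    split; rewrite /nball /=.
      rewrite (_ : vsub _ _ = vscale 2^-1 (vsub (c j) (c j'))).
        by rewrite nrm_scale// ger0_norm//; lra.
      by apply: eq_from_tnth => i; rewrite !(tnth_vsub, tnth_vscale, tnth_vadd); field.
    rewrite (_ : vsub _ _ = vscale (- 2^-1) (vsub (c j) (c j'))).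
      by rewrite nrm_scale// normrN ger0_norm//; lra.
    by apply: eq_from_tnth => i; rewrite !(tnth_vsub, tnth_vscale, tnth_vadd); field.
  by rewrite sep.
apply/seteqP; split => // y [] /=; rewrite /nball /= => h1 h2.
have := nrm_sub_trans hnrm y (c j) (c j'); rewrite (nrm_subC hnrm y).
by have := sep _ _ jj'; lra.
Qed.

Lemma packable_grid : exists2 h : R, 0 < h &
  forall m : nat, packable nrm (h * m%:R) (m ^ d).
Proof.
have [c c0 cl] := nrm_lower hnrm d0.
have h0 : 0 < 2 / c by rewrite divr_gt0.
exists (2 / c) => // m; set h := 2 / c.
have cardm : #|{: {ffun 'I_d -> 'I_m}}| = (m ^ d)%N by rewrite card_ffun !card_ord.
rewrite -cardm; apply/packableP.
pose z (j : 'I_#|{: {ffun 'I_d -> 'I_m}}|) : {ffun 'I_d -> 'I_m} := enum_val j.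
exists (fun j => [tuple h * ((z j i)%:R + 2^-1) | i < d]); split => [j k|j j' jj'].
  rewrite tnth_mktuple; 
  have : ((z j k)%:R + 1 : R) <= m%:R by rewrite natr1 ler_nat.
  have := ler0n R (z j k) => z0 zm.
  have z2 : 0 < (z j k)%:R + 2^-1 :> R by lra.
  by rewrite mulr_gt0//= ltr_pM2l//; lra.
have [i] : exists i, z j i != z j' i.
  apply/existsP; apply: contraNT jj'; rewrite negb_exists => /forallP e.
  apply/eqP/enum_val_inj/ffunP => i; apply/eqP; rewrite -[_ == _]negbK; exact: e.
move=> zz'; apply: le_trans (cl _ i).
rewrite tnth_vsub !tnth_mktuple -mulrBr normrM gtr0_norm// /h mulrA.
rewrite [c * _]mulrCA divff ?gt_eqF// mulr1 ler_peMr//.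
rewrite opprD addrACA subrr addr0.
move: zz'; rewrite -val_eqE neq_ltn => /orP [] lt.
  have : (z j i)%:R + 1 <= (z j' i)%:R :> R by rewrite natr1 ler_nat.
  by move=> h1; rewrite distrC ger0_norm; lra.
have : (z j' i)%:R + 1 <= (z j i)%:R :> R by rewrite natr1 ler_nat.
by move=> h1; rewrite ger0_norm; lra.
Qed.

Variable vol : {measure set V -> \bar R}.
Hypothesis hvol : is_lebesgue vol.

Lemma integral_translate x (g : V -> R) : measurable_fun setT g ->
  (forall y, 0 <= g y) ->
  (\int[vol]_y (g (vsub y x))%:E = \int[vol]_y (g y)%:E)%E.
Proof.
move=> mg g0.
have E y : vsub y x = vscale 1^-1 (vsub y x).
  by apply: eq_from_tnth => i; rewrite tnth_vscale invr1 mul1r.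
have mT := measurable_affine x (1^-1 : R).
transitivity (\int[pushforward vol (fun y => vscale 1^-1 (vsub y x))]_y (g y)%:E)%E.
  rewrite [RHS]ge0_integral_pushforward//; last 2 first.
  - exact: measurableT_comp.
  - by move=> y _; rewrite lee_fin.
  by apply: eq_integral => y _ /=; rewrite -E.
apply: eq_measure_integral => A mA _ /=.
by rewrite /pushforward vol_affine// expr1n mul1e.
Qed.

(** The centres shrunk by about one half are well-spread, so the corresponding translates of [phi]
    add up to at most 1, inside a box of side about [2 * L + K / 2]. Integrate. *)
Lemma packable_integral (phi : V -> R) (L K : R) (m : nat) :
  feasible nrm phi -> 0 < L -> 0 < K ->
  (forall x, ~ cbox (vcst (- L)) (vcst L) x -> phi x = 0) ->
  packable nrm K m ->
  (m%:R%:E * \int[vol]_x (phi x)%:E <= ((2 * L + K / 2) ^+ d)%:E)%E.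
Proof.
move=> fphi L0 K0 supp /packableP [c [cK sep]].
have mphi := feasible_measurable fphi.
have phi0 := feasible_ge0 fphi.
(* Packing centres may be at distance exactly 2 while well-spread means strictly more than 1: the
   factor [e > 1] makes room, and tends to 1 at the end. *)
have step (e : R) : 1 < e ->
   (m%:R%:E * \int[vol]_x (phi x)%:E <= ((2 * L + e * K / 2) ^+ d)%:E)%E.
  move=> e1; have e0 : 0 < e by lra.
  pose x (j : 'I_m) : V := vscale (- (e / 2)) (c j).
  pose Q : set V := cbox (vcst (- L - e * K / 2)) (vcst L).
  have eK0 : 0 < e * K by rewrite mulr_gt0.
  have volQ : vol Q = ((2 * L + e * K / 2) ^+ d)%:E.
    rewrite vol_cbox//; last by move=> i; rewrite !tnth_vcst; lra.
    congr EFin; rewrite -[in RHS](card_ord d) -prodr_const; apply: eq_bigr => i _.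
    by rewrite !tnth_vcst; ring.
  have <- : (\int[vol]_y (\1_Q y)%:E)%E = ((2 * L + e * K / 2) ^+ d)%:E.
    by rewrite -volQ integral_indic ?setIT//; exact: measurable_cbox.
  have mg j : measurable_fun setT (fun y => (phi (vsub y (x j)))%:E).
    apply: measurableT_comp => //; apply: measurableT_comp => //.
    have := measurable_affine (x j) (1 : R); congr measurable_fun.
    apply/funext => y; apply: eq_from_tnth => i.
    by rewrite tnth_vscale mul1r.
  apply: (@le_trans _ _ (\int[vol]_y (\sum_(j < m) (phi (vsub y (x j)))%:E))%E).
    rewrite ge0_integral_sum//; last by move=> j y _; rewrite lee_fin.
    rewrite (eq_bigr (fun=> \int[vol]_x (phi x)%:E)%E); last first.
      by move=> j _; rewrite integral_translate.
    by rewrite sumr_const card_ord mule_natl.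
  apply: ge0_le_integral => //.
  - by move=> y _; apply: sume_ge0 => j _; rewrite lee_fin.
  - by apply: emeasurable_sum => j.
  - by apply/measurable_EFinP; apply: measurable_indic; exact: measurable_cbox.
  move=> y _; rewrite sumEFin lee_fin indicE.
  case: (boolP (y \in Q)) => [yQ|yQ].
    apply: (@feasible_sum _ _ _ hnrm _ fphi 'I_m predT (fun j => vsub y (x j))) => // i j _ _ ij.
    rewrite (_ : vsub _ _ = vscale (e / 2) (vsub (c i) (c j))).
      by rewrite nrm_scale// gtr0_norm; [have := sep _ _ ij; nra|lra].
    by apply: eq_from_tnth => k; rewrite !(tnth_vsub, tnth_vscale); ring.
  rewrite big1// => j _; apply: supp => h; move/negP: yQ; apply; apply/mem_set => i.
  have := h i; rewrite tnth_vsub tnth_vscale !tnth_vcst => /andP [h1 h2].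
  have /andP [c1 c2] := cK j i.
  have : e * tnth (c j) i < e * K by rewrite ltr_pM2l.
  have : 0 < e * tnth (c j) i by rewrite mulr_gt0.
  by move=> ? ?; apply/andP; split; lra.
have fin : (m%:R%:E * \int[vol]_x (phi x)%:E)%E \is a fin_num.
  rewrite ge0_fin_numE; first by rewrite (le_lt_trans (step 2 _)) ?ltry//; lra.
  by rewrite mule_ge0 ?lee_fin// integral_ge0// => x _; rewrite lee_fin.
rewrite -(fineK fin) lee_fin -[K in (_ + K / _)]mul1r.
apply: (@le_right_limit _ (fun e => (2 * L + e * K / 2) ^+ d)).
  have c1 : {for (1 : R), continuous (fun e : R => 2 * L + e * K / 2)}.
    apply: cvgD; first exact: cvg_cst.
    by apply: cvgM; [apply: cvgM; [exact: cvg_id|exact: cvg_cst]|exact: cvg_cst].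
  exact: (@continuous_comp R R R _ (fun z => z ^+ d) 1 c1 (@exprn_continuous R d _)).
by move=> e e1; rewrite -lee_fin fineK// step.
Qed.

Definition box_restrict (phi : V -> R) (L : R) : V -> R :=
  fun x => phi x * \1_(cbox (vcst (- L)) (vcst L)) x.

Lemma box_restrict_feasible phi L : feasible nrm phi -> feasible nrm (box_restrict phi L).
Proof.
move=> fphi; apply: (feasible_dominated fphi).
  apply: measurable_funM; first exact: feasible_measurable fphi.
  by apply: measurable_indic; exact: measurable_cbox.
move=> x; rewrite /box_restrict indicE; have p0 := feasible_ge0 fphi x.
by case: (x \in _); rewrite ?mulr1 ?mulr0 ?lexx ?p0 ?lexx.
Qed.

Lemma box_restrict_supp phi L x : ~ cbox (vcst (- L)) (vcst L) x -> box_restrict phi L x = 0.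
Proof. by move=> nx; rewrite /box_restrict indicE memNset ?mulr0. Qed.

Lemma box_restrict_cvg phi : feasible nrm phi ->
  (\int[vol]_x (box_restrict phi n.+1%:R x)%:E)%E @[n --> \oo] -->
  (\int[vol]_x (phi x)%:E)%E.
Proof.
move=> fphi.
have mono x : {homo (fun n : nat => (box_restrict phi n.+1%:R x)%:E) : n m / (n <= m)%N >-> (n <= m)%E}.
  move=> n m nm; rewrite lee_fin /box_restrict ler_wpM2l ?(feasible_ge0 fphi)//.
  rewrite !indicE; case: (boolP (x \in cbox (vcst (- n.+1%:R)) _)) => [xn|_]; last by rewrite ler0n.
  rewrite mem_set// => i; have := set_mem xn i; rewrite !tnth_vcst => /andP [h1 h2].
  have : (n.+1%:R : R) <= m.+1%:R by rewrite ler_nat.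
  by move=> ?; apply/andP; split; lra.
have := @cvg_monotone_convergence _ V R vol setT measurableT
  (fun (n : nat) (x : V) => (box_restrict phi n.+1%:R x)%:E) _ _ (fun x _ => mono x).
have -> : (\int[vol]_x (phi x)%:E)%E = (\int[vol]_x limn (fun n : nat => (box_restrict phi n.+1%:R x)%:E))%E.
  apply: eq_integral => x _; apply/esym/cvg_lim => //.
  apply: cvg_near_cst; pose s := \sum_j `|tnth x j|.
  have s0 : 0 <= s by apply: sumr_ge0.
  exists (Num.truncn s) => // n /= sn; rewrite /box_restrict indicE mem_set ?mulr1// => i.
  rewrite !tnth_vcst -ler_norml; apply: (le_trans (y := s)).
    by rewrite /s (bigD1 i)//= lerDl sumr_ge0.
  case/andP: (truncn_itv s0) => _ /ltW h; apply: (le_trans h).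
  by rewrite ler_nat.
apply.
- by move=> n; apply/measurable_EFinP; case: (box_restrict_feasible n.+1%:R fphi).
- by move=> n x _; rewrite lee_fin (feasible_ge0 (box_restrict_feasible _ fphi)).
Qed.

Lemma feasible_int_ub : exists C : R, forall phi, feasible nrm phi ->
  (\int[vol]_x (phi x)%:E <= C%:E)%E.
Proof.
have [h h0 grid] := packable_grid.
exists (h ^+ d) => phi fphi.
apply: (cvge_le _ (box_restrict_cvg fphi)) => //; apply: nearW => n.
set L : R := n.+1%:R; have L0 : 0 < L by rewrite ltr0n.
(* With [K = h * m >= 4 * L] one has [2 * L + K / 2 <= K], so the bound [h ^+ d] is independent of
   the support. *)
pose m := (Num.truncn (4 * L / h)).+1.
have m0 : (0 : R) < m%:R by rewrite ltr0n.
have u0 : 0 <= 4 * L / h by rewrite divr_ge0 ?ltW// mulr_gt0.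
have mL : 4 * L <= h * m%:R.
  by have /andP [_ /ltW] := truncn_itv u0; rewrite ler_pdivrMr// [_ * h]mulrC.
have K0 : 0 < h * m%:R by rewrite mulr_gt0.
have := packable_integral (box_restrict_feasible L fphi) L0 K0
  (fun x => @box_restrict_supp phi L x) (grid m).
have f0 : forall x, 0 <= box_restrict phi L x := feasible_ge0 (box_restrict_feasible L fphi).
have md0 : (0 : R) < (m ^ d)%:R by rewrite natrX exprn_gt0.
rewrite -lee_pdivlMl// => H; apply: (le_trans H).
rewrite -EFinM lee_fin ler_pdivrMl// natrX -exprMn.
rewrite lerXn2r ?nnegrE//; [|by rewrite mulr_ge0 ?ltW|].
  by rewrite addr_ge0 ?divr_ge0 ?mulr_ge0 ?ltW.
rewrite mulrC; lra.
Qed.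

(** Serves as the limit of [f_chi] at infinity; [limval_max_int] identifies it with the constant of
    the packing density. *)
Definition max_int : R := sup [set (\int[vol]_x phi x)%R | phi in feasible nrm].

Lemma feasible_integrable phi : feasible nrm phi -> vol.-integrable setT (EFin \o phi).
Proof.
move=> fphi; apply/integrableP; split.
  by apply/measurable_EFinP; exact: feasible_measurable fphi.
have [C HC] := feasible_int_ub.
apply: (@le_lt_trans _ _ C%:E); last exact: ltry.
apply: le_trans (HC _ fphi); rewrite le_eqVlt; apply/orP; left; apply/eqP.
by apply: eq_integral => x _ /=; rewrite ger0_norm// (feasible_ge0 fphi).
Qed.

Lemma feasible_intE phi : feasible nrm phi ->
  (\int[vol]_x (phi x)%:E)%E = (\int[vol]_x phi x)%R%:E.
Proof.
by move=> fphi; rewrite /Rintegral fineK// integrable_fin_num//; exact: feasible_integrable.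
Qed.

Let feasible0 : feasible nrm (fun=> 0).
Proof.
apply: feasible_of_sum => // s _ _; rewrite big1//.
Qed.

Lemma max_int_has_sup : has_sup [set (\int[vol]_x phi x)%R | phi in feasible nrm].
Proof.
split; first by exists (\int[vol]_x (0 : R))%R; exists (fun=> 0).
have [C HC] := feasible_int_ub; exists C => _ [phi fphi <-].
by rewrite -lee_fin -feasible_intE// HC.
Qed.

Lemma max_int_ge phi : feasible nrm phi -> (\int[vol]_x phi x)%R <= max_int.
Proof.
by move=> fphi; apply: ub_le_sup; [case: max_int_has_sup|exists phi].
Qed.

Lemma max_int_approx (e : R) : 0 < e ->
  exists2 phi, feasible nrm phi & max_int - e < (\int[vol]_x phi x)%R.
Proof.
by move=> e0; have [_ [phi fphi <-] h] := sup_adherent e0 max_int_has_sup; exists phi.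
Qed.

Lemma max_int_approx_box (e : R) : 0 < e -> exists phi (L : R),
  [/\ feasible nrm phi, 0 < L, (forall x, ~ cbox (vcst (- L)) (vcst L) x -> phi x = 0) &
      max_int - e < (\int[vol]_x phi x)%R].
Proof.
move=> e0; have [phi fphi lt] := max_int_approx e0.
have := box_restrict_cvg fphi; rewrite feasible_intE// => /fine_cvg cv.
have [n _ H] : \forall n \near \oo, max_int - e < fine (\int[vol]_x (box_restrict phi n.+1%:R x)%:E)%E.
  exact: cvgr_gt cv _ lt.
exists (box_restrict phi n.+1%:R), n.+1%:R; split.
- exact: box_restrict_feasible.
- by rewrite ltr0n.
- exact: box_restrict_supp.
- exact: (H n (leqnn n)).
Qed.

Lemma cube_indicator_feasible x (h c : R) : 0 < h -> 0 <= c ->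
  (forall s : seq V, uniq s -> (forall v, v \in s -> cube x h v) ->
     (forall v w, v \in s -> w \in s -> v != w -> 1 < nrm (vsub v w)) ->
     (size s)%:R * c <= 1) ->
  feasible nrm (fun y => c * \1_(cube x h) y).
Proof.
move=> h0 c0 H; apply: feasible_of_sum.
- by apply: measurable_funM => //; apply: measurable_indic; exact: measurable_cube.
- by move=> y; rewrite mulr_ge0// indicE ler0n.
move=> s us sep.
rewrite (eq_bigr (fun y => if y \in cube x h then c else 0)); last first.
  by move=> y _; rewrite indicE; case: (y \in _); rewrite ?mulr1 ?mulr0.
rewrite -big_mkcond -big_filter big_const_seq count_predT iter_addr_0 -mulr_natl.
apply: H; first exact: filter_uniq.
  by move=> v; rewrite mem_filter => /andP [/set_mem].
by move=> v w; rewrite !mem_filter => /andP [_ vs] /andP [_ ws]; exact: sep.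
Qed.

Lemma cube_indicator_int x (h c : R) : 0 < h ->
  (\int[vol]_y (c * \1_(cube x h) y))%R = c * h ^+ d.
Proof.
move=> h0; have mc := measurable_cube x h.
have e : (\int[vol]_y (\1_(cube x h) y)%:E)%E = (h ^+ d)%:E.
  by rewrite integral_indic ?setIT// vol_cube.
rewrite RintegralZl//; first by rewrite /Rintegral e.
apply/integrableP; split; first by apply/measurable_EFinP; exact: measurable_indic.
rewrite (_ : (fun x0 => _) = (fun y => (\1_(cube x h) y)%:E)) ?e ?ltry//.
by apply/funext => y /=; rewrite ger0_norm// indicE ler0n.
Qed.

(** The cube has diameter at most 1 for [nrm], so a well-spread set meets it at most once. *)
Lemma small_cube_feasible :
  feasible nrm (fun y => 1 * \1_(cube vzero (nrm_upper nrm)^-1) y).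
Proof.
have C0 := nrm_upper_gt0 hnrm; set h := (nrm_upper nrm)^-1.
have h0 : 0 < h by rewrite invr_gt0.
apply: cube_indicator_feasible => // s us sc sep.
rewrite mulr1 -[leRHS]/(1%:R) ler_nat; case: s us sc sep => [|v [|w s]]//.
rewrite /= => /andP []; rewrite inE negb_or => /andP [vw _] _ sc.
have sv : cube vzero h v by apply: sc; rewrite inE eqxx.
have sw : cube vzero h w by apply: sc; rewrite !inE eqxx orbT.
move=> /(_ v w); rewrite !inE !eqxx orbT => /(_ isT isT vw).
have e1 : nrm_upper nrm * h = 1 by rewrite mulfV ?gt_eqF.
rewrite ltNge => /negP []; rewrite -e1.
apply: nrm_le_upper => //; last exact: ltW.
move=> i; rewrite tnth_vsub ler_norml.
have := sv i; have := sw i; rewrite tnth_vzero => /andP [? ?] /andP [? ?].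
by apply/andP; split; rewrite -/h; lra.
Qed.

Lemma max_int_gt0 : 0 < max_int.
Proof.
have h0 : 0 < (nrm_upper nrm)^-1 by rewrite invr_gt0 nrm_upper_gt0.
apply: (@lt_le_trans _ _ (1 * (nrm_upper nrm)^-1 ^+ d)); first by rewrite mul1r exprn_gt0.
by rewrite -(cube_indicator_int vzero 1 h0); apply: max_int_ge; exact: small_cube_feasible.
Qed.

Section NpackBounds.
Variable K : R.
Hypothesis K0 : 0 < K.

Let packset := [set (m%:R : R) | m in packable nrm K].

Let packset_has_sup : has_sup packset.
Proof.
split; first by exists 0, 0%N => //; exists (fun=> vzero); split => -[].
have [phi [L [fphi L0 supp lt]]] := max_int_approx_box (max_int_gt0).
rewrite subrr in lt.
exists ((2 * L + K / 2) ^+ d / (\int[vol]_x phi x)%R) => _ [m pm <-].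
have := packable_integral fphi L0 K0 supp pm.
by rewrite feasible_intE// -EFinM lee_fin ler_pdivlMr.
Qed.

Lemma Npack_ge m : packable nrm K m -> m%:R <= Npack nrm K.
Proof. by move=> pm; apply: ub_le_sup; [case: packset_has_sup|exists m]. Qed.

Lemma Npack_ge1 : 1 <= Npack nrm K.
Proof.
apply: (@Npack_ge 1%N); apply/packableP; exists (fun=> vcst (K / 2)); split.
  by move=> j k; have := K0; rewrite tnth_vcst => ?; lra.
by move=> j j'; rewrite !ord1 eqxx.
Qed.

Lemma Npack_upper phi (L : R) : feasible nrm phi -> 0 < L ->
  (forall x, ~ cbox (vcst (- L)) (vcst L) x -> phi x = 0) ->
  Npack nrm K * (\int[vol]_x phi x)%R <= (2 * L + K / 2) ^+ d.
Proof.
move=> fphi L0 supp.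
have I0 : 0 <= (\int[vol]_x phi x)%R by apply: Rintegral_ge0 => x _; exact: feasible_ge0 fphi x.
move: I0; rewrite le_eqVlt => /predU1P [<-|I0].
  by rewrite mulr0 exprn_ge0// addr_ge0 ?mulr_ge0 ?divr_ge0 ?ltW.
rewrite -ler_pdivlMr//; apply: ge_sup; first by case: packset_has_sup.
move=> _ [m pm <-]; rewrite ler_pdivlMr//.
have := packable_integral fphi L0 K0 supp pm.
by rewrite feasible_intE// -EFinM lee_fin.
Qed.

(** Doubling a well-spread subset of a cube of side below [K / 2] gives a packing, so the indicator
    of that cube divided by [Npack] is feasible. *)
Lemma Npack_lower : (K / 2) ^+ d <= Npack nrm K * max_int.
Proof.
have N1 := Npack_ge1.
(* The cube starts at [e] because packing centres have strictly positive coordinates; then [e] tends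
   to 0. *)
have step e : 0 < e < K / 2 -> (K / 2 - e) ^+ d <= Npack nrm K * max_int.
  move=> /andP [e0 eK].
  have h0 : 0 < K / 2 - e by lra.
  have Np : 0 < Npack nrm K by exact: lt_le_trans ltr01 N1.
  rewrite [leRHS]mulrC -ler_pdivrMr// mulrC.
  rewrite -(cube_indicator_int (vcst e) _ h0); apply: max_int_ge.
  apply: cube_indicator_feasible => //; first by rewrite invr_ge0 (le_trans _ N1).
  move=> s us sc sep; rewrite ler_pdivrMr ?(lt_le_trans _ N1)// mul1r.
  apply: Npack_ge; apply/packableP.
  exists (fun j : 'I_(size s) => vscale 2 (tnth (in_tuple s) j)); split.
    move=> j k; rewrite tnth_vscale.
    have /sc /(_ k) : tnth (in_tuple s) j \in s by exact: mem_tnth.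
    by rewrite tnth_vcst => /andP [? ?]; apply/andP; split; lra.
  move=> j j' jj'.
  rewrite (_ : vsub _ _ = vscale 2 (vsub (tnth (in_tuple s) j) (tnth (in_tuple s) j'))).
    rewrite nrm_scale// ger0_norm// ler_peMr// ltW// sep ?mem_tnth//.
    rewrite !(tnth_nth vzero) /= nth_uniq//.
  by apply: eq_from_tnth => k; rewrite !(tnth_vsub, tnth_vscale); ring.
rewrite leNgt; apply/negP => lt.
have : \forall y \near K / 2, Npack nrm K * max_int < y ^+ d.
  exact: cvgr_gt (@exprn_continuous R d (K / 2)) _ lt.
move=> /nbhs_ballP [e /= e0 He].
pose m := Num.min (e / 2) (K / 4).
have m0 : 0 < m by rewrite lt_min !divr_gt0.
have me : m <= e / 2 by rewrite ge_min lexx.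
have mK : m <= K / 4 by rewrite ge_min lexx orbT.
have := He (K / 2 - m); rewrite /ball /= opprB addrCA subrr addr0 gtr0_norm//.
have h1 : m < e by lra.
move=> /(_ h1); rewrite ltNge step//; apply/andP; split; lra.
Qed.

End NpackBounds.

Lemma Npack_cvg : Npack nrm K / K ^+ d @[K --> +oo] --> (2 ^+ d * max_int)^-1.
Proof.
have L0 := max_int_gt0.
have p2 : 0 < (2 : R) ^+ d by rewrite exprn_gt0.
apply/cvgrPdist_le => e e0.
set b := (2 ^+ d * max_int)^-1.
have b0 : 0 < b by rewrite invr_gt0 mulr_gt0.
have lower (K : R) : 0 < K -> b <= Npack nrm K / K ^+ d.
  move=> K0; rewrite ler_pdivlMr ?exprn_gt0// /b mulrC ler_pdivrMr ?mulr_gt0//.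
  rewrite mulrCA mulrA [2 ^+ d * _]mulrC.
  by have := Npack_lower K0; rewrite expr_div_n ler_pdivrMr// => h; rewrite (le_trans h)// mulrAC.
have be0 : 0 < b + e by rewrite addr_gt0.
(* A [phi] with integral [I > I1] satisfies [2^-1 ^+ d / I < b + e], and the left side is the limit
   of the upper bound for [Npack nrm K / K ^+ d]. *)
pose I1 := 2^-1 ^+ d / (b + e).
have I1lt : 0 < max_int - I1.
  rewrite subr_gt0 /I1 ltr_pdivrMr// exprVn -ltr_pdivrMl// mulrC.
  by rewrite -invfM -/b ltrDl.
have [phi [L [fphi Lp supp]]] := max_int_approx_box I1lt.
rewrite opprB addrCA subrr addr0; set I := (\int[vol]_x phi x)%R => I1I.
have I0 : 0 < I by apply: lt_trans I1I; rewrite divr_gt0// exprn_gt0// invr_gt0.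
have : \forall y \near (2^-1 : R), y ^+ d < I * (b + e).
  apply: cvgr_lt (@exprn_continuous R d 2^-1) _ _.
  by move: I1I; rewrite /I1 ltr_pdivrMr.
move=> /nbhs_ballP [r /= r0 Hr].
pose q := r / 2; have q0 : 0 < q by rewrite divr_gt0.
have Hq : (2^-1 + q) ^+ d < I * (b + e).
  apply: Hr; rewrite /ball /= opprD addrA subrr add0r normrN gtr0_norm//.
  by rewrite /q; lra.
near=> K.
have K0 : 0 < K by near: K; exact: nbhs_pinfty_gt.
have KL : 2 * L / q <= K by near: K; apply: nbhs_pinfty_ge; exact: num_real.
have Kd0 : 0 < K ^+ d by rewrite exprn_gt0.
have lo := lower K K0.
rewrite distrC ger0_norm ?subr_ge0// lerBlDl.
rewrite ler_pdivrMr// -(ler_pM2r I0).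
apply: (le_trans (Npack_upper K0 fphi Lp supp)).
apply: (@le_trans _ _ ((K * (2^-1 + q)) ^+ d)).
  rewrite lerXn2r ?nnegrE//.
  - by rewrite addr_ge0 ?divr_ge0 ?mulr_ge0// ltW.
  - by rewrite mulr_ge0 ?addr_ge0// ltW.
  by move: KL; rewrite ler_pdivrMr//; lra.
rewrite exprMn mulrC -mulrA [K ^+ d * I]mulrC mulrA ler_pM2r// mulrC.
exact: ltW.
Unshelve. all: by end_near. Qed.

(** By the upper bound on [nrm], each point of the ball lies in a small rational grid cube contained
    in the ball, and such cubes are countable. *)
Lemma measurable_unit_ball : measurable (unit_ball nrm).
Proof.
pose cell (z : nat * {ffun 'I_d -> int}) : set V :=
  cube [tuple (z.2 i)%:~R / z.1.+1%:R | i < d] z.1.+1%:R^-1.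
pose F z := if `[< cell z `<=` unit_ball nrm >] then cell z else set0.
rewrite (_ : unit_ball nrm = \bigcup_z F z).
  apply: countable_bigcupT_measurable => [|z]; first exact: countableP.
  by rewrite /F; case: ifP => _ //; exact: measurable_cube.
apply/seteqP; split => x; last first.
  by move=> [z _]; rewrite /F; case: ifP => // /asboolP h /h.
rewrite /unit_ball /= => x1.
have C0 := nrm_upper_gt0 hnrm.
have u0 : 0 <= nrm_upper nrm / (1 - nrm x) by rewrite divr_ge0 ?subr_ge0 ?ltW.
have /andP [_] := truncn_itv u0; set m := Num.truncn _ => mlt.
have m0 : (0 : R) < m.+1%:R by rewrite ltr0n.
have mC : nrm_upper nrm / m.+1%:R < 1 - nrm x.
  by rewrite ltr_pdivrMr// mulrC -ltr_pdivrMr// subr_gt0.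
pose z : nat * {ffun 'I_d -> int} := (m, [ffun i => Num.floor (tnth x i * m.+1%:R)]).
have xz : cell z x.
  move=> i; rewrite tnth_mktuple ffunE /= ler_pdivrMr//.
  rewrite -[X in _ + X]mul1r -mulrDl ltr_pdivlMr//.
  have := floor_itv (tnth x i * m.+1%:R); rewrite intrD; by [].
exists z => //; rewrite /F; case: asboolP => // -[] y yz.
rewrite /unit_ball /=.
have -> : y = vadd (vsub y x) x.
  by apply: eq_from_tnth => i; rewrite tnth_vadd tnth_vsub subrK.
apply: (le_lt_trans (nrm_add hnrm _ _)).
move: (mC); rewrite ltrBrDr; apply: le_lt_trans; rewrite lerD2r.
apply: nrm_le_upper => //.
move=> i; rewrite tnth_vsub ler_norml.
have := xz i; have := yz i; set a := tnth _ i; set c := m.+1%:R^-1 => /andP [? ?] /andP [? ?].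
by apply/andP; split; lra.
Qed.

Lemma vol_unit_ball : (0 < vol (unit_ball nrm) < +oo)%E.
Proof.
have C0 := nrm_upper_gt0 hnrm; have mB := measurable_unit_ball.
apply/andP; split.
  pose a := (2 * nrm_upper nrm)^-1.
  have a0 : 0 < a by rewrite invr_gt0 mulr_gt0.
  apply: (@lt_le_trans _ _ (vol (cube vzero a))).
    by rewrite vol_cube// lte_fin exprn_gt0.
  apply: measure_subset => //; first exact: measurable_cube.
  move=> x xa; rewrite /unit_ball /=; apply: (@le_lt_trans _ _ (nrm_upper nrm * a)).
    apply: nrm_le_upper => //; last exact: ltW.
    move=> i; have := xa i; rewrite tnth_vzero add0r => /andP [x0 xa1].
    by rewrite ger0_norm// ltW.
  rewrite /a invfM mulrCA mulfV ?gt_eqF// mulr1; lra.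
have [c c0 cl] := nrm_lower hnrm d0.
have ci : 0 < c^-1 by rewrite invr_gt0.
apply: (@le_lt_trans _ _ (vol (cbox (vcst (- c^-1)) (vcst c^-1)))).
  apply: measure_subset => //; first exact: measurable_cbox.
  move=> x x1 i; rewrite !tnth_vcst -ler_norml -[leRHS]mulr1 ler_pdivlMl//.
  by apply: (le_trans (cl x i)); exact: ltW.
rewrite vol_cbox ?ltry// => i; rewrite !tnth_vcst; lra.
Qed.

Lemma limval_max_int :
  fine (vol (unit_ball nrm)) / (2 ^+ d * packing_density nrm vol) = max_int.
Proof.
have /andP [B0 Bfin] := vol_unit_ball.
set b := fine _; have b0 : 0 < b by rewrite fine_gt0// B0.
have L0 := max_int_gt0.
have -> : packing_density nrm vol = b * (2 ^+ d * max_int)^-1.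
  rewrite /packing_density -/b; apply: cvg_lim => //.
  rewrite (_ : (fun K => _) = (fun K => b * (Npack nrm K / K ^+ d))); last first.
    by apply/funext => K; rewrite mulrAC mulrC.
  by apply: cvgMr; exact: Npack_cvg.
by field; rewrite !gt_eqF ?exprn_gt0.
Qed.

Notation fchi := (f_chi vol nrm).

Lemma fchi_ge phi t : feasible nrm phi -> (xi vol phi t <= fchi t)%E.
Proof. by move=> fphi; apply: ereal_sup_ubound; exists phi. Qed.

(** At a fixed [u] the bound is uniform in the feasible function, since [logmgf] is controlled by
    the integral alone. *)
Lemma fchi_upper t u : 0 < t -> 0 < u ->
  (fchi t <= ((t^-1 + u * expR u * max_int) / u)%:E)%E.
Proof.
move=> t0 u0; apply: ge_ereal_sup => _ [phi fphi <-].
have mphi := feasible_measurable fphi; have phi01 := feasible_01 fphi.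
have Iphi := feasible_integrable fphi.
apply: (le_trans (xi_le mphi phi01 Iphi t0 u0)).
rewrite lee_fin ler_wpM2r ?invr_ge0 ?(ltW u0)// lerD2l.
apply: (le_trans (logmgf_le mphi phi01 Iphi (ltW u0))).
by rewrite ler_wpM2l ?mulr_ge0 ?expR_ge0 ?(ltW u0)// max_int_ge.
Qed.

Lemma fchi_ge_max_int t : 0 < t -> (max_int%:E <= fchi t)%E.
Proof.
move=> t0; apply/lee_addgt0Pr => e e0.
have [phi fphi lt] := max_int_approx e0.
apply: (@le_trans _ _ ((\int[vol]_x phi x)%R%:E + e%:E)%E).
  by rewrite -EFinD lee_fin -lerBlDr ltW.
rewrite leeD2r//; apply: le_trans (fchi_ge t fphi).
have mphi := feasible_measurable fphi; have phi01 := feasible_01 fphi.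
have Iphi := feasible_integrable fphi.
by have := xi_ge_int mphi phi01 Iphi t0.
Qed.

Lemma fchi_fin_num t : 0 < t -> fchi t \is a fin_num.
Proof.
move=> t0; rewrite ge0_fin_numE.
  by apply: (le_lt_trans (fchi_upper t0 ltr01)); rewrite ltry.
by apply: le_trans (fchi_ge_max_int t0); rewrite lee_fin ltW// max_int_gt0.
Qed.

Lemma fchi_anti s t : 0 < s -> s <= t -> (fchi t <= fchi s)%E.
Proof.
move=> s0 st; apply: ge_ereal_sup => _ [phi fphi <-].
apply: le_trans (fchi_ge s fphi).
exact: xi_anti (feasible_measurable fphi) (feasible_01 fphi) (feasible_integrable fphi) _ _ s0 st.
Qed.

Lemma fchi_scale t l : 0 < t -> 1 <= l -> (fchi (t / l) <= l%:E * fchi t)%E.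
Proof.
move=> t0 l1; apply: ge_ereal_sup => _ [phi fphi <-].
apply: (le_trans (xi_scale (feasible_measurable fphi) (feasible_01 fphi) (feasible_integrable fphi) t0 l1)).
by apply: lee_wpmul2l; [rewrite lee_fin (le_trans _ l1)|exact: fchi_ge].
Qed.

(** [fchi] is antitone, and changing its argument by a factor up to [l] changes it by a factor at
    most [l]; take [l] near 1 with [(l - 1) * F t <= e]. *)
Lemma fchi_continuous t : 0 < t -> {for t, continuous (fun u => fine (fchi u))}.
Proof.
move=> t0; set F := fun u => fine (fchi u).
have Fp u : 0 < u -> 0 < F u.
  move=> u0; apply: (lt_le_trans max_int_gt0).
  by rewrite -lee_fin /F fineK ?fchi_fin_num// fchi_ge_max_int.
have Fanti s u : 0 < s -> s <= u -> F u <= F s.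
  move=> s0 su; rewrite fine_le ?fchi_fin_num ?fchi_anti//; exact: lt_le_trans su.
have Fscale u l : 0 < u -> 1 <= l -> F (u / l) <= l * F u.
  move=> u0 l1; have l0 : 0 < l by lra.
  have fu := fchi_fin_num u0; have fl := fchi_fin_num (divr_gt0 u0 l0).
  by have := fchi_scale u0 l1; rewrite -(fineK fu) -(fineK fl) -EFinM lee_fin.
apply/cvgrPdist_le => e e0.
pose l := 1 + e / (F t + e).
have Ft := Fp _ t0.
have Fe : 0 < F t + e by rewrite addr_gt0.
have q0 : 0 < e / (F t + e) by rewrite divr_gt0.
have l1 : 1 < l by rewrite /l ltrDl.
have l0 : 0 < l by lra.
have lE : (l - 1) * F t <= e.
  rewrite /l addrC addKr mulrAC ler_pdivrMr// ler_pM2l//; lra.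
clearbody l.
have tl : t / l < t by rewrite ltr_pdivrMr// ltr_pMr.
have tl2 : t < t * l by rewrite ltr_pMr.
have near1 : \forall u \near t, t / l < u by exact: lt_nbhsr.
have near2 : \forall u \near t, u < t * l by exact: lt_nbhsl.
near=> u.
have u1 : t / l < u by near: u.
have u2 : u < t * l by near: u.
have u0 : 0 < u by apply: lt_trans u1; rewrite divr_gt0.
have h1 : F u <= l * F t.
  by apply: le_trans (Fscale _ _ t0 (ltW l1)); apply: Fanti; [rewrite divr_gt0|exact: ltW].
have h2 : F t <= l * F u.
  apply: le_trans (Fscale _ _ u0 (ltW l1)); apply: Fanti; first by rewrite divr_gt0.
  by rewrite ler_pdivrMr// ltW.
move: Ft h1 h2 lE; move: (F t) (F u) => a b a0 h1 h2 lE.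
have h3 : a - b <= (l - 1) * a.
  have [le|lt] := lerP b a; last first.
    have : 0 <= (l - 1) * a by rewrite mulr_ge0 ?(ltW a0)//; lra.
    lra.
  have : (l - 1) * b <= (l - 1) * a by rewrite ler_wpM2l//; lra.
  lra.
by rewrite ler_norml; apply/andP; split; lra.
Unshelve. all: by end_near. Qed.

(** Squeeze between [max_int] and [(t * u)^-1 + expR u * max_int]: first fix a small [u], then let
    [t] grow. *)
Lemma fchi_cvg_pinfty : fchi t @[t --> +oo] --> max_int%:E.
Proof.
have L0 := max_int_gt0.
apply/fine_cvgP; split.
  by near=> t; apply: fchi_fin_num; near: t; exact: nbhs_pinfty_gt.
apply/cvgrPdist_le => e e0 /=.
have E1 := expR_gt0 (1 : R).
pose u := Num.min 1 (e / (2 * max_int * expR 1)).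
have u0 : 0 < u by rewrite lt_min ltr01 divr_gt0 ?mulr_gt0.
have u1 : u <= 1 by rewrite ge_min lexx.
have u2 : u * (2 * max_int * expR 1) <= e.
  by rewrite -ler_pdivlMr ?mulr_gt0// ge_min lexx orbT.
have eu : (expR u - 1) * max_int <= e / 2.
  have : expR u - 1 <= u * expR 1.
    by apply: (le_trans (expR_sub1_le _)); rewrite ler_wpM2l ?(ltW u0)// ler_expR.
  by move=> h; have : (expR u - 1) * max_int <= u * expR 1 * max_int; [rewrite ler_wpM2r// ltW|lra].
near=> t.
have t0 : 0 < t by near: t; exact: nbhs_pinfty_gt.
have t1 : 2 / (u * e) <= t by near: t; apply: nbhs_pinfty_ge; exact: num_real.
have ft := fchi_fin_num t0.
have h1 := fchi_ge_max_int t0; have h2 := fchi_upper t0 u0.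
move: h1 h2; rewrite -(fineK ft) !lee_fin => h1.
have -> : (t^-1 + u * expR u * max_int) / u = (t * u)^-1 + expR u * max_int.
  by field; rewrite !gt_eqF.
have : (t * u)^-1 <= e / 2.
  move: t1; rewrite ler_pdivrMr ?mulr_gt0// => t1.
  by rewrite -[leLHS]mul1r ler_pdivrMr ?mulr_gt0//; lra.
by move=> h2 h3; rewrite distrC ger0_norm; lra.
Unshelve. all: by end_near. Qed.

Lemma fchi_cvg_0 : fchi t @[t --> 0^'+] --> +oo%E.
Proof.
apply/cvgeyPge => A; pose B := Num.max A 1.
have B0 : 0 < B by rewrite lt_max ltr01 orbT.
have AB : A <= B by rewrite le_max lexx.
have h0 : 0 < (nrm_upper nrm)^-1 by rewrite invr_gt0 nrm_upper_gt0.
have fphi := small_cube_feasible.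
have := cube_indicator_int vzero 1 h0.
set phi := (fun y => _) in fphi *; rewrite mul1r; set v := _ ^+ d => Iv.
have v0 : 0 < v by rewrite exprn_gt0.
have mphi := feasible_measurable fphi; have phi01 := feasible_01 fphi.
have Iphi := feasible_integrable fphi.
have phiE x : phi x = 0 \/ phi x = 1.
  by rewrite /phi mul1r indicE; case: (x \in _); [right|left].
clearbody phi.
have lam s : 0 < s -> s ^+ 2 / 2 * v <= logmgf vol phi s.
  move=> s0; rewrite -Iv -RintegralZl//; apply: le_Rintegral => //.
  - exact: (@integrableZl _ _ _ vol setT measurableT _ (EFin \o phi)).
  - by apply: integrable_logmgf => //; exact: ltW.
  move=> x _; case: (phiE x) => ->; first by rewrite !mulr0 expR0 subrr.
  by rewrite !mulr1; have := expR_ge1Dxn 1%N (ltW s0); rewrite lerBrDl.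
near=> t.
have t0 : 0 < t by near: t; exact: nbhs_right_gt.
have t1 : t < (2 * B ^+ 2 / v)^-1.
  by near: t; apply: nbhs_right_lt; rewrite invr_gt0 divr_gt0 ?mulr_gt0 ?exprn_gt0.
have ti : 2 * B ^+ 2 / v < t^-1.
  by rewrite -[ltLHS]invrK ltf_pV2 ?posrE// invr_gt0 divr_gt0 ?mulr_gt0 ?exprn_gt0.
apply: le_trans (fchi_ge t fphi).
have [|s s0 ->] := xi_attained mphi phi01 Iphi t0; first by rewrite Iv.
rewrite lee_fin (le_trans AB)// ler_pdivlMr//.
have ls := lam s s0; have ti0 : 0 < t^-1 by rewrite invr_gt0.
move: ti; rewrite ltr_pdivrMr// => ti.
(* For large [s] the quadratic bound on [logmgf] exceeds [B * s]; for small [s] the term [t^-1]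
   does. *)
have [le|lt] := lerP (2 * B) (s * v).
  have : B * s <= s ^+ 2 / 2 * v.
    have : 0 <= (s * v - 2 * B) * s by rewrite mulr_ge0 ?subr_ge0// ltW.
    nra.
  lra.
have : B * s * v <= t^-1 * v.
  apply: le_trans (ltW ti); rewrite -mulrA expr2 mulrA.
  have : B * (s * v) <= B * (2 * B) by rewrite ler_pM2l// ltW.
  nra.
rewrite ler_pM2r// => h; have := lam s s0; have : 0 <= s ^+ 2 / 2 * v.
  by rewrite mulr_ge0 ?divr_ge0 ?sqr_ge0 ?ltW.
lra.
Unshelve. all: by end_near. Qed.

End Packing.

(** * Chromatic numbers of geometric graphs *)

Section Chromatic.
Variable (n : nat) (adj : rel 'I_n).

Lemma colorableP (T : finType) (c : 'I_n -> T) (k : nat) : (#|T| <= k)%N ->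
  (forall i j, adj i j -> c i != c j) -> colorable n adj k.
Proof.
move=> Tk cP; apply/existsP.
exists [ffun i => widen_ord Tk (enum_rank (c i))].
apply/forallP => i; apply/forallP => j; apply/implyP => /cP; rewrite !ffunE.
by apply: contraNneq => /(congr1 val) /= /val_inj /enum_rank_inj ->.
Qed.

Lemma chromatic_le k : colorable n adj k -> (chromatic n adj <= k)%N.
Proof.
move=> ck; have [kn|nk] := leqP k n.
  pose i := Ordinal (kn : (k < n.+1)%N).
  rewrite /chromatic -big_filter.
  have : i \in [seq j : 'I_n.+1 <- index_enum 'I_n.+1 | colorable n adj (j : 'I_n.+1)].
    by rewrite mem_filter ck mem_index_enum.
  elim: [seq _ <- _ | _] => //= j l IH; rewrite inE big_cons => /predU1P [<-|/IH].
    exact: geq_minl.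
  exact: leq_trans (geq_minr _ _).
apply: leq_trans (ltnW nk).
by rewrite /chromatic; elim/big_ind : _ => // [a b ab _|i _]; [rewrite geq_min ab|rewrite -ltnS].
Qed.

Lemma chromatic_colorable : irreflexive adj -> colorable n adj (chromatic n adj).
Proof.
move=> irr; rewrite /chromatic; elim/big_ind : _ => //.
  apply: (@colorableP 'I_n id); first by rewrite card_ord.
  by move=> i j; apply: contraTneq => ->; rewrite irr.
by move=> a b ca cb; rewrite /minn; case: ifP.
Qed.

(** Greedy colouring in the order of the vertices: neighbours occupy fewer than [k] colours. *)
Lemma colorable_degree (k : nat) : symmetric adj -> irreflexive adj ->
  (forall i, (#|[pred j | adj i j]| < k)%N) -> colorable n adj k.
Proof.
move=> sym irr deg.
have [n0|n0] := posnP n.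
  by apply: (@colorableP 'I_n id) => [|i]; [rewrite card_ord n0|have := ltn_ord i; rewrite {2}n0].
have k0 : (0 < k)%N by apply: leq_trans (deg (Ordinal n0)).
suff [c H] : exists c : 'I_n -> 'I_k, forall i j : 'I_n, (i < n)%N -> (j < n)%N -> adj i j -> c i != c j.
  by apply: (@colorableP 'I_k c); [rewrite card_ord|move=> i j; apply: H].
suff : forall m, exists c : 'I_n -> 'I_k, forall i j : 'I_n, (i < m)%N -> (j < m)%N -> adj i j -> c i != c j.
  exact.
elim=> [|m [c IH]]; first by exists (fun=> Ordinal k0).
have [mn|nm] := ltnP m n; last first.
  by exists c => i j _ _; apply: IH; exact: leq_trans (ltn_ord _) nm.
pose v := Ordinal mn.
have [e He] : exists e, e \notin [seq c j | j in [pred j | adj v j]].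
  apply/existsP; rewrite -negb_forall; apply: contraL (deg v) => /forallP all.
  rewrite -leqNgt -[X in (X <= _)%N](card_ord k).
  apply: leq_trans (leq_image_card c _).
  by apply: subset_leq_card; apply/fintype.subsetP => e _; exact: all.
exists (fun i => if i == v then e else c i) => i j im jm aij.
have [iv|iv] := eqVneq i v; have [jv|jv] := eqVneq j v.
- by move: aij; rewrite iv jv irr.
- by apply: contraNneq He => ->; apply: fintype.image_f; rewrite inE -iv.
- by apply: contraNneq He => <-; apply: fintype.image_f; rewrite inE -jv sym.
have lt (l : 'I_n) : (l < m.+1)%N -> l != v -> (l < m)%N.
  by rewrite ltnS leq_eqVlt => /predU1P [e1|//]; rewrite -val_eqE /= e1 eqxx.
by apply: IH => //; apply: lt.
Qed.

End Chromatic.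

(** * Geometric graphs, cells and windows of cells *)

Section Geometric.
Context {R : realType} {d : nat}.
Notation V := (d.-tuple R).
Variable nrm : V -> R.
Hypothesis hnrm : is_norm nrm.
Variable x : nat -> V.
Implicit Types (r : R) (n : nat).

Lemma rgg_irr r n : irreflexive (rgg_adj nrm x r n).
Proof. by move=> i; rewrite /rgg_adj eqxx. Qed.

Lemma rgg_sym r n : symmetric (rgg_adj nrm x r n).
Proof. by move=> i j; rewrite /rgg_adj eq_sym (nrm_subC hnrm). Qed.

Lemma rgg_chromatic_ge (phi : V -> R) r n (p : V) : feasible nrm phi -> 0 < r ->
  \sum_(i < n) phi (vscale r^-1 (vsub (x i) p)) <=
  (chromatic n (rgg_adj nrm x r n))%:R.
Proof.
move=> fphi r0.
have /existsP [c /forallP cP] := chromatic_colorable (@rgg_irr r n).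
set k := chromatic _ _ in c cP *.
rewrite (partition_big c predT)//=.
rewrite -[k in leRHS](card_ord k) -sum1_card natr_sum.
apply: ler_sum => a _.
apply: (feasible_sum hnrm fphi (P := fun i => c i == a)
  (v := fun i : 'I_n => vscale r^-1 (vsub (x i) p))) => i j /eqP ca /eqP cb ij.
rewrite (_ : vsub _ _ = vscale r^-1 (vsub (x i) (x j))); last first.
  by apply: eq_from_tnth => l; rewrite !(tnth_vsub, tnth_vscale); ring.
rewrite nrm_scale// gtr0_norm ?invr_gt0// ltr_pdivlMl// mulr1 ltNge.
apply/negP => le; have /forallP /(_ j) := cP i.
by rewrite /rgg_adj ij le /= ca cb eqxx.
Qed.

Definition cellidx (h : R) (y : V) : {ffun 'I_d -> int} :=
  [ffun i => Num.floor (tnth y i / h)].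

(** Position inside the window of [m] cells per axis with corner [z]; [None] stands for everything
    outside, which keeps the label type finite. *)
Definition label (h : R) (m : nat) (z : {ffun 'I_d -> int}) (y : V) :
    option {ffun 'I_d -> 'I_m} :=
  [pick q : {ffun 'I_d -> 'I_m} | [forall i, cellidx h y i == z i + (q i : nat)%:Z]].

Lemma labelP h m z y q : label h m z y = Some q <->
  forall i, cellidx h y i = z i + (q i : nat)%:Z.
Proof.
rewrite /label; case: pickP => [q' /forallP hq'|h0]; split => //.
- by case=> <- i; apply/eqP.
- move=> hq; congr Some; apply/ffunP => i; apply/val_inj.
  by have /eqP := hq' i; rewrite hq => /addrI [].
- by move=> hq; have /negP := h0 q; case; apply/forallP => i; apply/eqP.
Qed.

Lemma label_cube h m z q : 0 < h ->
  [set y | label h m z y = Some q] =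
  cube [tuple h * ((z i)%:~R + (q i)%:R) | i < d] h.
Proof.
move=> h0; apply/seteqP; split => y /=.
  move=> /labelP hq i; rewrite tnth_mktuple.
  have := floor_itv (tnth y i / h); have := hq i; rewrite ffunE => ->.
  rewrite !intrD -!pmulrn ler_pdivlMr// ltr_pdivrMr// !mulrDl mul1r.
  by move=> /andP [? ?]; apply/andP; split; lra.
move=> hy; apply/labelP => i; rewrite ffunE; apply/eqP.
rewrite floor_eq !intrD -!pmulrn ler_pdivlMr// ltr_pdivrMr//.
by have := hy i; rewrite tnth_mktuple => /andP [? ?]; apply/andP; split; lra.
Qed.

Definition optw {C : Type} (w : C -> R) (o : option C) : R :=
  if o is Some q then w q else 0.

Lemma optw_count {C : finType} (w : C -> R) n (l : 'I_n -> option C) :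
  \sum_(i < n) optw w (l i) =
  \sum_q w q * #|[pred i : 'I_n | l i == Some q]|%:R.
Proof.
transitivity (\sum_(i < n) \sum_q (if l i == Some q then w q else 0)).
  apply: eq_bigr => i _; rewrite /optw; case: (l i) => [q|].
    rewrite (bigD1 q)//= eqxx big1 ?addr0// => q' /negbTE qq'.
    by rewrite (_ : (Some q == Some q') = (q == q'))// eq_sym qq'.
  by rewrite big1.
rewrite exchange_big /=; apply: eq_bigr => q _.
by rewrite -big_mkcond sumr_const mulr_natr.
Qed.

(* Two points at distance at most [r] lie in cells that differ by at most
   [boxhw] in each coordinate, so a window of [2 * boxhw + 1] cells contains
   every neighbour of a point of its middle cell. *)
Lemma rgg_degree (c : R) : 0 < c -> (forall y i, c * `|tnth y i| <= nrm y) ->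
  let w := (Num.truncn c^-1).+2 in
  forall r n k, 0 < r ->
  (forall z, \sum_(i < n) optw (fun=> 1) (label r w.*2.+1 z (x i)) < (k.+2)%:R) ->
  (chromatic n (rgg_adj nrm x r n) <= k.+1)%N.
Proof.
move=> c0 cl w r n k r0 H; apply: chromatic_le; apply: colorable_degree.
- exact: rgg_sym.
- exact: rgg_irr.
move=> i; rewrite ltnS.
pose z : {ffun 'I_d -> int} := [ffun a => cellidx r (x i) a - w%:Z].
have := H z; rewrite optw_count.
pose A := [pred j : 'I_n | label r w.*2.+1 z (x j) != None].
have lab j : j = i \/ rgg_adj nrm x r n i j -> j \in A.
  move=> hj; have dist a : `|tnth (x i) a - tnth (x j) a| <= c^-1 * r.
    have : c * `|tnth (vsub (x i) (x j)) a| <= r.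
      case: hj => [->|/andP [_ le]]; last exact: le_trans (cl _ _) le.
      by rewrite tnth_vsub subrr normr0 mulr0 ltW.
    by rewrite tnth_vsub mulrC -ler_pdivlMr// mulrC.
  have bnd a : (`|cellidx r (x j) a - z a| < w.*2.+1)%N /\ 0 <= cellidx r (x j) a - z a.
    have c1 : c^-1 < w%:R - 1.
      have ci : 0 <= c^-1 by rewrite invr_ge0 ltW.
      by have /andP [_] := truncn_itv ci; rewrite /w -[_.+2%:R]natr1; lra.
    have fi := floor_itv (tnth (x i) a / r); have fj := floor_itv (tnth (x j) a / r).
    have dd : `|tnth (x i) a / r - tnth (x j) a / r| <= c^-1.
      by rewrite -mulrBl normrM [`|r^-1|]gtr0_norm ?invr_gt0// ler_pdivrMr.
    have : - (w%:Z)%:~R < ((cellidx r (x j) a - cellidx r (x i) a)%:~R : R) < (w%:Z)%:~R.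
      rewrite intrB !ffunE; move: fi fj dd; rewrite !intrD ler_norml -pmulrn.
      by move=> /andP [? ?] /andP [? ?] /andP [? ?]; apply/andP; split; lra.
    rewrite -mulrNz !ltr_int !ffunE => /andP [].
    set f1 := Num.floor _; set f2 := Num.floor _ => h1 h2; clear -h1 h2; split; lia.
  rewrite inE /A /=; apply/negP => /eqP.
  have q0 a : (`|cellidx r (x j) a - z a|%N < w.*2.+1)%N by case: (bnd a).
  suff -> : label r w.*2.+1 z (x j) = Some [ffun a => Ordinal (q0 a)] by [].
  apply/labelP => a; have [_ h] := bnd a.
  transitivity (z a + (cellidx r (x j) a - z a)); first by rewrite addrC subrK.
  by congr (_ + _); rewrite -[LHS]gez0_abs// [in RHS]ffunE.
have -> : \sum_q 1 * #|[pred j : 'I_n | label r w.*2.+1 z (x j) == Some q]|%:R =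
    (#|A|%:R : R).
  rewrite -sum1_card natr_sum (eq_bigr (fun q => \sum_(j < n) (label r w.*2.+1 z (x j) == Some q)%:R)); last first.
    move=> q _; rewrite mul1r -sum1_card natr_sum big_mkcond; apply: eq_bigr => j _.
    by rewrite inE; case: (_ == _).
  rewrite exchange_big [RHS]big_mkcond /=; apply: eq_bigr => j _.
  rewrite inE; case: (label _ _ _ _) => [q|] /=; last by rewrite big1.
  rewrite (bigD1 q)//= eqxx big1 ?addr0// => q' /negbTE qq'.
  by rewrite (_ : (Some q == Some q') = (q == q'))// eq_sym qq'.
rewrite ltr_nat ltnS => Ak; rewrite -ltnS; apply: leq_trans Ak.
rewrite (cardD1 i A) lab; last by left.
rewrite add1n ltnS; apply: subset_leq_card; apply/fintype.subsetP => j; rewrite inE => aij.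
have ji : j != i by move: aij; rewrite /rgg_adj eq_sym => /andP [].
by apply/andP; split => //; apply: lab; right.
Qed.

End Geometric.

(** Points of one cell are told apart by their rank among them, used as an index into the colours of
    the cell. *)
Lemma rank_coloring (n : nat) (A : eqType) (K : finType) (f : 'I_n -> A)
    (cols : A -> {set K}) :
  (forall i, #|[pred j | f j == f i]| <= #|cols (f i)|)%N ->
  exists c : 'I_n -> K, (forall i, c i \in cols (f i)) /\
    forall i j, f i = f j -> c i = c j -> i = j.
Proof.
move=> H; pose rk i := #|[pred j : 'I_n | (f j == f i) && (j < i)%N]|.
have rkP i : (rk i < #|cols (f i)|)%N.
  apply: leq_trans (H i); rewrite [X in (_ < X)%N](cardD1 i) inE eqxx add1n ltnS.
  apply: subset_leq_card; apply/fintype.subsetP => j; rewrite !inE => /andP [-> ji].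
  by rewrite andbT -val_eqE ltn_eqF.
have rk_lt i j : f i = f j -> (i < j)%N -> (rk i < rk j)%N.
  move=> fij ij; rewrite /rk [X in (_ < X)%N](cardD1 i) inE fij eqxx ij add1n ltnS.
  apply: subset_leq_card; apply/fintype.subsetP => l; rewrite !inE => /andP [-> li].
  by rewrite -val_eqE ltn_eqF//= (ltn_trans li).
exists (fun i => enum_val (Ordinal (rkP i))); split=> [i|i j fij]; first exact: enum_valP.
rewrite (enum_val_nth (enum_val (Ordinal (rkP i)))).
rewrite [RHS](enum_val_nth (enum_val (Ordinal (rkP i)))) /= -fij => /eqP.
rewrite nth_uniq ?enum_uniq -?cardE// ?rkP// ?fij// => /eqP rij.
apply/val_inj; case: (ltngtP i j) => // ij.
  by have := rk_lt _ _ fij ij; rewrite rij ltnn.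
by have := rk_lt _ _ (esym fij) ij; rewrite rij ltnn.
Qed.

Lemma dvdz_small (m : nat) (z : int) : (m%:Z %| z)%Z -> (`|z| < m)%N -> z = 0.
Proof.
move=> mz zm; apply/eqP; rewrite -absz_eq0 -leqn0 leqNgt; apply/negP => z0.
by move: mz; rewrite dvdzE absz_nat gtnNdvd.
Qed.

(** Distinct boxes of one shifted grid have corners at least [M + w] apart in some coordinate, so
    their inner cells differ there by more than [w]. *)
Lemma distz_gap (M w q q' : nat) (b b' : int) : (M + w <= `|(b - b')%R|)%N ->
  (q < M)%N -> (q' < M)%N -> (w < `|((b + q%:Z) - (b' + q'%:Z))%R|)%N.
Proof. lia. Qed.

(** * Corridors between boxes, in all shifted positions *)

Section Corridor.
Context {R : realType} {d : nat}.
Notation V := (d.-tuple R).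
Notation Z := {ffun 'I_d -> int}.
Variable nrm : V -> R.
Variables (eps rho : R) (M w : nat).
Notation C := {ffun 'I_d -> 'I_M}.
Notation m := (M + w)%N.

Definition cellgap (p q : Z) : V := [tuple eps * (p i - q i)%:~R | i < d].

Definition intpt (q : C) : Z := [ffun i => (q i : nat)%:Z].

Definition shiftc (z : Z) (q : C) : Z := [ffun i => z i + (q i : nat)%:Z].

Definition cell_stable : pred {set C} := fun S =>
  [forall p in S, forall q in S, (p != q) ==> (rho < nrm (cellgap (intpt p) (intpt q)))].

Lemma cell_stableP S p q : cell_stable S -> p \in S -> q \in S -> p != q ->
  rho < nrm (cellgap (intpt p) (intpt q)).
Proof.
by move=> /forallP /(_ p) /implyP h pS qS pq; move: (h pS) => /forallP /(_ q); rewrite qS pq.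
Qed.

Lemma cell_stable0 : cell_stable (@finset.set0 C).
Proof. by apply/forallP => p; rewrite inE. Qed.

Lemma cell_stable1 p : cell_stable [set p]%SET.
Proof.
apply/forallP => q; apply/implyP; rewrite inE => /eqP ->.
apply/forallP => q'; apply/implyP; rewrite inE => /eqP ->.
by rewrite eqxx.
Qed.

(** Position of [p] in the grid of period [M + w] shifted by [a]: values below [M] are inside a box,
    the other [w] values form the corridor. *)
Definition offset (a : nat) (p : Z) (i : 'I_d) : nat := `|((p i - a%:Z) %% m%:Z)%Z|%N.

Definition base (a : nat) (p : Z) : Z := [ffun i => p i - (offset a p i)%:Z].

Hypothesis w0 : (d * w < m)%N.

Let m0 : (0 < m)%N. Proof. exact: leq_ltn_trans w0. Qed.

Lemma offsetE a p i : (offset a p i)%:Z = ((p i - a%:Z) %% m%:Z)%Z.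
Proof. by rewrite /offset gez0_abs// modz_ge0// -lt0n. Qed.

Lemma offset_lt a p i : (offset a p i < m)%N.
Proof. by rewrite -ltz_nat offsetE; apply: ltz_pmod. Qed.

Lemma base_mod a p i : (m%:Z %| base a p i - a%:Z)%Z.
Proof.
rewrite ffunE offsetE; set y := p i - a%:Z.
rewrite (_ : _ - _ - _ = y - (y %% m%:Z)%Z); last by rewrite /y; ring.
by rewrite {1}(divz_eq y m%:Z) addrK dvdz_mull.
Qed.

Definition inner (p : Z) : {set 'I_m} := [set a : 'I_m | [forall i, (offset a p i < M)%N]]%SET.

(** In each coordinate at most [w] of the [m] shifts put [p] in a corridor. *)
Lemma card_inner p : (m - d * w <= #|inner p|)%N.
Proof.
rewrite -[X in (X - _)%N](card_ord m) -(cardsC (inner p)) leq_subLR addnC leq_add2r.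
rewrite (_ : (~: inner p)%SET = \bigcup_(i < d) [set a : 'I_m | (M <= offset a p i)%N])%SET; last first.
  apply/setP => a; rewrite !inE negb_forall; apply/existsP/bigcupP => [[i]|[i _]].
    by rewrite -leqNgt => h; exists i => //; rewrite inE.
  by rewrite inE leqNgt => h; exists i.
have bad i : (#|[set a : 'I_m | (M <= offset a p i)%N]%SET| <= w)%N.
  have inj : {in [set a : 'I_m | (M <= offset a p i)%N]%SET &,
      injective (fun a : 'I_m => Ordinal (offset_lt a p i))}.
    move=> a b _ _ /(congr1 val) /= /(congr1 Posz); rewrite !offsetE => /eqP.
    rewrite eqz_mod_dvd => h; apply/val_inj/eqP; rewrite -eqz_nat -subr_eq0 -oppr_eq0 opprB.
    apply/eqP/(@dvdz_small m); first by rewrite (_ : _ - _ = p i - a%:Z - (p i - b%:Z))//; ring.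
    by have := ltn_ord a; have := ltn_ord b; rewrite /= => ? ?; lia.
  rewrite -(card_in_imset inj).
  apply: leq_trans (_ : #|[set rshift M k | k : 'I_w]%SET| <= w)%N; last first.
    by apply: leq_trans (leq_imset_card _ _) _; rewrite card_ord.
  apply: subset_leq_card; apply/fintype.subsetP => b /imsetP [a]; rewrite inE => Ma ->.
  have lw : (offset a p i - M < w)%N by have := offset_lt a p i; lia.
  by apply/imsetP; exists (Ordinal lw) => //; apply/val_inj; rewrite /= subnKC.
suff h (s : seq 'I_d) : (#|(\bigcup_(i <- s) [set a : 'I_m | (M <= offset a p i)%N])%SET| <= size s * w)%N.
  by have := h (enum 'I_d); rewrite size_enum_ord big_enum.
elim: s => [|i s IH]; first by rewrite big_nil cards0.
rewrite big_cons; apply: leq_trans (leq_card_setU _ _) _.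
by rewrite mulSn leq_add.
Qed.

Variables (T : nat) (l : Z -> seq {set C}).
Hypothesis lT : forall z, (size (l z) <= T)%N.
Hypothesis lstable : forall z, all cell_stable (l z).

(** A colour is a shift together with an index into a list of stable sets. The cell [p] may use it
    if that shift keeps [p] out of the corridors and the indexed set of its box contains its
    position. All boxes of a shift share the same colours. *)
Definition palette (p : Z) : {set 'I_m * 'I_T} :=
  [set k : 'I_m * 'I_T | [exists q : C, [forall i, (q i == offset k.1 p i :> nat)] &&
     (q \in nth (@finset.set0 C) (l (base k.1 p)) k.2)]]%SET.

(** Inside one box, a common colour would put two close cells in one stable set; in different boxes,
    a corridor separates them by more than [rho]. *)
Lemma palette_disjoint (c0 : R) p p' : 0 < c0 -> 0 < eps ->
  (forall y i, c0 * `|tnth y i| <= nrm y) -> rho <= c0 * eps * w%:R ->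
  nrm (cellgap p p') <= rho -> p != p' -> forall k, k \in palette p -> k \notin palette p'.
Proof.
move=> c00 eps0 cl hw near pp' [a t] kp; apply/negP => kp'.
move: kp kp'; rewrite !inE /= => /existsP [q /andP [/forallP hq qS]] /existsP [q' /andP [/forallP hq' qS']].
have pE i : p i = base a p i + (q i)%:Z by rewrite (eqP (hq i)) [base _ _ _]ffunE subrK.
have pE' i : p' i = base a p' i + (q' i)%:Z by rewrite (eqP (hq' i)) [base _ _ _]ffunE subrK.
have [zz|zz] := eqVneq (base a p) (base a p').
  have st : cell_stable (nth (@finset.set0 C) (l (base a p)) t).
    have [tl|tl] := ltnP t (size (l (base a p))); last by rewrite nth_default// cell_stable0.
    by have /allP := lstable (base a p); apply; apply: mem_nth.
  have qq : q != q'.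
    by apply: contra_neq pp' => qq; apply/ffunP => i; rewrite pE pE' zz qq.
  have := cell_stableP st qS; rewrite {1}zz => /(_ _ qS' qq).
  suff -> : cellgap (intpt q) (intpt q') = cellgap p p' by rewrite ltNge near.
  apply: eq_from_tnth => i; rewrite !tnth_mktuple !(ffunE (fun _ => _%:Z)).
  by rewrite pE pE' zz; congr (_ * _%:~R); ring.
have [i zi] : exists i, base a p i != base a p' i.
  apply/existsP; rewrite -negb_forall; apply: contra zz => /forallP h.
  by apply/eqP/ffunP => i; exact/eqP.
have dv : (m%:Z %| base a p i - base a p' i)%Z.
  rewrite (_ : _ - _ = (base a p i - a%:Z) - (base a p' i - a%:Z)); last by ring.
  by apply: rpredB; exact: base_mod.
have big : (m <= `|base a p i - base a p' i|)%N.
  by rewrite leqNgt; apply: contra zi => h; rewrite -subr_eq0 (dvdz_small dv h).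
have gap : (w < `|p i - p' i|)%N.
  by rewrite pE pE'; exact: distz_gap big (ltn_ord _) (ltn_ord _).
have := cl (cellgap p p') i; rewrite tnth_mktuple normrM (gtr0_norm eps0) mulrA.
apply/negP; rewrite -ltNge; apply: le_lt_trans (near) _.
apply: le_lt_trans hw _; rewrite ltr_pM2l ?mulr_gt0//.
by rewrite -intr_norm -abszE ltr_nat.
Qed.

(** Each of the at least [m - d * w] good shifts supplies its share of the [N p] colours. *)
Lemma palette_card (N : Z -> nat) p :
  (forall z q, N (shiftc z q) <=
     (m - d * w) * count (fun S : {set C} => q \in S) (l z))%N ->
  (N p <= #|palette p|)%N.
Proof.
move=> HN; have g0 : (0 < m - d * w)%N by rewrite subn_gt0.
rewrite -(leq_pmul2l g0).
have slice (a : 'I_m) : a \in inner p ->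
    (N p <= (m - d * w) * #|[pred t : 'I_T | (a, t) \in palette p]|)%N.
  rewrite inE => /forallP ia; pose q : C := [ffun i => Ordinal (ia i)].
  have ps : p = shiftc (base a p) q.
    by apply/ffunP => i; rewrite !ffunE /= subrK.
  rewrite {1}ps; apply: leq_trans (HN _ _) _; rewrite leq_pmul2l//.
  rewrite -sum1_count (big_nth (@finset.set0 C)) big_mkord.
  rewrite (big_ord_widen_cond _ (fun j => q \in nth (@finset.set0 C) (l (base a p)) j) (fun=> 1%N) (lT _)).
  rewrite sum1_card; apply: subset_leq_card; apply/fintype.subsetP => t.
  rewrite !inE => /andP [qt _]; apply/existsP; exists q; apply/andP; split => /=.
    by apply/forallP => i; rewrite ffunE.
  exact: qt.
apply: leq_trans (_ : \sum_(a in inner p) N p <= _)%N.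
  by rewrite sum_nat_const leq_mul2r card_inner orbT.
apply: leq_trans (_ : \sum_(a in inner p) (m - d * w) * #|[pred t : 'I_T | (a, t) \in palette p]| <= _)%N.
  by apply: leq_sum => a /slice.
rewrite -big_distrr leq_pmul2l//= -[X in (_ <= X)%N]sum1_card.
rewrite [X in (_ <= X)%N](eq_bigl (fun u => (u.1, u.2) \in palette p)); last by case.
rewrite -(pair_big_dep predT (fun a t => (a, t) \in palette p) (fun _ _ => 1%N))/=.
apply: leq_trans (_ : \sum_(a : 'I_m) #|[pred t : 'I_T | (a, t) \in palette p]| <= _)%N.
  by rewrite [X in (_ <= X)%N](bigID (mem (inner p))) leq_addr.
by apply: leq_sum => a _; rewrite sum1_card.
Qed.

Lemma colorable_corridors (c0 : R) (n : nat) (adj : rel 'I_n) (f : 'I_n -> Z) :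
  0 < c0 -> 0 < eps -> (forall y i, c0 * `|tnth y i| <= nrm y) ->
  rho <= c0 * eps * w%:R -> irreflexive adj ->
  (forall i j, adj i j -> nrm (cellgap (f i) (f j)) <= rho) ->
  (forall z q, #|[pred j | f j == shiftc z q]| <=
     (m - d * w) * count (fun S : {set C} => q \in S) (l z))%N ->
  colorable n adj (m * T).
Proof.
move=> c00 eps0 cl hw irr near HN.
have [i|c [cP cinj]] := @rank_coloring n _ _ f palette.
  exact: (@palette_card (fun p => #|[pred j | f j == p]|)).
apply: (@colorableP _ _ _ c) => [|i j aij]; first by rewrite card_prod !card_ord.
have [fij|fij] := eqVneq (f i) (f j).
  by apply: contraTneq aij => /(cinj _ _ fij) ->; rewrite irr.
apply: contraNneq (palette_disjoint c00 eps0 cl hw (near _ _ aij) fij (cP i)) => ->.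
exact: cP.
Qed.

End Corridor.

(** * Dual weights on a grid of cells *)

Section DualNet.
Context {R : realType} {C : finType} (stab : pred {set C}).

Definition dual_feasible (phi : C -> R) : Prop :=
  (forall q, 0 <= phi q) /\ forall S, stab S -> \sum_(q in S) phi q <= 1.

Hypothesis stab1 : forall q, stab [set q]%SET.

Lemma dual_feasible_le1 phi q : dual_feasible phi -> phi q <= 1.
Proof. by move=> [_ /(_ _ (stab1 q))]; rewrite big_set1. Qed.

(** Rounding up to multiples of [1 / L] raises a stable sum by at most [#|C|] units, so the
    denominator [L + #|C|] restores feasibility at the price of a factor [1 + kappa], and only
    finitely many functions remain. *)
Lemma dual_net (kappa : R) : 0 < kappa ->
  exists (J : finType) (F : J -> C -> R), (forall j, dual_feasible (F j)) /\
    forall phi, dual_feasible phi -> exists j, forall q, phi q <= (1 + kappa) * F j q.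
Proof.
move=> k0; pose L := (Num.truncn (#|C|%:R / kappa)).+1; pose D : R := L%:R + #|C|%:R.
have L0 : 0 < L%:R :> R by rewrite ltr0n.
have CL : #|C|%:R <= kappa * L%:R.
  rewrite mulrC -ler_pdivrMr//; apply: ltW.
  by have /andP [] := @truncn_itv R (#|C|%:R / kappa) (divr_ge0 (ler0n _ _) (ltW k0)).
have D0 : 0 < D by rewrite ltr_wpDr.
pose ok (psi : {ffun C -> 'I_L.+2}) :=
  [forall S, stab S ==> (\sum_(q in S) psi q <= L + #|C|)%N].
exists {psi | ok psi}, (fun (j : {psi | ok psi}) q => (sval j q : nat)%:R / D); split.
  move=> [psi /= /forallP okp]; split=> [q|S sS]; first by rewrite divr_ge0// ltW.
  rewrite -mulr_suml ler_pdivrMr// mul1r -natr_sum /D -natrD ler_nat.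
  by have /implyP := okp S; apply.
move=> phi dphi; have [phi0 phiS] := dphi.
have pL q : 0 <= phi q * L%:R by rewrite mulr_ge0.
have lt q : ((Num.truncn (phi q * L%:R)).+1 < L.+2)%N.
  rewrite !ltnS truncn_le_nat; apply: (@le_lt_trans _ _ (1 * L%:R)).
    by rewrite ler_wpM2r// dual_feasible_le1.
  by rewrite mul1r ltr_nat.
pose psi : {ffun C -> 'I_L.+2} := [ffun q => Ordinal (lt q)].
have okp : ok psi.
  apply/forallP => S; apply/implyP => sS; rewrite -(ler_nat R) natr_sum natrD.
  apply: (@le_trans _ _ (\sum_(q in S) (phi q * L%:R + 1))).
    apply: ler_sum => q _; rewrite ffunE /= -natr1 lerD2r.
    by have /andP [] := truncn_itv (pL q).
  rewrite big_split /= -mulr_suml sumr_const lerD//.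
    by rewrite ler_piMl// phiS.
  by rewrite ler_nat max_card.
exists (exist _ psi okp) => q /=; rewrite ffunE /=.
have /andP [_ lt1] := truncn_itv (pL q).
rewrite mulrA ler_pdivlMr//; apply: (@le_trans _ _ (phi q * ((1 + kappa) * L%:R))).
  by rewrite ler_wpM2l// /D mulrDl mul1r lerD2l.
by rewrite mulrCA; apply: ler_wpM2l; [rewrite addr_ge0// ltW|exact: ltW].
Qed.

End DualNet.

Lemma measurable_option_label (dV : measure_display) (V : measurableType dV) (C : finType)
    (c : V -> option C) :
  (forall q, measurable [set y | c y = Some q]) -> forall k, measurable [set y | c y = k].
Proof.
move=> mc [q|]; first exact: mc.
rewrite (_ : [set y | _] = ~` \bigcup_q [set y | c y = Some q]).
  by apply: measurableC; apply: fin_bigcup_measurable => //; exact: finite_finset.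
apply/seteqP; split => y /=; first by move=> cy [q _ /=]; rewrite cy.
by move=> h; case e : (c y) => [q|//]; case: h; exists q.
Qed.

(** * Functions constant on finitely many cells *)

Section SimpleFunction.
Context {R : realType} (dV : measure_display) (V : measurableType dV) (C : finType).
Variables (vol : {measure set V -> \bar R}) (c : V -> option C) (g : C -> R).
Hypothesis mc : forall q, measurable [set y | c y = Some q].

Lemma optw_indicE y : optw g (c y) = \sum_q g q * \1_[set y | c y = Some q] y.
Proof.
have cE q : \1_[set y | c y = Some q] y = (c y == Some q)%:R :> R.
  rewrite indicE; congr (nat_of_bool _)%:R.
  by apply/idP/eqP => [/set_mem|e]; [|apply/mem_set].
under eq_bigr do rewrite cE; case: (c y) => [q|] /=; last first.
  by rewrite big1// => q _; rewrite mulr0.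
rewrite (bigD1 q)//= eqxx mulr1 big1 ?addr0// => q' /negbTE qq'.
by rewrite (_ : (Some q == Some q') = (q == q'))// eq_sym qq' mulr0.
Qed.

Lemma measurable_optw : measurable_fun setT (fun y => optw g (c y)).
Proof.
under eq_fun do rewrite optw_indicE.
by apply: measurable_sum => q; apply: measurable_funM.
Qed.

Hypothesis vc : forall q, (vol [set y | c y = Some q] < +oo)%E.

Let integrable_level q : vol.-integrable setT
  (fun y => (g q * \1_[set y | c y = Some q] y)%:E).
Proof.
apply: (@integrableZl _ _ _ vol setT measurableT (g q) (fun y => (\1__ y)%:E)).
apply/integrableP; split; first by apply/measurable_EFinP; exact: measurable_indic.
rewrite (_ : (fun _ => _) = (fun y => (\1_[set y | c y = Some q] y)%:E)).
  by rewrite integral_indic ?setIT.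
by apply/funext => y /=; rewrite ger0_norm// indicE ler0n.
Qed.

Lemma integrable_optw : vol.-integrable setT (EFin \o (fun y => optw g (c y))).
Proof.
rewrite (_ : _ \o _ = (fun y => \sum_q (g q * \1_[set y | c y = Some q] y)%:E)%E).
  by apply: integrable_sum => // q _; exact: integrable_level.
by apply/funext => y /=; rewrite optw_indicE sumEFin.
Qed.

Lemma Rintegral_optw :
  (\int[vol]_y optw g (c y))%R = \sum_q g q * fine (vol [set y | c y = Some q]).
Proof.
rewrite /Rintegral; under eq_integral do rewrite optw_indicE -sumEFin.
rewrite integral_sum// -sum_fine// => [|q _]; last exact: integrable_fin_num.
apply: eq_bigr => q _; rewrite -[LHS]/(\int[vol]_y (g q * \1__ y))%R.
rewrite RintegralZl//; first by rewrite /Rintegral integral_indic ?setIT.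
apply/integrableP; split; first by apply/measurable_EFinP; exact: measurable_indic.
rewrite (_ : (fun _ => _) = (fun y => (\1_[set y | c y = Some q] y)%:E)).
  by rewrite integral_indic ?setIT.
by apply/funext => y /=; rewrite ger0_norm// indicE ler0n.
Qed.

End SimpleFunction.

(** * Comparison of distances between cells and between points *)

Section Cells.
Context {R : realType} {d : nat}.
Notation V := (d.-tuple R).
Notation Z := {ffun 'I_d -> int}.
Variable nrm : V -> R.
Hypothesis hnrm : is_norm nrm.
Notation C1 := (nrm_upper nrm).

Lemma cellgap_scale (a h : R) (p q : Z) :
  cellgap (a * h) p q = vscale a (cellgap h p q).
Proof. by apply: eq_from_tnth => i; rewrite !tnth_mktuple mulrA. Qed.

Lemma cellgap_dist (h : R) (y y' : V) : 0 < h ->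
  nrm (vsub (cellgap h (cellidx h y) (cellidx h y')) (vsub y y')) <= C1 * h.
Proof.
move=> h0; apply: nrm_le_upper => //; last exact: ltW.
move=> i; rewrite !tnth_mktuple !ffunE intrB.
have := floor_itv (tnth y i / h); have := floor_itv (tnth y' i / h).
rewrite !intrD !ler_pdivlMr// !ltr_pdivrMr// !mulrDl !mul1r !(mulrC _ h) mulrBr.
rewrite ler_norml => /andP [? ?] /andP [? ?]; apply/andP; split; lra.
Qed.

Lemma cellgap_upper (h : R) (y y' : V) : 0 < h ->
  nrm (cellgap h (cellidx h y) (cellidx h y')) <= nrm (vsub y y') + C1 * h.
Proof.
move=> h0; apply: le_trans (lerD (lexx _) (cellgap_dist y y' h0)).
set g := cellgap _ _ _; set u := vsub y y'.
rewrite [X in nrm X <= _](_ : g = vadd u (vsub g u)); first exact: nrm_add.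
by apply: eq_from_tnth => i; rewrite tnth_vadd tnth_vsub addrC subrK.
Qed.

Lemma cellgap_lower (h : R) (y y' : V) : 0 < h ->
  nrm (vsub y y') <= nrm (cellgap h (cellidx h y) (cellidx h y')) + C1 * h.
Proof.
move=> h0; apply: le_trans (lerD (lexx _) (cellgap_dist y y' h0)).
set g := cellgap _ _ _; set u := vsub y y'; rewrite (nrm_subC hnrm g u).
rewrite [X in nrm X <= _](_ : u = vadd g (vsub u g)); first exact: nrm_add.
by apply: eq_from_tnth => i; rewrite tnth_vadd tnth_vsub addrC subrK.
Qed.

Lemma label_shiftc (h : R) M (z : Z) (y : V) (q : {ffun 'I_d -> 'I_M}) :
  (label h M z y == Some q) = (cellidx h y == shiftc z q).
Proof.
apply/eqP/eqP => [/labelP hq|hq]; last by apply/labelP => i; rewrite hq ffunE.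
by apply/ffunP => i; rewrite [RHS]ffunE hq.
Qed.

Lemma chromatic_upper (eta eps : R) : (0 < d)%N -> 0 < eta -> 0 < eps ->
  exists M (J : finType) (F : J -> {ffun 'I_d -> 'I_M} -> R) (n1 : R), [/\ (0 < M)%N,
    forall j, dual_feasible (@cell_stable R d nrm eps (1 + C1 * eps) M) (F j) &
    forall n (x : nat -> V) r tau, 0 < r -> 0 < tau ->
      (forall j z, \sum_(i < n) optw (F j) (label (eps * r) M z (x i)) <= tau) ->
      (chromatic n (rgg_adj nrm x r n))%:R <= (1 + eta) * tau + n1].
Proof.
move=> d0 eta0 eps0; have [c0 c00 cl] := nrm_lower hnrm d0.
have C10 := nrm_upper_gt0 hnrm.
(* In units of [r], points at distance at most 1 lie in cells with gap at most [rho]. *)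
pose rho := 1 + C1 * eps.
have rho0 : 0 < rho by rewrite addr_gt0// mulr_gt0.
pose w := (Num.truncn (rho / (c0 * eps))).+1.
have hw : rho <= c0 * eps * w%:R.
  rewrite mulrC -ler_pdivrMr ?mulr_gt0//; apply: ltW.
  have q0 : 0 <= rho / (c0 * eps) by rewrite divr_ge0 ?ltW// mulr_gt0.
  by have /andP [] := truncn_itv q0.
(* Three factors [1 + e] are lost, to the finite net, the greedy cover and the corridors; and
   [(1 + e) ^+ 3 <= 1 + 7 * e] for [e <= 1]. *)
pose e := Num.min 1 (eta / 7).
have e0 : 0 < e by rewrite lt_min ltr01 divr_gt0.
have e1 : e <= 1 by rewrite ge_min lexx.
have e7 : e <= eta / 7 by rewrite ge_min lexx orbT.
pose M := (Num.truncn (2 * (d * w)%:R / e)).+1; pose m := (M + w)%N.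
have eM : 2 * (d * w)%:R <= e * m%:R.
  have q0 : 0 <= 2 * (d * w)%:R / e by rewrite divr_ge0 ?(ltW e0)// mulr_ge0.
  have /andP [_] := truncn_itv q0; rewrite ltr_pdivrMr// -/M => h.
  rewrite /m natrD mulrDr mulrC [e * M%:R]mulrC; have : 0 <= e * w%:R by rewrite mulr_ge0// ltW.
  lra.
have m0 : (0 < m)%N by rewrite ltn_addr.
have m0R : 0 < m%:R :> R by rewrite ltr0n.
have wm : (d * w < m)%N.
  rewrite -(ltr_nat R); have : e * m%:R <= m%:R by rewrite ler_piMl// ltW.
  lra.
pose g := (m - d * w)%N.
have gE : g%:R = m%:R - (d * w)%:R :> R by rewrite natrB// ltnW.
have g0 : 0 < g%:R :> R by rewrite ltr0n subn_gt0.
have mg : m%:R <= (1 + e) * g%:R.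
  rewrite gE; have : e * (d * w)%:R <= (d * w)%:R by rewrite ler_piMl.
  lra.
pose stab := @cell_stable R d nrm eps rho M.
have [J [F [Fd Fnet]]] := @dual_net R _ stab (cell_stable1 nrm eps rho (M := M)) e e0.
have [n0 n00 cover] := @greedy_cover R _ stab (cell_stable0 nrm eps rho M) e e0.
pose K : R := #|{ffun 'I_d -> 'I_M}|%:R.
exists M, J, F, (m%:R * ((1 + e) * (n0 * K) + 1)); split => //.
move=> n x r tau r0 tau0 H.
have h0 : 0 < eps * r by rewrite mulr_gt0.
pose N z (q : {ffun 'I_d -> 'I_M}) := #|[pred i : 'I_n | label (eps * r) M z (x i) == Some q]|.
(* Dual value of the demand [N / g + n0]: each of the [g] good shifts serves a share of [N], and the
   threshold [n0] of [greedy_cover], added to every cell, costs only a constant. *)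
pose c := (1 + e) * tau / g%:R + n0 * K.
have c0' : 0 < c by rewrite ltr_wpDr ?mulr_ge0// divr_gt0// mulr_gt0// addr_gt0.
have /choice [l Hl] : forall z, exists l : seq {set {ffun 'I_d -> 'I_M}},
    [/\ (size l)%:R <= (1 + e) * c + 1, all stab l &
      forall q, (N z q)%:R / g%:R + n0 <= (count (fun S : {set _} => q \in S) l)%:R].
  move=> z; apply: cover => // [q|phi phi0 phiS]; first by rewrite lerDr divr_ge0// ltW.
  rewrite (eq_bigr (fun q => (phi q * (N z q)%:R) / g%:R + n0 * phi q)); last first.
    by move=> q _; ring.
  have dphi : dual_feasible stab phi by [].
  rewrite big_split /= -mulr_suml -mulr_sumr lerD//; last first.
    rewrite ler_wpM2l// /K -sum1_card natr_sum; apply: ler_sum => q _.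
    exact: (dual_feasible_le1 (cell_stable1 nrm eps rho (M := M)) q dphi).
  rewrite ler_pM2r ?invr_gt0//; have [j hj] := Fnet _ dphi.
  apply: (@le_trans _ _ (\sum_q (1 + e) * (F j q * (N z q)%:R))).
    by apply: ler_sum => q _; rewrite mulrA ler_wpM2r.
  rewrite -mulr_sumr ler_pM2l ?addr_gt0//.
  by rewrite -(optw_count (F j) (fun i : 'I_n => label (eps * r) M z (x i))).
pose T := Num.truncn ((1 + e) * c + 1).
have q0 : 0 <= (1 + e) * c + 1.
  by rewrite addr_ge0// mulr_ge0 ?(ltW c0')// addr_ge0// ltW.
have lT z : (size (l z) <= T)%N by rewrite truncn_ge_nat//; case: (Hl z).
have ls z : all stab (l z) by case: (Hl z).
have col : colorable n (rgg_adj nrm x r n) (m * T).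
  apply: (colorable_corridors wm lT ls (c0 := c0) (f := fun i => cellidx (eps * r) (x i))) => //.
  - exact: rgg_irr.
  - move=> i j /andP [_ le]; rewrite -(ler_pM2l r0).
    have := cellgap_upper (x i) (x j) h0.
    rewrite [eps * r]mulrC cellgap_scale nrm_scale// gtr0_norm// => h.
    by apply: (le_trans h); rewrite /rho mulrDr mulr1 lerD// mulrCA.
  move=> z q; have [_ _ /(_ q) h] := Hl z.
  rewrite (_ : #|_| = N z q); last first.
    by apply: eq_card => i; rewrite !inE label_shiftc.
  rewrite -(ler_nat R) natrM -/g -ler_pdivrMl// mulrC.
  by apply: le_trans h; rewrite lerDl.
have := chromatic_le col; rewrite -(ler_nat R) natrM => h; apply: (le_trans h).
apply: (@le_trans _ _ (m%:R * ((1 + e) * c + 1))).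
  by rewrite ler_wpM2l//; have /andP [] := truncn_itv q0.
rewrite /c; have mg' : m%:R / g%:R <= 1 + e by rewrite ler_pdivrMr.
have -> : m%:R * ((1 + e) * ((1 + e) * tau / g%:R + n0 * K) + 1) =
    (1 + e) * (1 + e) * tau * (m%:R / g%:R) + m%:R * ((1 + e) * (n0 * K) + 1) by ring.
rewrite lerD2r; apply: (@le_trans _ _ ((1 + e) * (1 + e) * tau * (1 + e))).
  by rewrite ler_wpM2l// !mulr_ge0 ?addr_ge0 ?ltW.
have -> : (1 + e) * (1 + e) * tau * (1 + e) = ((1 + e) ^+ 3) * tau by ring.
rewrite ler_wpM2r ?(ltW tau0)//.
have : e ^+ 2 <= e by rewrite expr2 ler_piMl// ltW.
have : e ^+ 3 <= e by rewrite exprS ler_piMr ?(ltW e0)// exprn_ile1// ltW.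
have -> : (1 + e) ^+ 3 = 1 + 3 * e + 3 * e ^+ 2 + e ^+ 3 by ring.
lra.
Qed.

Section CellFunction.
Variables (h : R) (M : nat) (z : Z) (F : {ffun 'I_d -> 'I_M} -> R).
Hypothesis h0 : 0 < h.

Lemma measurable_label k : measurable [set y : V | label h M z y = k].
Proof.
by apply: measurable_option_label => q; rewrite label_cube//; exact: measurable_cube.
Qed.

Lemma logmgf_optw (vol : {measure set V -> \bar R}) s : is_lebesgue vol ->
  logmgf vol (fun y => optw F (label h M z y)) s =
  h ^+ d * \sum_q (expR (s * F q) - 1).
Proof.
move=> hvol; have vq q : vol [set y | label h M z y = Some q] = (h ^+ d)%:E.
  by rewrite label_cube// vol_cube.
rewrite mulrC mulr_suml /logmgf.
transitivity (\int[vol]_y optw (fun q => expR (s * F q) - 1) (label h M z y))%R.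
  by apply: eq_Rintegral => y _; case: label => //=; rewrite mulr0 expR0 subrr.
rewrite Rintegral_optw => [|q|q].
- by apply: eq_bigr => q _; rewrite vq.
- exact: measurable_label.
- by rewrite vq ltry.
Qed.

End CellFunction.

(** After the dilation, points more than 1 apart have cells with gap above [1 + C1 * eps] at scale
    [eps]: one [C1 * eps] is lost from points to cells, the other is the margin in [cell_stable]. In
    particular they never share a cell. *)
Lemma cell_function_feasible (eps : R) M (F : {ffun 'I_d -> 'I_M} -> R) : 0 < eps ->
  dual_feasible (@cell_stable R d nrm eps (1 + C1 * eps) M) F ->
  feasible nrm (fun y => optw F (label (eps / (1 + 2 * (C1 * eps))) M [ffun=> 0] y)).
Proof.
move=> eps0 [F0 FS]; have C10 := nrm_upper_gt0 hnrm.
set b := C1 * eps; have b0 : 0 < b by rewrite mulr_gt0.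
set c := 1 + 2 * b; have c0 : 0 < c by rewrite addr_gt0// mulr_gt0.
set h := eps / c; have h0 : 0 < h by rewrite divr_gt0.
apply: feasible_of_sum.
- by apply: measurable_optw => q; exact: measurable_label.
- by move=> y; rewrite /optw; case: label.
move=> s us sep; pose L := pmap (label h M [ffun=> 0]) s.
have -> : \sum_(v <- s) optw F (label h M [ffun=> 0] v) = \sum_(q <- L) F q.
  rewrite /L; elim: s {us sep L} => [|v s IH] /=; first by rewrite !big_nil.
  by rewrite big_cons IH; case: label => [q|] /=; rewrite ?big_cons// add0r.
have far v v' q q' : v \in s -> v' \in s -> v != v' ->
    label h M [ffun=> 0] v = Some q -> label h M [ffun=> 0] v' = Some q' ->
    1 + b < nrm (cellgap eps (intpt q) (intpt q')).
  move=> vs vs' vv' /labelP lq /labelP lq'.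
  have /(lt_le_trans (sep _ _ vs vs' vv')) := cellgap_lower v v' h0.
  rewrite (_ : cellidx h v = intpt q); last first.
    by apply/ffunP => i; rewrite lq !ffunE add0r.
  rewrite (_ : cellidx h v' = intpt q'); last first.
    by apply/ffunP => i; rewrite lq' !ffunE add0r.
  rewrite /h [eps / c]mulrC cellgap_scale nrm_scale// gtr0_norm ?invr_gt0//.
  rewrite [C1 * _]mulrCA -mulrDr mulrC ltr_pdivlMr// mul1r -/b /c; lra.
have ndiag (q : {ffun 'I_d -> 'I_M}) : ~ (1 + b < nrm (cellgap eps (intpt q) (intpt q))).
  move=> lt; have : nrm (cellgap eps (intpt q) (intpt q)) = 0.
    rewrite (_ : cellgap _ _ _ = vzero) ?(nrm0 hnrm)//.
    by apply: eq_from_tnth => i; rewrite tnth_vzero tnth_mktuple subrr mulr0.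
  by move=> e; move: lt; rewrite e; lra.
have uL : uniq L.
  rewrite /L; elim: s us {sep} far {L} => //= v s IH /andP [vs us] far.
  have IHs : uniq (pmap (label h M [ffun=> 0]) s).
    by apply: IH => // u u' q q' us1 us2; apply: far; rewrite inE ?us1 ?us2 orbT.
  case e : (label h M [ffun=> 0] v) => [q|] //=; rewrite IHs andbT.
  rewrite mem_pmap; apply/negP => /mapP [v' v's e'].
  apply: (ndiag q); apply: (far v v') => //; rewrite ?inE ?eqxx ?v's ?orbT//.
  by apply: contraNneq vs => ->.
rewrite big_uniq//= -[X in _ <= X]/(1 : R).
rewrite (eq_bigl (fun q => q \in [set q | q \in L]%SET)); last by move=> q; rewrite inE.
apply: FS; apply/forallP => p; apply/implyP; rewrite inE => pL.
apply/forallP => q; apply/implyP; rewrite inE => qL; apply/implyP => pq.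
move: pL qL; rewrite !mem_pmap => /mapP [v vs ev] /mapP [v' vs' ev'].
apply: (far v v') => //; apply: contraNneq pq => vv'.
by move: ev'; rewrite -vv' -ev => -[->].
Qed.

(** Supplies, for each dual function, the tilt of its Chernoff bound. *)
Lemma fchi_dual (vol : {measure set V -> \bar R}) (eps t : R) M
    (F : {ffun 'I_d -> 'I_M} -> R) : (0 < d)%N -> is_lebesgue vol -> 0 < eps -> 0 < t ->
  dual_feasible (@cell_stable R d nrm eps (1 + C1 * eps) M) F ->
  exists2 s, 0 < s &
    t^-1 + (eps / (1 + 2 * (C1 * eps))) ^+ d * \sum_q (expR (s * F q) - 1) <=
    s * fine (f_chi vol nrm t).
Proof.
move=> d0 hvol eps0 t0 dF; have C10 := nrm_upper_gt0 hnrm.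
have fphi := cell_function_feasible eps0 dF; set h := eps / _ in fphi *.
have h0 : 0 < h by rewrite divr_gt0// addr_gt0// mulr_gt0// mulr_gt0.
set phi := (fun y => _) in fphi.
have ffin := fchi_fin_num hnrm d0 hvol t0.
have fpos : 0 < fine (f_chi vol nrm t).
  apply: (lt_le_trans (max_int_gt0 hnrm d0 hvol)).
  by rewrite -lee_fin fineK// fchi_ge_max_int.
have mphi := feasible_measurable fphi; have phi01 := feasible_01 fphi.
have Iphi := feasible_integrable hnrm d0 hvol fphi.
have : 0 <= (\int[vol]_x phi x)%R by apply: Rintegral_ge0 => x _; exact: feasible_ge0 fphi x.
rewrite le_eqVlt => /predU1P [/esym I0|I0].
  (* With zero integral there is no tilt to take from [xi]; [logmgf] is then at most 0, and this
     value makes the right side equal to [t^-1]. *)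
  exists (t * fine (f_chi vol nrm t))^-1; first by rewrite invr_gt0 mulr_gt0.
  rewrite -(logmgf_optw [ffun=> 0] F h0 _ hvol) -/h -/phi; set s := (_ * _)^-1.
  have -> : s * fine (f_chi vol nrm t) = t^-1 by rewrite /s invfM mulfVK// gt_eqF.
  rewrite gerDl; have := logmgf_le mphi phi01 Iphi (s := s).
  by rewrite I0 mulr0; apply; rewrite invr_ge0; apply: mulr_ge0; exact: ltW.
have [s s0 e] := xi_attained mphi phi01 Iphi t0 I0.
exists s => //; have := fchi_ge vol t fphi; rewrite e -(fineK ffin) lee_fin.
by rewrite ler_pdivrMr// logmgf_optw// mulrC [s * _]mulrC.
Qed.

End Cells.

(** * Borel-Cantelli and independent labels *)

Section BorelCantelli.
Context {R : realType} {dO : measure_display} {Omega : measurableType dO}.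
Variable P : probability Omega R.

Lemma ae_eventually (Q : nat -> Omega -> Prop) (c : R) n0 :
  (forall n, (n0 <= n)%N -> exists B, [/\ measurable B,
     (P B <= (c / (n.+1)%:R ^+ 2)%:E)%E & forall w, ~ B w -> Q n w]) ->
  {ae P, forall w, \forall n \near \oo, Q n w}.
Proof.
move=> H.
have /choice [B HB] : forall n, exists B, [/\ measurable B,
    (P B <= (Num.max c 0 / (n.+1)%:R ^+ 2)%:E)%E & (n0 <= n)%N -> forall w, ~ B w -> Q n w].
  move=> n; have [/H [B [mB PB BQ]]|nn0] := leqP n0 n.
    exists B; split => //; apply: (le_trans PB); rewrite lee_fin ler_wpM2r//.
    by rewrite le_max lexx.
  exists set0; rewrite measure0; split => //.
  by rewrite lee_fin divr_ge0 ?exprn_ge0// le_max lexx orbT.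
have mB n : measurable (B n) by case: (HB n).
set c' := Num.max c 0 in HB; have c0 : 0 <= c' by rewrite le_max lexx orbT.
(* Telescoping: [1 / u ^+ 2 <= 2 / u - 2 / (u + 1)] for [u >= 1]. *)
have part (k : nat) : \sum_(0 <= n < k) c' / (n.+1)%:R ^+ 2 <= c' * (2 - 2 / (k.+1)%:R).
  elim: k => [|k IH]; first by rewrite big_geq// mulr_ge0// divr1 subrr.
  rewrite big_nat_recr//=; apply: (le_trans (lerD IH (lexx _))).
  rewrite -mulrDr ler_wpM2l//; set u : R := (k.+1)%:R.
  have u1 : 1 <= u by rewrite ler1n.
  have -> : (k.+2)%:R = u + 1 :> R by rewrite -natr1.
  rewrite -subr_ge0; set D := _ - _.
  have -> : D = (u - 1) / (u ^+ 2 * (u + 1)).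
    by rewrite /D; field; rewrite !gt_eqF; lra.
  by rewrite divr_ge0 ?subr_ge0// mulr_ge0 ?exprn_ge0//; lra.
have sum_lt : (\sum_(n <oo) P (B n) < +oo)%E.
  apply: (@le_lt_trans _ _ (c' * 2)%:E); last by rewrite ltry.
  apply: lime_le; first exact: is_cvg_nneseries.
  apply: nearW => k; apply: (@le_trans _ _ (\sum_(0 <= n < k) (c' / (n.+1)%:R ^+ 2)%:E)%E).
    by apply: lee_sum => n _; case: (HB n).
  rewrite sumEFin lee_fin; apply: (le_trans (part k)); rewrite ler_wpM2l//.
  by rewrite gerBl divr_ge0.
exists (lim_sup_set B); split; last first.
- move=> w /= nQ n _ /=; apply: contrapT => h; apply: nQ.
  exists (maxn n n0) => // j /= nj; case: (HB j) => _ _; apply.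
    by apply: leq_trans nj; rewrite leq_maxr.
  by move=> Bj; apply: h; exists j => //=; apply: leq_trans nj; rewrite leq_maxl.
- exact: lim_sup_set_cvg0.
- by apply: bigcap_measurable => // n _; apply: bigcup_measurable.
Qed.

End BorelCantelli.

(** * From random points to independent finite labels *)

Section Transfer.
Context {R : realType} {dO dV : measure_display} {Omega : measurableType dO}
  {V : measurableType dV}.
Variables (P : probability Omega R) (X : nat -> Omega -> V).
Hypothesis mX : forall i, measurable_fun setT (X i).
Hypothesis law : forall i (A : set V), measurable A -> P (X i @^-1` A) = P (X 0%N @^-1` A).
Hypothesis indep : mutually_independent P X.
Context {K : finType} (c : V -> K).
Hypothesis mc : forall k, measurable [set y | c y = k].

Definition plab (k : K) : R := fine (P (X 0%N @^-1` [set y | c y = k])).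

Lemma plab_ge0 k : 0 <= plab k.
Proof. exact: fine_ge0. Qed.

Let mcX i k : measurable [set w | c (X i w) = k].
Proof. by have := mX i measurableT (mc k); rewrite setTI. Qed.

Lemma plabE i k : P [set w | c (X i w) = k] = (plab k)%:E.
Proof. rewrite /plab fineK; first by rewrite -(law i).
by rewrite fin_num_measure//; exact: (mcX 0). Qed.

Lemma measure_split (E : set Omega) i : measurable E ->
  P E = (\sum_k P (E `&` [set w | c (X i w) = k]))%E.
Proof.
move=> mE; rewrite -measure_bigcup_finType.
- by congr (P _); apply/seteqP; split => [w Ew|w [k _ []//]]; exists (c (X i w)).
- by move=> k; apply: measurableI => //; exact: mcX.
- apply/trivIsetP => k k' _ _ /eqP kk'; rewrite -subset0 => w [[_ /= e] [_ /= e']].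
  by apply: kk'; rewrite -e -e'.
Qed.

Lemma plab_sum1 : \sum_k plab k = 1.
Proof.
apply/EFin_inj; rewrite -sumEFin -[RHS](probability_setT P) (measure_split 0%N)//.
by apply: eq_bigr => k _; rewrite setTI plabE.
Qed.

Lemma plab_sum (A : pred K) :
  \sum_(k | A k) plab k = fine (P (X 0%N @^-1` [set y | A (c y)])).
Proof.
have mA : measurable [set w | A (c (X 0%N w))].
  rewrite (_ : [set w | _] = \bigcup_(k in [set k | A k]) [set w | c (X 0%N w) = k]).
    apply: fin_bigcup_measurable => [|k _]; last exact: mcX.
    by apply: (@sub_finite_set _ _ [set: K]) => //; exact: finite_finset.
  by apply/seteqP; split => [w Aw|w [k Ak /= ->]//]; exists (c (X 0%N w)).
rewrite (measure_split 0%N)// -sum_fine; last first.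
  by move=> k _; rewrite fin_num_measure//; apply: measurableI => //; exact: mcX.
rewrite [LHS]big_mkcond; apply: eq_bigr => k _; case: ifPn => Ak.
  rewrite /plab; congr (fine (P _)); apply/seteqP; split => w /=; last by case.
  by move=> e; rewrite e.
rewrite (_ : _ `&` _ = set0) ?measure0//.
by rewrite -subset0 => w /= [] /[swap] ->; rewrite (negbTE Ak).
Qed.

Let lab m n w := [seq c (X i w) | i <- iota m n].

Lemma measurable_labels m n (A : pred (seq K)) : measurable [set w | A (lab m n w)].
Proof.
elim: n m A => [|n IH] m A.
  by rewrite /lab /=; case: (A [::]); [rewrite (_ : [set _ | _] = setT)|rewrite (_ : [set _ | _] = set0)] => //; apply/seteqP; split.
rewrite (_ : [set w | _] = \bigcup_k ([set w | c (X m w) = k] `&`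
    [set w | A (k :: lab m.+1 n w)])).
  apply: fin_bigcup_measurable; first exact: finite_finset.
  by move=> k _; apply: measurableI; [exact: mcX|exact: (IH _ (fun s => A (k :: s)))].
by apply/seteqP; split => [w Aw|w [k _ [/= <-]//]]; exists (c (X m w)).
Qed.

Let prefix_prob t : P [set w | lab 0 (size t) w = t] = (\prod_(k <- t) plab k)%:E.
Proof.
case: t => [|k0 t'].
  by rewrite big_nil -[RHS](probability_setT P); congr (P _); apply/seteqP; split.
move: (k0 :: t') => t {t'}; set m := size t.
have := indep (iota_uniq 0 m) (fun i => mc (nth k0 t i)).
rewrite (_ : \big[setI/setT]_(i <- _) _ = [set w | lab 0 m w = t]); last first.
  rewrite -bigcap_seq; apply/seteqP; split => w /= h.
    apply: (@eq_from_nth _ k0); rewrite size_map size_iota// => i im.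
    rewrite (nth_map 0%N) ?size_iota// nth_iota// add0n.
    by apply: (h i); rewrite /= mem_iota.
  move=> i; rewrite /= mem_iota /= add0n => im.
  by rewrite -h (nth_map 0%N) ?size_iota// nth_iota.
move=> ->; rewrite (big_nth k0) -/m /index_iota subn0.
rewrite (eq_bigr (fun i => (plab (nth k0 t i))%:E)); last by move=> i _; exact: plabE.
by rewrite prodEFin.
Qed.

Lemma iid_transfer n (A : pred (seq K)) :
  P [set w | A [seq c (X i w) | i <- iota 0 n]] =
  (iidE plab n (fun s => (A s)%:R))%:E.
Proof.
(* Generalised to an already revealed prefix [t]: each step appends one label to it, and
   independence enters through the probabilities of prefixes. *)
suff H t : P ([set w | lab 0 (size t) w = t] `&` [set w | A (lab (size t) n w)]) =
    (P [set w | lab 0 (size t) w = t] * (iidE plab n (fun s => (A s)%:R))%:E)%E.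
  have := H [::]; rewrite prefix_prob big_nil mul1e => <-; congr (P _).
  by apply/seteqP; split => [w Aw|w []].
elim: n A t => [|n IH] A t.
  rewrite /lab /=; case: (A [::]).
    by rewrite mule1 (_ : [set _ | true] = setT) ?setIT//; apply/seteqP; split.
  by rewrite mule0 (_ : [set _ | false] = set0) ?setI0 ?measure0//; apply/seteqP; split.
rewrite (measure_split (size t)); last first.
  apply: measurableI; last exact: measurable_labels.
  rewrite (_ : [set w | _] = [set w | lab 0 (size t) w == t]); first exact: (measurable_labels 0 (size t) (fun s => s == t)).
  by apply/seteqP; split => w /= /eqP.
transitivity (\sum_k (P [set w | lab 0 (size t) w = t] *
    (plab k * iidE plab n (fun s => (A (k :: s))%:R))%:E))%E; last first.
  rewrite prefix_prob /= -EFinM mulr_sumr -sumEFin.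
  by apply: eq_bigr => k _; rewrite EFinM.
apply: eq_bigr => k _; have := IH (fun s => A (k :: s)) (rcons t k).
rewrite !prefix_prob size_rcons -cats1 big_cat /= big_seq1 -!EFinM mulrA => <-.
congr (P _); apply/seteqP; split => w /=.
  move=> [[h1 h2] h3]; split; last by rewrite /lab /= h3 in h2.
  by rewrite /lab -addn1 iotaD map_cat /= add0n h3 -[X in _ = X ++ _]h1.
rewrite /lab -[in X in X = _]addn1 iotaD map_cat /= add0n => -[h1 h2].
have [e1 e2] : [seq c (X i w) | i <- iota 0 (size t)] = t /\ c (X (size t) w) = k.
  by move/eqP: h1; rewrite eqseq_cat ?size_map ?size_iota// => /andP [/eqP ? /eqP [?]].
by rewrite e1 e2.
Qed.

End Transfer.

(** * Chernoff bounds for the density *)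

Section Density.
Context {R : realType} {d : nat}.
Notation V := (d.-tuple R).
Variable vol : {measure set V -> \bar R}.
Hypothesis hvol : is_lebesgue vol.
Variable f : V -> R.
Hypothesis mf : measurable_fun setT f.
Hypothesis f0 : forall x, 0 <= f x.
Hypothesis fbdd : exists M : R, forall x, f x <= M.
Hypothesis fint : (\int[vol]_x (f x)%:E = 1)%E.

Notation sigma := (ess_sup_density vol f).
Notation nu A := (\int[vol]_(x in A) (f x)%:E)%E.

Lemma measurable_superlevel (s : R) : measurable [set x | s < f x].
Proof.
rewrite (_ : [set x | _] = f @^-1` `]s, +oo[%classic); last first.
  by apply/seteqP; split => x /=; rewrite in_itv /= andbT.
by rewrite -[X in measurable X]setTI; exact: mf.
Qed.

Lemma has_sup_density : has_sup [set s : R | (0 < vol [set x | (s < f x)%R])%E].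
Proof.
split.
  exists (-1); rewrite /= (_ : [set x | _] = setT).
    apply: lt_le_trans (_ : (vol (cube vzero 1) <= _)%E).
      by rewrite vol_cube// expr1n lte_fin.
    by apply: le_measure; rewrite ?inE//; exact: measurable_cube.
  by apply/seteqP; split => // x _ /=; apply: lt_le_trans (f0 x); rewrite ltrN10.
have [M fM] := fbdd; exists M => s /=; apply: contraPle => Ms.
rewrite (_ : [set x | _] = set0) ?measure0 ?ltxx//.
by apply/seteqP; split => // x /=; apply/negP; rewrite -leNgt (le_trans (fM x))// ltW.
Qed.

Lemma vol_above_sigma : vol [set x | sigma < f x] = 0%E.
Proof.
pose A (n : nat) := [set x | sigma + (n.+1)%:R^-1 < f x].
have A0 n : vol (A n) = 0%E.
  apply/eqP; rewrite eq_le measure_ge0 andbT leNgt; apply/negP => pos.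
  have := ub_le_sup (proj2 has_sup_density) pos.
  by apply/negP; rewrite -ltNge ltrDl invr_gt0.
apply/eqP; rewrite eq_le measure_ge0 andbT.
apply: (@le_trans _ _ (\sum_(n <oo) vol (A n))%E).
  apply: measure_sigma_subadditive => [n||x /= fx].
  - exact: measurable_superlevel.
  - exact: measurable_superlevel.
  have u0 : 0 < f x - sigma by rewrite subr_gt0.
  exists (Num.truncn (f x - sigma)^-1) => //; rewrite /A /= -ltrBrDl.
  rewrite -[ltRHS]invrK ltf_pV2 ?posrE ?invr_gt0//.
  by have ui : 0 <= (f x - sigma)^-1; [rewrite invr_ge0 ltW|have /andP [] := truncn_itv ui].
by rewrite eseries0.
Qed.

Lemma sigma_gt0 : 0 < sigma.
Proof.
rewrite ltNge; apply/negP => s0.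
have : (\int[vol]_x (f x)%:E = \int[vol]_(x in setT) (cst 0%E x))%E.
  apply: ae_eq_integral => //; first by apply/measurable_EFinP.
  exists [set x | sigma < f x]; split; [exact: measurable_superlevel|exact: vol_above_sigma|].
  move=> x /= /not_implyP [_ fx]; rewrite (le_lt_trans s0)// lt_neqAle f0 andbT.
  by apply/eqP => e; apply: fx; rewrite -e.
by rewrite fint integral0 => /eqP; rewrite onee_eq0.
Qed.

Lemma nu_le A : measurable A -> (nu A <= sigma%:E * vol A)%E.
Proof.
move=> mA; rewrite -integral_cst//; apply: ae_ge0_le_integral => //.
- by move=> x _; rewrite lee_fin.
- by apply/measurable_EFinP; exact: measurable_funTS.
- by move=> x _; rewrite lee_fin ltW// sigma_gt0.
exists [set x | sigma < f x]; split; [exact: measurable_superlevel|exact: vol_above_sigma|].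
by move=> x /= /not_implyP [_] /negP; rewrite lee_fin -ltNge.
Qed.

Lemma vol_near_sigma kappa : 0 < kappa -> (0 < vol [set x | (sigma - kappa < f x)%R])%E.
Proof.
move=> k0; have [s /= vs ls] := sup_adherent k0 has_sup_density.
apply: (lt_le_trans vs); apply: le_measure; rewrite ?inE; try exact: measurable_superlevel.
by move=> x /=; exact: lt_trans ls.
Qed.

(** Meant for a cube [Q] mostly filled by the set where [f] exceeds [c]: the loss depends on [Q]
    only, whatever the shape of [A]. *)
Lemma nu_ge A Q (c delta : R) : measurable A -> measurable Q -> A `<=` Q -> 0 <= c ->
  (vol (Q `\` [set x | (c < f x)%R]) <= delta%:E)%E ->
  (c%:E * vol A <= nu A + (c * delta)%:E)%E.
Proof.
move=> mA mQ AQ c0 hd; set E := [set x | (c < f x)%R] in hd.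
have mE : measurable E := measurable_superlevel c.
have -> : vol A = (vol (A `&` E) + vol (A `\` E))%E.
  by rewrite addeC -measureDI.
rewrite ge0_muleDr// EFinM; apply: leeD; last first.
  apply: lee_wpmul2l; first by rewrite lee_fin.
  apply: le_trans hd; apply: le_measure; rewrite ?inE; try exact: measurableD.
  exact: setSD.
apply: (@le_trans _ _ (nu (A `&` E))); last first.
  apply: ge0_subset_integral => //; first exact: measurableI.
    by apply/measurable_EFinP; exact: measurable_funTS.
  by move=> x _; rewrite lee_fin.
rewrite -integral_cst; last exact: measurableI.
apply: ge0_le_integral => //; first exact: measurableI.
- by apply/measurable_EFinP; exact: measurable_funTS.
by move=> x [_ /= cx]; rewrite lee_fin ltW.
Qed.

End Density.

Lemma sum_option {R : realType} (C : finType) (F : option C -> R) :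
  \sum_k F k = F None + \sum_q F (Some q).
Proof.
rewrite (bigD1 None)//=; congr (_ + _).
rewrite (reindex_omap Some id) /=; last by case.
by apply: eq_bigl => q; rewrite eqxx.
Qed.

Lemma sum_labels {R : realType} (T K : Type) (c : T -> K) (w : K -> R) (x : nat -> T) n :
  \sum_(k <- [seq c (x i) | i <- iota 0 n]) w k = \sum_(i < n) w (c (x i)).
Proof. by rewrite big_map -(big_mkord xpredT (fun i => w (c (x i)))) /index_iota subn0. Qed.

(** * Tail bounds over all windows and over many regions *)

Section Chernoff.
Context {R : realType} {d : nat}.
Notation V := (d.-tuple R).
Variable vol : {measure set V -> \bar R}.
Hypothesis hvol : is_lebesgue vol.
Context {dO : measure_display} {Omega : measurableType dO}.
Variables (P : probability Omega R) (X : nat -> Omega -> V).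
Hypothesis mX : forall i, measurable_fun setT (X i).
Hypothesis law : forall i (A : set V), measurable A -> P (X i @^-1` A) = P (X 0%N @^-1` A).
Hypothesis indep : mutually_independent P X.
Variable sigma : R.
Hypothesis sigma0 : 0 < sigma.
Hypothesis law_le : forall A, measurable A -> (P (X 0%N @^-1` A) <= sigma%:E * vol A)%E.

Let cellmass (h : R) M z (q : {ffun 'I_d -> 'I_M}) : 0 < h ->
  plab P X (label h M z) (Some q) <= sigma * h ^+ d.
Proof.
move=> h0; have mq := measurable_label z h0 (Some q).
rewrite -lee_fin /plab fineK; last first.
  by rewrite fin_num_measure// -[X in measurable X]setTI; exact: mX.
by apply: le_trans (law_le mq) _; rewrite label_cube// vol_cube.
Qed.

(** Union bound over all window positions: each tail is at most [D] times the probability that one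
    point falls in the window, and a point lies in exactly [#|C|] windows, so the total is at most
    [D * #|C|]. *)
Lemma chernoff_grid n M (phi : {ffun 'I_d -> 'I_M} -> R) h s tau :
  (forall q, 0 <= phi q <= 1) -> 0 < h -> 0 <= s -> 0 < tau ->
  exists B, [/\ measurable B,
    (P B <= (n%:R * #|{ffun 'I_d -> 'I_M}|%:R * expR s *
       expR (n%:R * (sigma * h ^+ d * \sum_q (expR (s * phi q) - 1)) - s * tau))%:E)%E &
    forall w, ~ B w -> forall z, \sum_(i < n) optw phi (label h M z (X i w)) < tau].
Proof.
move=> phi01 h0 s0 tau0; pose C := {ffun 'I_d -> 'I_M}.
pose Z := {ffun 'I_d -> int}.
pose hit (z : Z) := [set w | tau <= \sum_(k <- [seq label h M z (X i w) | i <- iota 0 n]) optw phi k].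
have w01 k : 0 <= optw phi k <= 1 by case: k => [q|] /=; rewrite ?lexx ?ler01.
have ml z k : measurable [set y : V | label h M z y = k] by exact: measurable_label.
have mhit z : measurable (hit z).
  exact: (measurable_labels mX (ml z) 0 n (fun l => tau <= \sum_(k <- l) optw phi k)).
pose near (z : Z) := X 0%N @^-1` [set y | label h M z y != None].
have mnear z q : measurable (X 0%N @^-1` [set y | label h M z y = Some q]).
  by rewrite -[X in measurable X]setTI; apply: mX.
pose D := n%:R * expR s *
  expR (n%:R * (sigma * h ^+ d * \sum_q (expR (s * phi q) - 1)) - s * tau).
have D0 : 0 <= D by rewrite !mulr_ge0// expR_ge0.
have nearE z : P (near z) = (\sum_q P (X 0%N @^-1` [set y | label h M z y = Some q]))%E.
  rewrite -measure_bigcup_finType//; last first.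
    apply/trivIsetP => q q' _ _ /eqP qq'; rewrite -subset0 => w [/= -> [e]].
    exact: qq'.
  congr (P _); apply/seteqP; split => w; rewrite /near /=.
    by case e : (label _ _ _ _) => [q|//] _; exists q.
  by move=> [q _ /= ->].
have Phit z : (P (hit z) <= D%:E * P (near z))%E.
  rewrite /hit (iid_transfer mX law indep (ml z) n (fun l => tau <= \sum_(k <- l) optw phi k)).
  have p0 k := plab_ge0 P X (label h M z) k.
  have p1 := plab_sum1 mX law (ml z).
  set p := plab P X (label h M z) in p0 p1 *.
  have -> : P (near z) = (\sum_(k | k != None) p k)%:E.
    rewrite (plab_sum P mX (ml z)) fineK// fin_num_measure// /near.
    rewrite (_ : _ @^-1` _ = \bigcup_q (X 0%N @^-1` [set y | label h M z y = Some q])).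
      by apply: fin_bigcup_measurable => //; exact: finite_finset.
    apply/seteqP; split => w /=; last by move=> [q _ /= ->].
    by case e : (label _ _ _ _) => [q|//] _; exists q.
  rewrite -EFinM lee_fin; apply: (le_trans (iidE_upper_tail n p0 p1 w01 s0 tau0)).
  have S1 : \sum_(k | optw phi k != 0) p k <= \sum_(k | k != None) p k.
    rewrite [leLHS]big_mkcond [leRHS]big_mkcond; apply: ler_sum => -[q|] _ /=.
      by case: ifP => // _; exact: p0.
    by rewrite eqxx.
  have S2 : \sum_k p k * (expR (s * optw phi k) - 1) <=
      sigma * h ^+ d * \sum_q (expR (s * phi q) - 1).
    rewrite sum_option /= mulr0 expR0 subrr mulr0 add0r mulr_sumr; apply: ler_sum => q _.
    apply: ler_wpM2r; last exact: cellmass.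
    by rewrite subr_ge0 -expR0 ler_expR mulr_ge0//; case/andP: (phi01 q).
  rewrite /D [leRHS]mulrC [leRHS]mulrA; apply: ler_pM.
  - by rewrite !mulr_ge0 ?expR_ge0// sumr_ge0.
  - exact: expR_ge0.
  - rewrite mulrA [_ * n%:R]mulrC ler_wpM2r ?expR_ge0// ler_wpM2l//.
  - by rewrite ler_expR lerB// ler_wpM2l.
(* Enumeration of the window positions; indices that code none give empty events. *)
pose pinv (k : nat) : option Z := pickle_inv k.
pose F k := if pinv k is Some z then hit z else set0.
pose G k q := if pinv k is Some z
  then X 0%N @^-1` [set y | label h M z y = Some q] else set0.
have mF k : measurable (F k) by rewrite /F; case: (pinv k).
have mG k q : measurable (G k q) by rewrite /G; case: (pinv k).
have PF k : (P (F k) <= D%:E * \sum_q P (G k q))%E.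
  rewrite /F /G; case: (pinv k) => [z|]; first by rewrite -nearE.
  by rewrite measure0 mule_ge0 ?lee_fin// sume_ge0.
(* For a fixed cell [q] of the window, the events for different positions are disjoint. *)
have GC N : (\sum_(k < N) \sum_q P (G k q) <= #|C|%:R%:E)%E.
  rewrite exchange_big /= -sum1_card natr_sum -sumEFin; apply: lee_sum => q _.
  rewrite -(@measure_bigcup_finType _ _ _ P 'I_N (fun k => G k q))//; last first.
    apply/trivIsetP => k k' _ _ kk'; rewrite -subset0 => w; rewrite /G.
    case ek : (pinv k) => [z|] []//; case ek' : (pinv k') => [z'|] //=.
    move=> /labelP hz /labelP hz'; move: kk'; apply/negP; rewrite negbK -val_eqE /=.
    have ki : oapp pickle (k : nat) (pinv k) = k := pickle_invK _.
    have ki' : oapp pickle (k' : nat) (pinv k') = k' := pickle_invK _.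
    rewrite ek in ki; rewrite ek' in ki'; rewrite -ki -ki' /=.
    suff -> : z = z' by [].
    by apply/ffunP => i; have := hz i; rewrite hz' => /addIr.
  by apply: probability_le1; apply: fin_bigcup_measurable => //; exact: finite_finset.
exists (\bigcup_k F k); split.
- exact: bigcup_measurable.
- apply: (@le_trans _ _ (\sum_(k <oo) P (F k))%E).
    by apply: measure_sigma_subadditive => //; exact: bigcup_measurable.
  apply: lime_le; first exact: is_cvg_nneseries.
  apply: nearW => N; apply: (@le_trans _ _ (\sum_(0 <= k < N) D%:E * \sum_q P (G k q))%E).
    by apply: lee_sum => k _.
  rewrite big_mkord -ge0_sume_distrr; last by move=> k _; apply: sume_ge0.
  apply: le_trans (lee_wpmul2l _ (GC N)) _; first by rewrite lee_fin.
  rewrite -EFinM lee_fin /D mulrAC -/C; set a := _%:R; set b := #|C|%:R; set e := expR s.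
  by rewrite (mulrAC a e b) lexx.
- move=> w nB z; rewrite ltNge; apply/negP => h1; apply: nB.
  exists (pickle z) => //; rewrite /F /pinv pickleK_inv /hit /=.
  by rewrite sum_labels.
Qed.

(* At least one of many disjoint regions is crowded: by negative association, the
   events that the various regions are not crowded are at most as likely to occur
   together as if they were independent. *)
Lemma regions_fail n M (C : finType) (x : 'I_M -> V) (a : V) (r L : R) (c0 : V -> option C)
    (w : C -> R) (tau q : R) :
  0 < r -> trivIset setT (fun j => cube (x j) (r * L)) ->
  (forall q, measurable [set y | c0 y = Some q]) ->
  (forall y, c0 y != None -> cube a L y) -> (forall q, 0 <= w q) ->
  (forall j, (q%:E <= P [set u | (tau <=
     \sum_(i < n) optw w (c0 (vscale r^-1 (vsub (X i u) (vsub (x j) (vscale r a))))))%R])%E) ->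
  exists B, [/\ measurable B, (P B <= (expR (- (M%:R * q)))%:E)%E &
    forall u, ~ B u -> exists j,
      tau <= \sum_(i < n) optw w (c0 (vscale r^-1 (vsub (X i u) (vsub (x j) (vscale r a)))))].
Proof.
move=> r0 tx mc0 c0L w0 hq.
pose cj j y := c0 (vscale r^-1 (vsub y (vsub (x j) (vscale r a)))).
have cjcube j y : cj j y != None -> cube (x j) (r * L) y.
  move=> /c0L h i; have := h i; rewrite tnth_vscale !tnth_vsub tnth_vscale.
  rewrite mulrC ler_pdivlMr// ltr_pdivrMr// mulrDl ![_ * r]mulrC => /andP [? ?].
  by apply/andP; split; lra.
have cj1 j j' y : cj j y != None -> cj j' y != None -> j = j'.
  by move=> h h'; apply: tx => //; exists y; split; exact: cjcube.
(* Region and cell in one finite label, unambiguous because the cubes are disjoint. *)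
pose ct y : option ('I_M * C) :=
  if [pick j | cj j y != None] is Some j then omap (pair j) (cj j y) else None.
have ctE j q' y : (ct y = Some (j, q')) <-> (cj j y = Some q').
  rewrite /ct; case: pickP => [j' h|h0]; last first.
    by split => // e; have := h0 j; rewrite e.
  split; first by case e : (cj j' y) => [q''|] //= [<- <-].
  by move=> e; have -> : j' = j; [apply: (cj1 _ _ y) => //; rewrite e|rewrite e].
pose wt j (k : option ('I_M * C)) : R :=
  if k is Some (j', q') then if j' == j then w q' else 0 else 0.
have wtE j y : wt j (ct y) = optw w (cj j y).
  case e : (cj j y) => [q'|] /=; first by have /ctE -> := e; rewrite /wt eqxx.
  case e' : (ct y) => [[j' q']|//] /=; case: eqP => // jj'.
  by move: e'; rewrite jj' => /ctE; rewrite e.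
have wt0 j k : 0 <= wt j k by case: k => [[j' q']|] //=; case: eqP.
have mct : forall k, measurable [set y | ct y = k].
  apply: measurable_option_label => -[j q'].
  rewrite (_ : [set y | _] = (fun y => vscale r^-1 (vsub y (vsub (x j) (vscale r a)))) @^-1` [set y | c0 y = Some q']).
    by rewrite -[X in measurable X]setTI; apply: measurable_affine.
  by apply/seteqP; split => y; rewrite /= -/(cj j y) ctE.
have p0 k := plab_ge0 P X ct k.
have p1 := plab_sum1 mX law mct.
have tr := iid_transfer mX law indep mct n.
set p := plab P X ct in p0 p1 tr.
pose good j (s : seq (option ('I_M * C))) := tau <= \sum_(k <- s) wt j k.
pose F j s : R := (~~ good j s)%:R.
exists [set u | [forall j, ~~ good j [seq ct (X i u) | i <- iota 0 n]]]; split.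
- exact: (measurable_labels mX mct 0 n (fun s => [forall j, ~~ good j s])).
- rewrite (tr (fun s => [forall j, ~~ good j s])) lee_fin.
  rewrite (@eq_iidE _ _ p n _ (fun s => \prod_j F j s)); last first.
    move=> s _; rewrite /F; case: forallP => [h|nh].
      by rewrite big1// => j _; rewrite h.
    have [j gj] : exists j, good j s.
      by apply: contrapT => h; apply: nh => j; apply/negP => gj; apply: h; exists j.
    by rewrite (bigD1 j)//= gj mul0r.
  (* [None] is the neutral label: it carries no weight, so putting it in place of another can only
     help a region to fail. *)
  apply: (le_trans (@iidE_neg_assoc _ _ _ p (omap fst) None p0 p1 n F _ _ _ _)) => //.
  + move=> j s1 k s2; rewrite /F; case g : (good j (s1 ++ None :: s2)); last by rewrite lern1 leq_b1.
    suff -> : good j (s1 ++ k :: s2) by [].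
    apply: (le_trans g); rewrite !big_cat !big_cons /= add0r lerD2l lerDr.
    exact: wt0.
  + move=> j s1 k s2 hk; rewrite /F /good !big_cat !big_cons /=.
    suff -> : wt j k = 0 by [].
    by case: k hk => [[j' q']|] //=; have [->|//] := eqVneq j' j; rewrite eqxx.
  apply: (@le_trans _ _ (\prod_(j < M) expR (- q))); last first.
    by rewrite prodr_const card_ord -expRM_natl mulrN.
  apply: ler_prod => j _; rewrite iidE_ge0//=.
  have -> : iidE p n (F j) = 1 - iidE p n (fun s => (good j s)%:R).
    apply/eqP; rewrite eq_sym subr_eq -iidED; apply/eqP.
    rewrite -[LHS](iidE_cst n 1 p1); apply: eq_iidE => s _.
    by rewrite /F; case: (good j s) => /=; rewrite ?add0r ?addr0.
  apply: le_trans (expR_ge1Dx _); rewrite lerD2l lerN2 -lee_fin -tr.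
  apply: (le_trans (hq j)); rewrite le_eqVlt; apply/orP; left; apply/eqP; congr (P _).
  have e u : \sum_(i < n) wt j (ct (X i u)) = \sum_(i < n) optw w (cj j (X i u)).
    by apply: eq_bigr => i _; rewrite wtE.
  by apply/seteqP; split => u; rewrite /= /good sum_labels e.
- move=> u /= /negP; rewrite negb_forall => /existsP [j]; rewrite negbK => gj.
  exists j; move: gj; rewrite /good sum_labels.
  by move=> h; apply: (le_trans h); apply: ler_sum => i _; rewrite wtE.
Qed.

End Chernoff.

(** * Upper tails of the chromatic number *)

Lemma measure_bigcup_finType_le (R : realType) (dT : measure_display) (T : measurableType dT)
    (m : {measure set T -> \bar R}) (I : finType) (F : I -> set T) :
  (forall i, measurable (F i)) -> (m (\bigcup_i F i) <= \sum_i m (F i))%E.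
Proof.
move=> mF; rewrite (_ : [set: I] = [set` index_enum I]); last first.
  by apply/seteqP; split => i //= _; rewrite mem_index_enum.
rewrite bigcup_seq; elim: (index_enum I) => [|i l IH]; first by rewrite !big_nil measure0.
rewrite !big_cons; apply: (le_trans (measureU2 _ _ _)) => //.
  by apply: bigsetU_measurable => j _.
exact: leeD2l.
Qed.

Section Upper.
Context {R : realType} {d : nat}.
Notation V := (d.-tuple R).
Hypothesis hd : (0 < d)%N.
Variable nrm : V -> R.
Hypothesis hnrm : is_norm nrm.
Variable vol : {measure set V -> \bar R}.
Hypothesis hvol : is_lebesgue vol.
Context {dO : measure_display} {Omega : measurableType dO}.
Variables (P : probability Omega R) (X : nat -> Omega -> V).
Hypothesis mX : forall i, measurable_fun setT (X i).
Hypothesis law : forall i (A : set V), measurable A -> P (X i @^-1` A) = P (X 0%N @^-1` A).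
Hypothesis indep : mutually_independent P X.
Variable sigma : R.
Hypothesis sigma0 : 0 < sigma.
Hypothesis law_le : forall A, measurable A -> (P (X 0%N @^-1` A) <= sigma%:E * vol A)%E.

Notation chi w n r := (chromatic n (rgg_adj nrm (fun i => X i w) r n)).

Lemma rgg_chromatic_mono (x : nat -> V) n N (r r' : R) : (n <= N)%N -> r <= r' ->
  (chromatic n (rgg_adj nrm x r n) <= chromatic N (rgg_adj nrm x r' N))%N.
Proof.
move=> nN rr; apply: chromatic_le.
have /existsP [c /forallP cP] := chromatic_colorable (@rgg_irr _ _ nrm x r' N).
apply: (@colorableP _ _ 'I_(chromatic N (rgg_adj nrm x r' N)) (fun i => c (widen_ord nN i))).
  by rewrite card_ord.
move=> i j /andP [ij le]; have /forallP /(_ (widen_ord nN j)) := cP (widen_ord nN i).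
by rewrite /rgg_adj -val_eqE /= val_eqE ij (le_trans le rr).
Qed.

(** With all weights 1, the window bound controls all degrees. The event concerns the largest graph;
    monotonicity carries it to all smaller [n] and radii, as the blocks require. *)
Lemma degree_upper : exists2 C : R, 0 < C & forall N k r s, 0 < r -> 0 <= s ->
  exists B, [/\ measurable B,
    (P B <= (N%:R * C * expR s *
       expR (N%:R * (sigma * r ^+ d * (C * expR s)) - s * (k.+2)%:R))%:E)%E &
    forall u, ~ B u -> forall n r', (n <= N)%N -> r' <= r -> (chi u n r' <= k.+1)%N].
Proof.
have [c0 c00 cl] := nrm_lower hnrm hd.
pose m := (Num.truncn c0^-1).+2.*2.+1.
exists #|{ffun 'I_d -> 'I_m}|%:R.
  by rewrite ltr0n; apply/card_gt0P; exists [ffun=> ord0].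
move=> N k r s r0 s0.
have phi01 (q : {ffun 'I_d -> 'I_m}) : 0 <= (1 : R) <= 1 by rewrite ler01 lexx.
have [B [mB PB BQ]] := chernoff_grid hvol mX law indep law_le N phi01 r0 s0 (ltr0Sn R k.+1).
exists B; split => //.
  apply: (le_trans PB); rewrite lee_fin; apply: ler_wpM2l.
    by rewrite !mulr_ge0// expR_ge0.
  rewrite ler_expR lerD2r; apply: ler_wpM2l => //; apply: ler_wpM2l.
    by rewrite mulr_ge0 ?exprn_ge0// ltW.
  rewrite -sum1_card natr_sum mulr_suml; apply: ler_sum => q _.
  by rewrite mul1r mulr1 gerBl.
move=> u nB n r' nN rr'.
apply: leq_trans (rgg_chromatic_mono (fun i => X i u) nN rr') _.
by apply: (rgg_degree hnrm c00 cl) => // z; exact: BQ.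
Qed.

Lemma lp_upper (kappa t : R) : 0 < kappa -> 0 < t ->
  exists D n1 : R, forall N r, (0 < N)%N -> 0 < r -> exists B, [/\ measurable B,
    (P B <= (D * N%:R * expR (- (sigma * (N%:R * r ^+ d) / t)))%:E)%E &
    forall u, ~ B u -> forall n r', (n <= N)%N -> r' <= r ->
      (chi u n r')%:R <= (1 + kappa) * (sigma * (N%:R * r ^+ d)) * fine (f_chi vol nrm t) + n1].
Proof.
move=> k0 t0; have C10 := nrm_upper_gt0 hnrm; set C1 := nrm_upper nrm in C10.
(* Two factors [1 + e] are lost, to the dilation of cell functions and to [chromatic_upper]. *)
pose e := Num.min 1 (kappa / 3).
have e0 : 0 < e by rewrite lt_min ltr01 divr_gt0.
have e1 : e <= 1 by rewrite ge_min lexx.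
have e3 : e <= kappa / 3 by rewrite ge_min lexx orbT.
have d0 : 0 < d%:R :> R by rewrite ltr0n.
have l0 : 0 < ln (1 + e) by rewrite ln_gt0// ltrDl.
(* Makes the dilation [c] satisfy [c ^+ d <= 1 + e], through [c <= expR (ln (1 + e) / d)]. *)
pose eps := ln (1 + e) / (2 * C1 * d%:R).
have eps0 : 0 < eps by rewrite divr_gt0// !mulr_gt0.
pose c := 1 + 2 * (C1 * eps).
have c1 : 1 <= c by rewrite lerDl; apply: mulr_ge0 => //; apply: mulr_ge0; exact: ltW.
have c0 : 0 < c by apply: lt_le_trans c1.
have cd : c ^+ d <= 1 + e.
  have ec : c <= expR (ln (1 + e) / d%:R).
    apply: le_trans (expR_ge1Dx _); rewrite /c lerD2l /eps.
    rewrite le_eqVlt; apply/orP; left; apply/eqP; field.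
    by rewrite !gt_eqF.
  apply: (le_trans (y := expR (ln (1 + e) / d%:R) ^+ d)).
    by rewrite lerXn2r// nnegrE ?expR_ge0// ltW.
  by rewrite -expRM_natl mulrC divfK ?gt_eqF// lnK// posrE addr_gt0.
have cd1 : 1 <= c ^+ d by exact: exprn_ege1.
have [M [J [F [n1 [M0 dF H]]]]] := chromatic_upper hnrm hd e0 eps0.
have /choice [s Hs] : forall j, exists s, 0 < s /\
    t^-1 + (eps / c) ^+ d * \sum_q (expR (s * F j q) - 1) <= s * fine (f_chi vol nrm t).
  by move=> j; have [s s0 hs] := fchi_dual hnrm hd hvol eps0 t0 (dF j); exists s.
have fpos : 0 < fine (f_chi vol nrm t).
  apply: (lt_le_trans (max_int_gt0 hnrm hd hvol)).
  by rewrite -lee_fin fineK ?fchi_ge_max_int ?fchi_fin_num.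
pose K : R := #|{ffun 'I_d -> 'I_M}|%:R.
exists (\sum_j K * expR (s j)), n1 => N r N0 r0.
pose mu := sigma * (N%:R * r ^+ d).
have mu0 : 0 < mu by rewrite !mulr_gt0 ?exprn_gt0// ltr0n.
pose tau := mu * c ^+ d * fine (f_chi vol nrm t).
have tau0 : 0 < tau by rewrite mulr_gt0// mulr_gt0// exprn_gt0.
have h0 : 0 < eps * r by rewrite mulr_gt0.
have F01 j q : 0 <= F j q <= 1.
  case: (dF j) => -> _ /=.
  exact: (dual_feasible_le1 (cell_stable1 nrm eps (1 + C1 * eps) (M := M)) q (dF j)).
have /choice [B HB] : forall j, exists B, [/\ measurable B,
    (P B <= (K * expR (s j) * N%:R * expR (- (mu / t)))%:E)%E &
    forall w, ~ B w -> forall z, \sum_(i < N) optw (F j) (label (eps * r) M z (X i w)) < tau].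
  move=> j; have [s0 hs] := Hs j.
  have [B [mB PB BQ]] := chernoff_grid hvol mX law indep law_le N (F01 j) h0 (ltW s0) tau0.
  exists B; split => //; apply: (le_trans PB); rewrite lee_fin.
  rewrite [N%:R * _]mulrC -/K [K * N%:R * _]mulrAC; apply: ler_wpM2l.
    by rewrite !mulr_ge0// expR_ge0.
  rewrite ler_expR exprMn.
  have {}hs : eps ^+ d * \sum_q (expR (s j * F j q) - 1) <=
      c ^+ d * (s j * fine (f_chi vol nrm t) - t^-1).
    by move: hs; rewrite expr_div_n mulrAC -lerBrDl ler_pdivrMr ?exprn_gt0// [leRHS]mulrC.
  set S := \sum_q _ in hs *.
  have -> : N%:R * (sigma * (eps ^+ d * r ^+ d) * S) = mu * (eps ^+ d * S).
    by rewrite /mu; ring.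
  apply: (@le_trans _ _ (mu * (c ^+ d * (s j * fine (f_chi vol nrm t) - t^-1)) - s j * tau)).
    by rewrite lerD2r ler_pM2l.
  (* By the choice of [tau] the terms in [f_chi] cancel, and only the cost [c ^+ d * (mu / t)]
     remains. *)
  have -> : mu * (c ^+ d * (s j * fine (f_chi vol nrm t) - t^-1)) - s j * tau =
    - (c ^+ d * (mu / t)) by rewrite /tau; ring.
  by rewrite lerN2 ler_peMl// divr_ge0// ltW.
exists (\bigcup_j B j); split.
- by apply: fin_bigcup_measurable; [exact: finite_finset|move=> j _; case: (HB j)].
- apply: (le_trans (measure_bigcup_finType_le _ _)); first by move=> j; case: (HB j).
  rewrite -mulrA mulr_suml -sumEFin; apply: lee_sum => j _.
  by rewrite mulrA; case: (HB j).
move=> u nB n r' nN rr'.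
have := rgg_chromatic_mono (fun i => X i u) nN rr'; rewrite -(ler_nat R) => /le_trans; apply.
apply: (le_trans (H N (fun i => X i u) r tau r0 tau0 _)).
  move=> j z; apply: ltW; case: (HB j) => _ _; apply => //.
  by move=> Bj; apply: nB; exists j.
rewrite lerD2r /tau -/mu mulrA ler_wpM2r ?(ltW fpos)// mulrCA mulrC ler_wpM2r ?(ltW mu0)//.
apply: (@le_trans _ _ ((1 + e) * (1 + e))).
  by rewrite ler_wpM2l// addr_ge0// ltW.
have : e * e <= e by rewrite ler_piMl// ltW.
by rewrite mulrDl mul1r mulrDr mulr1; lra.
Qed.

End Upper.

(** * Simple feasible functions *)

Section SimpleApproximation.
Context {R : realType} {d : nat}.
Notation V := (d.-tuple R).
Hypothesis hd : (0 < d)%N.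
Variable nrm : V -> R.
Hypothesis hnrm : is_norm nrm.
Variable vol : {measure set V -> \bar R}.
Hypothesis hvol : is_lebesgue vol.

(** Rounding [phi] down to multiples of [1 / m] in a large box keeps it feasible and cannot increase
    the entropy; only the tilted mean loses, half of [eps] to the box and half to the rounding. *)
Lemma simple_approx (phi : V -> R) (s eps : R) : feasible nrm phi -> 0 <= s -> 0 < eps ->
  exists (C : finType) (c : V -> option C) (w : C -> R) (a : V) (L : R),
  let v q := fine (vol [set y | c y = Some q]) in
  [/\ [/\ 0 < L, forall q, measurable [set y | c y = Some q],
      forall y, c y != None -> cube a L y & forall q, 0 <= w q <= 1],
    feasible nrm (fun y => optw w (c y)),
    \sum_q v q * Hfun (expR (s * w q)) <= tilted_entropy vol phi s &
    tilted_mean vol phi s - eps <= \sum_q v q * (w q * expR (s * w q))].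
Proof.
move=> fphi s0 eps0; have mphi := feasible_measurable fphi.
have phi01 := feasible_01 fphi; have Iphi := feasible_integrable hnrm hd hvol fphi.
(* Lipschitz constant of [u * expR (s * u)] on the unit interval. *)
pose D := (1 + s) * expR s.
have D0 : 0 < D by rewrite mulr_gt0 ?expR_gt0// ltr_wpDr.
have ed : 0 < eps / (2 * D) by rewrite divr_gt0// mulr_gt0.
pose I := (\int[vol]_x phi x)%R.
have [n hn] : exists n : nat, I - eps / (2 * D) <= (\int[vol]_x box_restrict phi n.+1%:R x)%R.
  have lt : I - eps / (2 * D) < I by rewrite gtrBl.
  have := box_restrict_cvg (vol := vol) fphi; rewrite (feasible_intE hnrm hd hvol)// => /fine_cvg cv.
  have [n _ H] : \forall n \near \oo, I - eps / (2 * D) <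
      fine (\int[vol]_x (box_restrict phi n.+1%:R x)%:E)%E by exact: cvgr_gt cv _ lt.
  by exists n; apply: ltW; exact: (H n (leqnn n)).
pose L : R := n.+1%:R; have L0 : 0 < L by rewrite ltr0n.
pose Q := cbox (vcst (- L) : V) (vcst L).
have mQ : measurable Q := measurable_cbox _ _.
have vQ : vol Q = ((2 * L) ^+ d)%:E.
  rewrite vol_cbox// => [|i]; last by rewrite !tnth_vcst lerNl (le_trans _ (ltW L0))// oppr_le0 ltW.
  under eq_bigr do rewrite !tnth_vcst opprK -mulr2n -[_ *+ 2]mulr_natl.
  by rewrite prodr_const card_ord.
pose m := (Num.truncn (2 * D * (2 * L) ^+ d / eps)).+1.
have m0 : 0 < m%:R :> R by rewrite ltr0n.
have hm : (2 * L) ^+ d / m%:R <= eps / (2 * D).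
  rewrite ler_pdivrMr// mulrAC ler_pdivlMr; last by apply: mulr_gt0.
  have u0 : 0 <= 2 * D * (2 * L) ^+ d / eps.
    apply: divr_ge0; last exact: ltW.
    by apply: mulr_ge0; [apply: mulr_ge0 => //; exact: ltW|rewrite exprn_ge0// mulr_ge0// ltW].
  have /andP [_ /ltW] := truncn_itv u0; rewrite ler_pdivrMr// -/m [_ * eps]mulrC.
  by rewrite [_ ^+ d * _]mulrC.
have pm x : 0 <= phi x * m%:R by rewrite mulr_ge0//; case/andP: (phi01 x).
have lt x : (Num.truncn (phi x * m%:R) < m.+1)%N.
  rewrite ltnS truncn_le_nat; apply: (@le_lt_trans _ _ m%:R); last by rewrite ltr_nat.
  by rewrite ler_piMl//; case/andP: (phi01 x).
pose c y : option 'I_m.+1 := if y \in Q then Some (Ordinal (lt y)) else None.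
pose w (q : 'I_m.+1) : R := q%:R / m%:R.
have w01 q : 0 <= w q <= 1.
  by rewrite divr_ge0//= ler_pdivrMr// mul1r ler_nat -ltnS.
have cE q y : c y = Some q <-> Q y /\ w q <= phi y < w q + m%:R^-1.
  rewrite /c /w; case: (boolP (y \in Q)) => [/set_mem Qy|/negP nQy]; last first.
    by split => // -[Qy _]; case: nQy; exact/mem_set.
  rewrite -{3}[m%:R^-1]mul1r -mulrDl natr1 ler_pdivrMr// ltr_pdivlMr//; split.
    by case=> <-; split => //=; exact: truncn_itv.
  move=> [_ h]; congr Some; apply/val_inj => /=; exact/truncn_def.
have mc q : measurable [set y | c y = Some q].
  rewrite (_ : [set y | _] = Q `&` phi @^-1` `[w q, w q + m%:R^-1[%classic); last first.
    by apply/seteqP; split => y /=; rewrite cE in_itv.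
  by apply: measurableI => //; rewrite -[X in measurable X]setTI; exact: mphi.
have vc q : (vol [set y | c y = Some q] < +oo)%E.
  apply: le_lt_trans (_ : (vol Q < +oo)%E); last by rewrite vQ ltry.
  by apply: le_measure; rewrite ?inE// => y /= /cE [].
have wphi y : optw w (c y) <= phi y.
  case e : (c y) => [q|] /=; last by case/andP: (phi01 y).
  by have /cE [_ /andP []] := e.
exists 'I_m.+1, c, w, (vcst (- L)), (2 * L + 1) => v; split.
- split => //; first by rewrite addr_gt0// mulr_gt0.
  move=> y; case e : (c y) => [q|//] _; have /cE [Qy _] := e.
  by move=> i; have := Qy i; rewrite !tnth_vcst => /andP [? ?]; apply/andP; split; lra.
- apply: (feasible_dominated fphi); first exact: measurable_optw.
  by move=> y; rewrite wphi andbT; case: (c y) => [q|] //=; case/andP: (w01 q).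
- under eq_bigr do rewrite mulrC.
  rewrite -(@Rintegral_optw _ _ _ _ vol c (fun q => Hfun (expR (s * w q))))//.
  apply: le_Rintegral => //.
  + exact: integrable_optw.
  + exact: integrable_tilted_entropy.
  move=> y _; case e : (c y) => [q|] /=.
    rewrite -subr_ge0; have := wphi y; rewrite e /= => h.
    have sw : 0 <= s * w q <= s * phi y.
      by rewrite ler_wpM2l// andbT mulr_ge0//; case/andP: (w01 q).
    by have /andP [] := Hfun_expR_lip sw.
  have sp : 0 <= s * phi y by rewrite mulr_ge0//; case/andP: (phi01 y).
  by apply: le_trans (Hfun_expR_ge sp); rewrite divr_ge0// sqr_ge0.
under eq_bigr do rewrite mulrC.
rewrite -(@Rintegral_optw _ _ _ _ vol c (fun q => w q * expR (s * w q)))//.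
have bnd y : phi y * expR (s * phi y) <= optw (fun q => w q * expR (s * w q)) (c y) +
    D * ((phi y - box_restrict phi L y) + m%:R^-1 * \1_Q y).
  have step u : 0 <= u <= phi y -> phi y * expR (s * phi y) - u * expR (s * u) <= D * (phi y - u).
    move=> /andP [u0 up]; have /andP [p0 p1] := phi01 y.
    have e1 : expR (s * phi y) - expR (s * u) <= expR (s * phi y) * (s * (phi y - u)).
      have h := expR_ge1Dx (s * u - s * phi y).
      have -> : expR (s * u) = expR (s * phi y) * expR (s * u - s * phi y).
        by rewrite -expRD; congr expR; ring.
      rewrite -subr_ge0 (_ : _ - _ =
        expR (s * phi y) * (expR (s * u - s * phi y) - (1 + (s * u - s * phi y)))); last by ring.
      by rewrite mulr_ge0 ?expR_ge0// subr_ge0.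
    have ep : expR (s * phi y) <= expR s by rewrite ler_expR ler_piMr.
    have e0 := expR_gt0 (s * phi y).
    have -> : phi y * expR (s * phi y) - u * expR (s * u) =
      (phi y - u) * expR (s * phi y) + u * (expR (s * phi y) - expR (s * u)) by ring.
    apply: (@le_trans _ _ ((phi y - u) * expR (s * phi y) + expR (s * phi y) * (s * (phi y - u)))).
      rewrite lerD2l; apply: le_trans (ler_wpM2l u0 e1) _.
      rewrite ler_piMl//; last by rewrite (le_trans up).
      by rewrite mulr_ge0 ?expR_ge0// mulr_ge0// subr_ge0.
    have -> : (phi y - u) * expR (s * phi y) + expR (s * phi y) * (s * (phi y - u)) =
      (1 + s) * expR (s * phi y) * (phi y - u) by ring.
    by rewrite /D ler_wpM2r ?subr_ge0// ler_wpM2l// addr_ge0.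
  rewrite /box_restrict -/Q !indicE; case e : (c y) => [q|] /=.
    have /cE [Qy /andP [h1 h2]] := e; rewrite (mem_set Qy) !mulr1 subrr add0r.
    have := step (w q); rewrite h1; case/andP: (w01 q) => -> _ => /(_ isT).
    have : D * (phi y - w q) <= D / m%:R by rewrite ler_pM2l//; lra.
    lra.
  have nQ : y \notin Q by move: e; rewrite /c; case: ifP.
  rewrite (negbTE nQ) !mulr0 subr0 addr0 add0r.
  by have := step 0; rewrite lexx/= mul0r !subr0; apply; case/andP: (phi01 y).
have mbr := box_restrict_feasible L fphi.
have Ibr := feasible_integrable hnrm hd hvol mbr.
have IQ : vol.-integrable setT (EFin \o (fun y => m%:R^-1 * \1_Q y)).
  apply: (@integrableZl _ _ _ vol setT measurableT _ (fun y => (\1_Q y)%:E)).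
  apply/integrableP; split; first by apply/measurable_EFinP; exact: measurable_indic.
  rewrite (_ : (fun _ => _) = (fun y => (\1_Q y)%:E)); last first.
    by apply/funext => y /=; rewrite ger0_norm// indicE ler0n.
  by rewrite integral_indic ?setIT// vQ ltry.
have vQr : (\int[vol]_y (m%:R^-1 * \1_Q y))%R = (2 * L) ^+ d / m%:R.
  rewrite RintegralZl//; first by rewrite /Rintegral integral_indic ?setIT// vQ mulrC.
  by have := @integrableZl _ _ _ vol setT measurableT m%:R _ IQ;
    rewrite (_ : (fun x => _) = (EFin \o \1_Q))//; apply/funext => y /=;
    rewrite -EFinM mulrA mulfV ?mul1r// gt_eqF.
have Io := @integrable_optw _ _ _ _ vol c (fun q => w q * expR (s * w q)) mc vc.
have Id : vol.-integrable setT (EFin \o (fun y => phi y - box_restrict phi L y)).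
  by apply: (@integrableB _ _ _ vol setT measurableT (EFin \o phi) (EFin \o box_restrict phi L)).
have Is : vol.-integrable setT
    (EFin \o (fun y => (phi y - box_restrict phi L y) + m%:R^-1 * \1_Q y)).
  exact: (@integrableD _ _ _ vol setT measurableT (EFin \o _) (EFin \o _)).
have IDs : vol.-integrable setT
    (EFin \o (fun y => D * ((phi y - box_restrict phi L y) + m%:R^-1 * \1_Q y))).
  exact: (@integrableZl _ _ _ vol setT measurableT D (EFin \o _)).
rewrite lerBlDr; apply: (@le_trans _ _ (\int[vol]_y (optw (fun q => w q * expR (s * w q)) (c y) +
    D * ((phi y - box_restrict phi L y) + m%:R^-1 * \1_Q y)))%R).
  apply: le_Rintegral => //; first exact: integrable_tilted_mean.
  exact: (@integrableD _ _ _ vol setT measurableT (EFin \o _) (EFin \o _)).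
rewrite RintegralD// lerD2l RintegralZl// RintegralD// RintegralB// vQr.
rewrite (_ : eps = D * (eps / (2 * D) + eps / (2 * D))); last by field; rewrite gt_eqF.
rewrite ler_pM2l//; apply: lerD => //; rewrite lerBlDr -lerBlDl; exact: hn.
Qed.

End SimpleApproximation.

(** * Lower tails of the chromatic number *)

Lemma expRN_le_quadratic (R : realType) (x : R) : 0 <= x -> expR (- x) <= 1 - x + x ^+ 2.
Proof.
move=> x0; have x1 : 0 < 1 + x by lra.
apply: (@le_trans _ _ (1 + x)^-1).
  by rewrite expRN lef_pV2 ?posrE ?expR_gt0// expR_ge1Dx.
rewrite -[leLHS]mul1r ler_pdivrMr//.
have -> : (1 - x + x ^+ 2) * (1 + x) = 1 + x ^+ 3 by ring.
by rewrite lerDl exprn_ge0.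
Qed.

Lemma expRN_le_sub1 (R : realType) (x : R) : 0 <= x -> x <= 2^-1 -> expR (- (2 * x)) <= 1 - x.
Proof.
move=> x0 x2; have x1 : 0 < 1 - x by lra.
rewrite expRN -[leRHS]invrK lef_pV2 ?posrE ?expR_gt0 ?invr_gt0//.
apply: le_trans (expR_ge1Dx _); rewrite -[leLHS]mul1r ler_pdivrMr//.
have : 0 <= x * (1 - 2 * x) by rewrite mulr_ge0//; lra.
lra.
Qed.

Lemma expn_le_binomial n k : (k <= n)%N -> (n ^ k <= k ^ k * 'C(n, k))%N.
Proof.
elim: k n => [|k IH] [|n] // kn; rewrite ?bin0//.
rewrite ltnS in kn; rewrite !expnS mulnAC -mul_bin_diag -mulnA leq_pmul2l//= mulnC.
have k0 : (0 < k ^ k)%N by case: (k) => // m; rewrite expn_gt0.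
rewrite -(leq_pmul2l k0) -expnMn; apply: (@leq_trans ((k.+1 * n) ^ k)).
  have [->//|k1] := posnP k.
  by rewrite leq_exp2r// mulnS mulSn leq_add2r.
rewrite expnMn mulnCA leq_mul2l mulnC; apply/orP; right; rewrite mulnC; exact: IH.
Qed.

Section Lower.
Context {R : realType} {d : nat}.
Notation V := (d.-tuple R).
Hypothesis hd : (0 < d)%N.
Variable nrm : V -> R.
Hypothesis hnrm : is_norm nrm.
Variable vol : {measure set V -> \bar R}.
Hypothesis hvol : is_lebesgue vol.
Variable f : V -> R.
Hypothesis mf : measurable_fun setT f.
Hypothesis f0 : forall x, 0 <= f x.
Hypothesis fbdd : exists M : R, forall x, f x <= M.
Hypothesis fint : (\int[vol]_x (f x)%:E = 1)%E.
Context {dO : measure_display} {Omega : measurableType dO}.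
Variables (P : probability Omega R) (X : nat -> Omega -> V).
Hypothesis mX : forall i, measurable_fun setT (X i).
Hypothesis hlaw : forall i (A : set V), measurable A ->
  P (X i @^-1` A) = (\int[vol]_(x in A) (f x)%:E)%E.
Hypothesis indep : mutually_independent P X.

Notation sigma := (ess_sup_density vol f).
Notation chi w n r := (chromatic n (rgg_adj nrm (fun i => X i w) r n)).

Lemma law_same i (A : set V) : measurable A -> P (X i @^-1` A) = P (X 0%N @^-1` A).
Proof. by move=> mA; rewrite !hlaw. Qed.

Lemma law_le A : measurable A -> (P (X 0%N @^-1` A) <= sigma%:E * vol A)%E.
Proof. by move=> mA; rewrite hlaw//; exact: nu_le. Qed.

Section Region.
Variables (C : finType) (c : V -> option C) (a : V) (L : R).
Hypothesis mc : forall q, measurable [set y | c y = Some q].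
Hypothesis cL : forall y, c y != None -> cube a L y.
Hypothesis L0 : 0 < L.
Variables (b delta r : R) (x : V).
Hypothesis b0 : 0 <= b.
Hypothesis r0 : 0 < r.
Hypothesis xE : (vol (cube x (r * L) `\` [set y | (b < f y)%R]) <= (delta * (r * L) ^+ d)%:E)%E.

Definition region_label (y : V) : option C := c (vscale r^-1 (vsub y (vsub x (vscale r a)))).

Lemma region_label_preimage q : [set y | region_label y = Some q] =
  (fun y => vscale r^-1 (vsub y (vsub x (vscale r a)))) @^-1` [set y | c y = Some q].
Proof. by []. Qed.

Lemma measurable_region_label k : measurable [set y | region_label y = k].
Proof.
apply: measurable_option_label => q; rewrite region_label_preimage -[X in measurable X]setTI.
exact: measurable_affine.
Qed.

Notation v q := (fine (vol [set y | c y = Some q])).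

Lemma vol_level_fin q : vol [set y | c y = Some q] \is a fin_num.
Proof.
rewrite ge0_fin_numE//; apply: le_lt_trans (_ : (vol (cube a L) < +oo)%E).
  by apply: le_measure; rewrite ?inE//; [exact: measurable_cube|move=> y /= cy; apply: cL; rewrite cy].
by rewrite vol_cube ?ltry.
Qed.

Lemma vol_region_label q : vol [set y | region_label y = Some q] = (r ^+ d * v q)%:E.
Proof. by rewrite region_label_preimage vol_affine// EFinM fineK// vol_level_fin. Qed.

Lemma region_mass_le q : plab P X region_label (Some q) <= sigma * r ^+ d * v q.
Proof.
have mq := measurable_region_label (Some q).
rewrite -lee_fin /plab fineK; last first.
  by rewrite fin_num_measure// -[X in measurable X]setTI; exact: mX.
by apply: (le_trans (law_le mq)); rewrite vol_region_label -EFinM mulrA.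
Qed.

Lemma region_mass_ge q :
  b * r ^+ d * (v q - delta * L ^+ d) <= plab P X region_label (Some q).
Proof.
have mq := measurable_region_label (Some q).
have sub : [set y | region_label y = Some q] `<=` cube x (r * L).
  move=> y /= e; have : cube a L (vscale r^-1 (vsub y (vsub x (vscale r a)))).
    by apply: cL; rewrite -/(region_label y) e.
  move=> h i; have := h i; rewrite tnth_vscale !tnth_vsub tnth_vscale.
  rewrite mulrC ler_pdivlMr// ltr_pdivrMr// mulrDl ![_ * r]mulrC => /andP [? ?].
  by apply/andP; split; lra.
have fin : P (X 0%N @^-1` [set y | region_label y = Some q]) \is a fin_num.
  by rewrite fin_num_measure// -[X in measurable X]setTI; exact: mX.
have := nu_ge mf f0 mq (measurable_cube _ _) sub b0 xE.
rewrite -(hlaw 0%N mq) vol_region_label -(fineK fin) -EFinM -EFinD lee_fin exprMn.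
by rewrite -/(plab P X region_label (Some q)); lra.
Qed.

Lemma region_sum_le (g : C -> R) : (forall q, 0 <= g q) ->
  \sum_q plab P X region_label (Some q) * g q <= sigma * r ^+ d * \sum_q v q * g q.
Proof.
move=> g0; rewrite mulr_sumr; apply: ler_sum => q _.
by rewrite mulrA ler_wpM2r// region_mass_le.
Qed.

Lemma region_sum_ge (g : C -> R) : (forall q, 0 <= g q) ->
  b * r ^+ d * (\sum_q v q * g q - delta * L ^+ d * \sum_q g q) <=
  \sum_q plab P X region_label (Some q) * g q.
Proof.
move=> g0; rewrite [delta * _ * _]mulr_sumr -sumrB mulr_sumr; apply: ler_sum => q _.
by rewrite -mulrBl mulrA ler_wpM2r// region_mass_ge.
Qed.

Lemma region_transfer n (w : C -> R) (A : pred R) :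
  P [set u | A (\sum_(i < n) optw w (region_label (X i u)))] =
  (iidE (plab P X region_label) n (fun l => (A (\sum_(k <- l) optw w k))%:R))%:E.
Proof.
rewrite -(iid_transfer mX law_same indep measurable_region_label n
  (fun l => A (\sum_(k <- l) optw w k))).
by congr (P _); apply/seteqP; split => u; rewrite /= sum_labels.
Qed.

End Region.

(** In cubes mostly filled by the set where [f] exceeds a level [b] just below [sigma], cells have
    mass nearly [sigma] times their volume. The level costs at most [eps / 2], the holes of relative
    size [delta] another [eps / 2]. *)
Lemma region_weights (C : finType) (c : V -> option C) (a : V) (L : R) (g : C -> R) (eps : R) :
  (forall q, measurable [set y | c y = Some q]) -> (forall y, c y != None -> cube a L y) ->
  0 < L -> (forall q, 0 <= g q) -> 0 < eps ->
  let v q := fine (vol [set y | c y = Some q]) in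
  exists2 c0 : R, 0 < c0 & exists2 h0 : R, 0 < h0 & forall r, 0 < r < h0 ->
  exists (M : nat) (y : 'I_M -> V), [/\ c0 <= M%:R * r ^+ d,
    trivIset setT (fun j => cube (y j) (r * L)) &
    forall j, let p := plab P X (region_label c a r (y j)) in
      sigma * r ^+ d * (\sum_q v q * g q - eps) <= \sum_q p (Some q) * g q /\
      forall g', (forall q, 0 <= g' q) ->
        \sum_q p (Some q) * g' q <= sigma * r ^+ d * \sum_q v q * g' q].
Proof.
move=> mc cL L0 g0 eps0 v; have sg0 := sigma_gt0 hvol mf f0 fbdd fint.
have v0 q : 0 <= v q by exact: fine_ge0.
pose T1 := \sum_q v q * g q; pose E1 := \sum_q g q.
have T10 : 0 <= T1 by apply: sumr_ge0 => q _; rewrite mulr_ge0.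
have E10 : 0 <= E1 by apply: sumr_ge0.
have T11 : 0 < T1 + 1 by rewrite ltr_wpDl.
pose k1 := Num.min 2^-1 (eps / 2 / (T1 + 1)).
have k10 : 0 < k1 by rewrite lt_min invr_gt0 ltr0n /= !divr_gt0.
have k12 : k1 <= 2^-1 by rewrite ge_min lexx.
have k1T : k1 * T1 <= eps / 2.
  apply: (@le_trans _ _ (k1 * (T1 + 1))); first by rewrite ler_pM2l// lerDl.
  by rewrite -ler_pdivlMr// ge_min lexx orbT.
have k1' : 0 <= 1 - k1 by clearbody k1; lra.
pose b := sigma * (1 - k1).
have b0 : 0 <= b by rewrite mulr_ge0// ltW.
have Ld0 : 0 < L ^+ d by rewrite exprn_gt0.
have LE : 0 < L ^+ d * E1 + 1 by rewrite ltr_wpDl// mulr_ge0// ltW.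
pose delta := eps / 2 / (L ^+ d * E1 + 1).
have delta0 : 0 < delta by rewrite !divr_gt0.
have dE : delta * L ^+ d * E1 <= eps / 2.
  by rewrite -mulrA /delta mulrAC ler_pdivrMr// ler_pM2l ?divr_gt0// lerDl.
have vE : (0 < vol [set y | (b < f y)%R])%E.
  rewrite (_ : b = sigma - sigma * k1); last by rewrite /b; ring.
  by apply: vol_near_sigma => //; rewrite mulr_gt0.
have [cM cM0 [hM hM0 dense]] :=
  dense_cubes hvol (measurable_superlevel mf b) delta0 vE.
exists (cM / L ^+ d); first by rewrite divr_gt0.
exists (hM / L); first by rewrite divr_gt0.
move=> r /andP [r0 rM].
have rL : 0 < r * L < hM by rewrite mulr_gt0//= -ltr_pdivlMr.
have [M [y [cMh yE ty]]] := dense _ rL; exists M, y; split => //.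
  by rewrite ler_pdivrMr// -mulrA -exprMn.
move=> j p; split; last by move=> g' g'0; exact: (region_sum_le mc cL L0 (y j) r0 g'0).
apply: le_trans (region_sum_ge mc cL L0 b0 r0 (yE j) g0).
rewrite -/E1 -/T1 /b.
have -> : sigma * (1 - k1) * r ^+ d * (T1 - delta * L ^+ d * E1) =
  sigma * r ^+ d * ((1 - k1) * (T1 - delta * L ^+ d * E1)) by ring.
apply: ler_wpM2l; first by rewrite mulr_ge0 ?exprn_ge0// ltW.
apply: (@le_trans _ _ ((1 - k1) * (T1 - eps / 2))); last first.
  by apply: ler_wpM2l => //; rewrite lerD2l lerN2.
have : 0 <= k1 * (eps / 2) by rewrite mulr_ge0 ?(ltW k10)// divr_ge0// ltW.
by move: k1T; lra.
Qed.

(** One region succeeds with probability at least [expR (- (mu * g)) / 2]: the gap between the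
    entropy and [g] pays for the Chebyshev window. The number of regions is of order [r ^- d]. *)
Lemma tilt_lower (phi : V -> R) (s eps g : R) : feasible nrm phi -> 0 < s -> 0 < eps ->
  tilted_entropy vol phi s < g ->
  exists c h0 mu0 : R, [/\ 0 < c, 0 < h0 & forall n r, 0 < r < h0 ->
    mu0 <= sigma * (n%:R * r ^+ d) -> exists B, [/\ measurable B,
      (P B <= (expR (- (c / r ^+ d * expR (- (sigma * (n%:R * r ^+ d) * g)))))%:E)%E &
      forall u, ~ B u ->
        (tilted_mean vol phi s - eps) * (sigma * (n%:R * r ^+ d)) <= (chi u n r)%:R]].
Proof.
move=> fphi s0 eps0 Gg; have sg0 := sigma_gt0 hvol mf f0 fbdd fint.
set T := tilted_mean vol phi s; set G := tilted_entropy vol phi s in Gg *.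
have e4 : 0 < eps / 4 by rewrite divr_gt0.
have [C [c [w [a [L [[L0 mc cL w01] fw GE TE]]]]]] :=
  simple_approx hd hnrm hvol fphi (ltW s0) e4.
rewrite -/G -/T in GE TE; set v := fun q => fine (vol [set y | c y = Some q]).
have v0 q : 0 <= v q by exact: fine_ge0.
have w0 q : 0 <= w q by case/andP: (w01 q).
have se q : 1 <= expR (s * w q) by rewrite -expR0 ler_expR mulr_ge0// ltW.
pose gm q := w q * expR (s * w q); pose gz q := expR (s * w q) - 1.
pose gh q := Hfun (expR (s * w q)).
have gm0 q : 0 <= gm q by rewrite mulr_ge0// expR_ge0.
have gz0 q : 0 <= gz q by rewrite subr_ge0.
have gh0 q : 0 <= gh q.
  have sw : 0 <= s * w q by rewrite mulr_ge0// ltW.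
  by apply: le_trans (Hfun_expR_ge sw); rewrite divr_ge0// sqr_ge0.
pose T1 := \sum_q v q * gm q; pose G1 := \sum_q v q * gh q; pose Z1 := \sum_q v q * gz q.
have T10 : 0 <= T1 by apply: sumr_ge0 => q _; rewrite mulr_ge0.
have Z10 : 0 <= Z1 by apply: sumr_ge0 => q _; rewrite mulr_ge0.
have G10 : 0 <= G1 by apply: sumr_ge0 => q _; rewrite mulr_ge0.
rewrite -/v -/G1 -/T1 in GE TE.
have T11 : 0 < T1 + 1 by rewrite ltr_wpDl.
have [cM cM0 [hM hM0 dense]] := region_weights mc cL L0 gm0 e4.
(* Half-width of the window in units of [mu]: the first bound protects the mean, the second keeps
   the extra cost in the exponent below [(g - G) * mu]. *)
pose a0 := Num.min (eps / 4) ((g - G) / s).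
have a00 : 0 < a0 by rewrite lt_min e4 /= divr_gt0// subr_gt0.
have a0e : a0 <= eps / 4 by rewrite ge_min lexx.
have T1e : T1 - eps / 2 <= T1 - eps / 4 - eps / 4 by lra.
have Ta0 : T - eps + a0 <= T1 - eps / 2 by lra.
have a0g : s * a0 <= g - G by rewrite mulrC -ler_pdivlMr// ge_min lexx orbT.
(* The last bound makes a region so light that dividing by [Z = 1 + S] lowers the mean by at most
   [eps / 4 * mu]. *)
pose h0 := Num.min 1 (Num.min hM (eps / 4 / (sigma * Z1 * T1 + 1))).
have ZT1 : 0 < sigma * Z1 * T1 + 1 by rewrite ltr_wpDl// !mulr_ge0// ltW.
have h00 : 0 < h0 by rewrite !lt_min ltr01 hM0 !divr_gt0.
(* Above this value of [mu] the condition [m *+ 2 <= (a0 * mu) ^+ 2] holds. *)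
exists (cM / 2), h0, (2 * (T1 + 1) / a0 ^+ 2); split => //.
  by rewrite divr_gt0.
move=> n r /andP [r0 rh] mu0.
have [r1 rM rZ] : [/\ r < 1, r < hM & r < eps / 4 / (sigma * Z1 * T1 + 1)].
  by move: rh; rewrite !lt_min => /andP [-> /andP [-> ->]].
have rd0 : 0 < r ^+ d by rewrite exprn_gt0.
have rd1 : r ^+ d <= r.
  by rewrite -{2}[r]expr1 ler_wiXn2l// ltW.
set mu := sigma * (n%:R * r ^+ d) in mu0 *.
have mu_ge0 : 0 <= mu by rewrite mulr_ge0 ?(ltW sg0)// mulr_ge0// ltW.
have mu_gt0 : 0 < mu.
  by apply: lt_le_trans mu0; rewrite !divr_gt0 ?exprn_gt0// mulr_gt0.
have rM' : 0 < r < hM by rewrite r0.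
have [M [y [cMh ty weights]]] := dense r rM'.
pose tau := (T - eps) * mu; pose q0 := expR (- (mu * g)) / 2.
have good j : (q0%:E <= P [set u | (tau <=
     \sum_(i < n) optw w (c (vscale r^-1 (vsub (X i u) (vsub (y j) (vscale r a))))))%R])%E.
  rewrite (region_transfer a mc r (y j) n w (fun z => tau <= z)) lee_fin.
  have ml := measurable_region_label a mc r (y j).
  have p0 k := plab_ge0 P X (region_label c a r (y j)) k.
  have p1 := plab_sum1 mX law_same ml.
  have [sum_ge sum_le] := weights j.
  set p := plab P X _ in p0 p1 sum_le sum_ge *.
  have ow01 k : 0 <= optw w k <= 1 by case: k => [q|] /=; rewrite ?lexx ?ler01.
  have aa : 0 < a0 * mu by rewrite mulr_gt0.
  have := @iidE_tilted_lower _ _ p n (optw w) s (a0 * mu) p0 p1 ow01 (ltW s0) aa.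
  set Z := \sum_k _; set W := \sum_k _; move=> /= H.
  pose S := \sum_q p (Some q) * gz q.
  have ZE : Z = 1 + S.
    rewrite -p1 /Z /S !sum_option /= mulr0 expR0 mulr1 -addrA; congr (_ + _).
    by rewrite -big_split; apply: eq_bigr => q _; rewrite /gz /=; ring.
  have WE : W = \sum_q p (Some q) * gm q.
    by rewrite /W sum_option /= mulr0 mul0r add0r; apply: eq_bigr => q _; rewrite mulrA.
  have S0 : 0 <= S by apply: sumr_ge0 => q _; rewrite mulr_ge0.
  have Sle : S <= sigma * r ^+ d * Z1 := sum_le _ gz0.
  have Wle : W <= sigma * r ^+ d * T1 by rewrite WE; exact: sum_le _ gm0.
  have Wge : sigma * r ^+ d * (T1 - eps / 4) <= W by rewrite WE; exact: sum_ge.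
  have Hle : s * W - S <= sigma * r ^+ d * G.
    apply: (@le_trans _ _ (sigma * r ^+ d * G1)); last first.
      by apply: ler_wpM2l GE; rewrite mulr_ge0// ltW.
    apply: le_trans (sum_le _ gh0); rewrite WE mulr_sumr -sumrB; apply: ler_sum => q _.
    by rewrite /gh HfunE /gm /gz le_eqVlt; apply/orP; left; apply/eqP; ring.
  have Z1' : 1 <= Z by rewrite ZE lerDl.
  have Z0 : 0 < Z by apply: lt_le_trans Z1'.
  set m := n%:R * (W / Z) in H.
  have nW_le : n%:R * W <= mu * T1.
    have -> : mu * T1 = n%:R * (sigma * r ^+ d * T1) by rewrite /mu; ring.
    by rewrite ler_wpM2l.
  have W0 : 0 <= W.
    by rewrite WE; apply: sumr_ge0 => q _; rewrite mulr_ge0.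
  have m_le : m <= mu * T1.
    apply: le_trans nW_le; rewrite /m ler_wpM2l// ler_pdivrMr//.
    by rewrite ler_peMr.
  have nW_ge : mu * (T1 - eps / 4) <= n%:R * W.
    have -> : mu * (T1 - eps / 4) = n%:R * (sigma * r ^+ d * (T1 - eps / 4)) by rewrite /mu; ring.
    by rewrite ler_wpM2l.
  have S_small : S * T1 <= eps / 4.
    apply: (@le_trans _ _ (r * (sigma * Z1 * T1 + 1))); last first.
      by rewrite -ler_pdivlMr// ltW.
    apply: (@le_trans _ _ (sigma * r ^+ d * Z1 * T1)); first by rewrite ler_wpM2r.
    have -> : sigma * r ^+ d * Z1 * T1 = r ^+ d * (sigma * Z1 * T1) by ring.
    apply: ler_pM => //; first exact: ltW.
    + by rewrite !mulr_ge0// ltW.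
    + by rewrite lerDl.
  have m_ge : mu * (T1 - eps / 2) <= m.
    have mE : m = n%:R * W - m * S by rewrite /m ZE; field; rewrite -ZE gt_eqF.
    have : m * S <= mu * (eps / 4).
      apply: (@le_trans _ _ (mu * T1 * S)); first by rewrite ler_wpM2r.
      by rewrite -mulrA ler_pM2l// mulrC.
    move=> mS; rewrite mE; apply: le_trans (lerB nW_ge mS).
    by rewrite -mulrBr ler_pM2l//.
  have cond : m *+ 2 <= (a0 * mu) ^+ 2.
    apply: (@le_trans _ _ (2 * (T1 + 1) * mu)).
      rewrite -mulr_natl -mulrA ler_pM2l// mulrDl [T1 * mu]mulrC mul1r.
      by apply: (le_trans m_le); rewrite lerDl.
    rewrite exprMn [mu ^+ 2]expr2 [leRHS]mulrA ler_pM2r//.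
    by move: mu0; rewrite ler_pdivrMr ?exprn_gt0// [mu * _]mulrC.
  apply: (@le_trans _ _ (Z ^+ n * expR (- (s * (m + a0 * mu))) / 2)).
    rewrite /q0 ler_pM2r ?invr_gt0//.
    (* From [expR (- (S / Z)) >= 1 - S / Z = Z^-1]. *)
    have Zn : expR (n%:R * (S / Z)) <= Z ^+ n.
      rewrite expRM_natl lerXn2r// ?nnegrE ?expR_ge0 ?(ltW Z0)//.
      rewrite -[leRHS]invrK -[expR _]invrK -expRN lef_pV2 ?posrE ?expR_gt0 ?invr_gt0//.
      apply: le_trans (expR_ge1Dx _); rewrite le_eqVlt; apply/orP; left; apply/eqP.
      by rewrite ZE; field; rewrite -ZE gt_eqF.
    apply: le_trans (ler_wpM2r (expR_ge0 _) Zn); rewrite -expRD ler_expR.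
    have -> : n%:R * (S / Z) - s * (m + a0 * mu) = - (n%:R * (s * W - S) / Z + s * a0 * mu).
      by rewrite /m; ring.
    rewrite lerN2; apply: (@le_trans _ _ (mu * G + s * a0 * mu)); last first.
      by rewrite [_ * a0 * mu]mulrC -mulrDr ler_pM2l// -lerBrDl.
    rewrite lerD2r ler_pdivrMr//; apply: (@le_trans _ _ (mu * G)).
      have -> : mu * G = n%:R * (sigma * r ^+ d * G) by rewrite /mu; ring.
      by rewrite ler_wpM2l.
    have G0 : 0 <= G by exact: le_trans GE.
    by rewrite ler_peMr// mulr_ge0.
  apply: (le_trans (H cond)); apply: le_iidE => // l _; rewrite ler_nat.
  suff : m - a0 * mu <= \sum_(k <- l) optw w k -> tau <= \sum_(k <- l) optw w k.
    by case: (_ <= _) => //= ->.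
  move=> h; apply: le_trans h; rewrite /tau lerBrDr; apply: le_trans m_ge.
  by rewrite -mulrDl [leLHS]mulrC ler_pM2l.
have [B [mB PB BQ]] := regions_fail mX law_same indep r0 ty mc cL w0 good.
exists B; split => //.
  apply: (le_trans PB); rewrite lee_fin ler_expR lerN2.
  have -> : cM / 2 / r ^+ d * expR (- (mu * g)) = cM / r ^+ d * q0.
    by rewrite /q0; field; rewrite gt_eqF.
  apply: ler_wpM2r; first by rewrite divr_ge0 ?expR_ge0.
  by rewrite ler_pdivrMr.
move=> u nB; have [j hj] := BQ u nB; apply: (le_trans hj).
exact: (rgg_chromatic_ge hnrm (fun i => X i u) n (vsub (y j) (vscale r a)) fw r0).
Qed.

(** A single region and a Chernoff lower tail suffice: the failure probability is summable once [mu]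
    dominates [ln n]. *)
Lemma mean_lower (phi : V -> R) (eps : R) : feasible nrm phi -> 0 < eps ->
  exists c h0 : R, [/\ 0 < c, 0 < h0 & forall n r, 0 < r < h0 ->
    exists B, [/\ measurable B,
      (P B <= (expR (- (c * (sigma * (n%:R * r ^+ d)))))%:E)%E &
      forall u, ~ B u ->
        ((\int[vol]_x phi x)%R - eps) * (sigma * (n%:R * r ^+ d)) <= (chi u n r)%:R]].
Proof.
move=> fphi eps0; have sg0 := sigma_gt0 hvol mf f0 fbdd fint.
have e4 : 0 < eps / 4 by rewrite divr_gt0.
have [C [c [w [a [L [[L0 mc cL w01] fw _ TE]]]]]] :=
  simple_approx hd hnrm hvol fphi (lexx 0) e4.
set T := (\int[vol]_x phi x)%R; set v := fun q => fine (vol [set y | c y = Some q]) in TE.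
have {TE} TE : T - eps / 4 <= \sum_q v q * w q.
  move: TE; rewrite /tilted_mean; under eq_Rintegral do rewrite mul0r expR0 mulr1.
  by under eq_bigr do rewrite mul0r expR0 mulr1.
have v0 q : 0 <= v q by exact: fine_ge0.
have w0 q : 0 <= w q by case/andP: (w01 q).
set T1 := \sum_q _ in TE; have T10 : 0 <= T1 by apply: sumr_ge0 => q _; rewrite mulr_ge0.
have T11 : 0 < T1 + 1 by rewrite ltr_wpDl.
have [cM cM0 [hM hM0 dense]] := region_weights mc cL L0 w0 e4.
pose s := Num.min 1 (eps / 4 / (T1 + 1)).
have s0 : 0 < s by rewrite lt_min ltr01 !divr_gt0.
have s1 : s <= 1 by rewrite ge_min lexx.
have sT : s * T1 <= eps / 4.
  apply: (@le_trans _ _ (s * (T1 + 1))); first by rewrite ler_pM2l// lerDl.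
  by rewrite -ler_pdivlMr// ge_min lexx orbT.
exists (s * (eps / 4)), hM; split => //; first by rewrite mulr_gt0.
move=> n r rh; have /andP [r0 _] := rh.
have [M [y [cMh _ weights]]] := dense r rh.
have rd0 : 0 < r ^+ d by rewrite exprn_gt0.
have M0 : (0 < M)%N.
  rewrite lt0n; apply/eqP => M0; move: cMh; rewrite M0 mul0r => h.
  by have := lt_le_trans cM0 h; rewrite ltxx.
set mu := sigma * (n%:R * r ^+ d).
have mu_ge0 : 0 <= mu by rewrite mulr_ge0 ?(ltW sg0)// mulr_ge0// ltW.
pose j := Ordinal M0; have [sum_ge _] := weights j.
pose tau := (T - eps) * mu; pose p := vsub (y j) (vscale r a).
pose X' u i := c (vscale r^-1 (vsub (X i u) p)).
have ml := measurable_region_label a mc r (y j).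
exists [set u | \sum_(i < n) optw w (X' u i) <= tau]; split; last first.
- move=> u /= /negP; rewrite -ltNge => h; apply: (le_trans (ltW h)).
  exact: (rgg_chromatic_ge hnrm (fun i => X i u) n p fw r0).
- rewrite (region_transfer a mc r (y j) n w (fun z => z <= tau)) lee_fin.
  have p0 k := plab_ge0 P X (region_label c a r (y j)) k.
  have p1 := plab_sum1 mX law_same ml.
  set q := plab P X _ in p0 p1 sum_ge *; rewrite -/v -/T1 in sum_ge.
  apply: (le_trans (@iidE_lower_tail _ _ q n (optw w) s tau p0 (ltW s0))).
  set W := \sum_k q (Some k) * w k in sum_ge.
  have W0 : 0 <= W by apply: sumr_ge0 => k _; rewrite mulr_ge0.
  have s2 : 0 <= s - s ^+ 2 by rewrite subr_ge0 expr2 ler_piMl// ltW.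
  have mgf : \sum_k q k * expR (- (s * optw w k)) <= expR (- ((s - s ^+ 2) * W)).
    apply: le_trans (expR_ge1Dx _); rewrite -p1 !sum_option /= mulr0 oppr0 expR0 mulr1.
    rewrite -addrA lerD2l -mulNr mulr_sumr -big_split /=; apply: ler_sum => k _.
    have -> : q (Some k) + - (s - s ^+ 2) * (q (Some k) * w k) =
      q (Some k) * (1 - s * w k + s ^+ 2 * w k) by ring.
    apply: ler_wpM2l => //; have sw : 0 <= s * w k by rewrite mulr_ge0// ltW.
    apply: (le_trans (expRN_le_quadratic sw)); rewrite lerD2l exprMn.
    rewrite ler_wpM2l ?sqr_ge0// expr2 ler_piMl//; by case/andP: (w01 k).
  apply: (@le_trans _ _ (expR (s * tau) * expR (- ((s - s ^+ 2) * W)) ^+ n)).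
    rewrite ler_wpM2l ?expR_ge0// lerXn2r ?nnegrE ?expR_ge0//.
    by apply: sumr_ge0 => k _; rewrite mulr_ge0 ?expR_ge0.
  rewrite -expRM_natl -expRD ler_expR.
  have : mu * ((s - s ^+ 2) * (T1 - eps / 4)) <= n%:R * ((s - s ^+ 2) * W).
    have -> : mu * ((s - s ^+ 2) * (T1 - eps / 4)) =
      n%:R * ((s - s ^+ 2) * (sigma * r ^+ d * (T1 - eps / 4))) by rewrite /mu; ring.
    by rewrite ler_wpM2l// ler_wpM2l.
  have : mu * (s * (T - eps - (1 - s) * (T1 - eps / 4) + eps / 4)) <= 0.
    rewrite mulr_ge0_le0// mulr_ge0_le0 ?(ltW s0)//.
    have : 0 <= s * (eps / 4) by rewrite mulr_ge0 ?(ltW s0)// ltW.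
    lra.
  rewrite /tau; lra.
- rewrite (_ : [set u | _] = [set u | (fun l => \sum_(k <- l) optw w k <= tau)
      [seq region_label c a r (y j) (X i u) | i <- iota 0 n]]).
    exact: (measurable_labels mX ml 0 n (fun l => \sum_(k <- l) optw w k <= tau)).
  by apply/seteqP; split => u; rewrite /= sum_labels.
Qed.

Lemma sum_unit (F : unit -> R) : \sum_q F q = F tt.
Proof. by rewrite (bigD1 tt)//= big1 ?addr0// => -[]. Qed.

(** The points in one small cube form a clique. A cube of mass [p <= 2^-1] holds exactly [k] points
    with probability at least [(n * p / k) ^+ k * expR (- (2 * n * p))], and many disjoint cubes are
    tried. *)
Lemma clique_lower : exists c h0 : R, [/\ 0 < c, 0 < h0 & forall n k r, 0 < r < h0 ->
    (0 < k <= n)%N -> exists B, [/\ measurable B,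
      (P B <= (expR (- (c / r ^+ d * (c * (n%:R * r ^+ d) / k%:R) ^+ k *
                       expR (- (n%:R * r ^+ d / c)))))%:E)%E &
      forall u, ~ B u -> (k <= chi u n r)%N]].
Proof.
have sg0 := sigma_gt0 hvol mf f0 fbdd fint.
pose L := (nrm_upper nrm)^-1; have L0 : 0 < L by rewrite invr_gt0 nrm_upper_gt0.
pose c (y : V) : option unit := if y \in cube vzero L then Some tt else None.
have cE y : c y = Some tt <-> cube vzero L y.
  rewrite /c; case: (boolP (y \in _)) => [/set_mem//|/negP h]; split => // /mem_set.
  by move/h.
have mc q : measurable [set y | c y = Some q].
  case: q; rewrite (_ : [set y | _] = cube vzero L); first exact: measurable_cube.
  by apply/seteqP; split => y /= /cE.
have cL y : c y != None -> cube vzero L y by case e : (c y) => [[]|//] _; exact/cE.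
pose w (q : unit) : R := 1; have w0 q : 0 <= w q by rewrite /w.
pose b := sigma * L ^+ d / 2; have Ld0 : 0 < L ^+ d by rewrite exprn_gt0.
have b0 : 0 < b by rewrite divr_gt0// mulr_gt0.
have L20 : 0 < L ^+ d / 2 by rewrite divr_gt0.
have [cM cM0 [hM hM0 dense]] := region_weights mc cL L0 w0 L20.
have vtt : fine (vol [set y | c y = Some tt]) = L ^+ d.
  rewrite (_ : [set y | _] = cube vzero L) ?vol_cube//.
  by apply/seteqP; split => y /= /cE.
(* One constant serves the number of regions, the base of the power and the exponential. *)
pose c1 := Num.min cM (Num.min b (4 * b)^-1).
have c10 : 0 < c1 by rewrite !lt_min cM0 b0 invr_gt0 mulr_gt0.
have [c1M c1b c1i] : [/\ c1 <= cM, c1 <= b & c1 <= (4 * b)^-1].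
  by rewrite /c1 !ge_min !lexx ?orbT.
pose h0 := Num.min 1 (Num.min hM (4 * b)^-1).
have h00 : 0 < h0 by rewrite !lt_min ltr01 hM0 invr_gt0 mulr_gt0.
exists c1, h0; split => // n k r /andP [r0 rh] /andP [k0 kn].
have [r1 rM rb] : [/\ r < 1, r < hM & r < (4 * b)^-1].
  by move: rh; rewrite !lt_min => /andP [-> /andP [-> ->]].
have rd0 : 0 < r ^+ d by rewrite exprn_gt0.
have rd1 : r ^+ d <= r by rewrite -{2}[r]expr1 ler_wiXn2l// ltW.
have k0R : 0 < k%:R :> R by rewrite ltr0n.
have n0R : 0 < n%:R :> R by rewrite ltr0n (leq_trans k0).
have rM' : 0 < r < hM by rewrite r0.
have half_vb : sigma * r ^+ d * (L ^+ d - L ^+ d / 2) = b * r ^+ d by rewrite /b; field.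
have two_vb : sigma * r ^+ d * L ^+ d = 2 * (b * r ^+ d) by rewrite /b; field.
have br : 2 * (b * r ^+ d) <= 2^-1.
  have -> : 2^-1 = 2 * 4^-1 :> R by field.
  by rewrite ler_pM2l// mulrC -ler_pdivlMr// -invfM; apply: (le_trans rd1); exact: ltW.
have [M [y [cMh ty weights]]] := dense r rM'.
pose q0 := (n%:R * (b * r ^+ d) / k%:R) ^+ k * expR (- (4 * (n%:R * (b * r ^+ d)))).
have good j : (q0%:E <= P [set u | (k%:R <=
     \sum_(i < n) optw w (c (vscale r^-1 (vsub (X i u) (vsub (y j) (vscale r vzero))))))%R])%E.
  rewrite (region_transfer vzero mc r (y j) n w (fun z => k%:R <= z)) lee_fin.
  have ml := measurable_region_label vzero mc r (y j).
  have p0 q := plab_ge0 P X (region_label c vzero r (y j)) q.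
  have p1 := plab_sum1 mX law_same ml.
  have [sum_ge sum_le] := weights j; have {}sum_le := sum_le _ w0.
  set p := plab P X _ in p0 p1 sum_ge sum_le *.
  rewrite !sum_unit vtt /w !mulr1 in sum_ge sum_le.
  set pt := p (Some tt) in sum_ge sum_le.
  have pge : b * r ^+ d <= pt by rewrite -half_vb.
  have ple : pt <= 2 * (b * r ^+ d) by rewrite -two_vb.
  have pt0 : 0 <= pt by exact: p0.
  apply: (@le_trans _ _ (iidE p n (fun l => (count (pred1 (Some tt)) l == k)%:R))); last first.
    apply: le_iidE => // l _; rewrite ler_nat; case: eqP => // <-.
    have -> : \sum_(j <- l) optw w j = (count (pred1 (Some tt)) l)%:R :> R.
      by elim: l => [|[[]|] l IH]; rewrite ?big_nil// big_cons IH /= ?natrD// add0r.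
    by rewrite lexx.
  rewrite iidE_binomial// big_pred1_eq -/pt.
  have E1 : (n%:R * (b * r ^+ d) / k%:R) ^+ k <= 'C(n, k)%:R * pt ^+ k.
    rewrite mulrAC exprMn; apply: ler_pM.
    - by rewrite exprn_ge0// divr_ge0// ltW.
    - by rewrite exprn_ge0// mulr_ge0 ?ltW.
    - rewrite expr_div_n ler_pdivrMr ?exprn_gt0// mulrC -!natrX -natrM ler_nat.
      exact: expn_le_binomial.
    - by rewrite lerXn2r// nnegrE// mulr_ge0// ltW.
  have E2 : expR (- (4 * (n%:R * (b * r ^+ d)))) <= (1 - pt) ^+ (n - k).
    have E3 := expRN_le_sub1 pt0 (le_trans ple br).
    have q10 : 0 <= 1 - pt := le_trans (expR_ge0 _) E3.
    apply: (@le_trans _ _ ((1 - pt) ^+ n)); last first.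
      by rewrite ler_wiXn2l// ?leq_subr// lerBlDr lerDl.
    apply: (@le_trans _ _ (expR (- (2 * pt)) ^+ n)); last first.
      by apply: lerXn2r; rewrite ?nnegrE ?expR_ge0.
    rewrite -expRM_natl ler_expR mulrN lerN2 mulrCA.
    have -> : 4 * (n%:R * (b * r ^+ d)) = 2 * (n%:R * (2 * (b * r ^+ d))) by ring.
    by rewrite ler_pM2l// ler_pM2l.
  by apply: ler_pM E1 E2; rewrite ?expR_ge0// exprn_ge0// divr_ge0 ?(ltW k0R)// !mulr_ge0 ?ltW.
have [B [mB PB BQ]] := regions_fail mX law_same indep r0 ty mc cL w0 good.
exists B; split => //.
  apply: (le_trans PB); rewrite lee_fin ler_expR lerN2 /q0 mulrA.
  have nr0 : 0 <= n%:R * r ^+ d by rewrite mulr_ge0 ?ltW.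
  apply: ler_pM; rewrite ?expR_ge0//.
  - apply: mulr_ge0; first by rewrite divr_ge0 ?(ltW c10)// ltW.
    by rewrite exprn_ge0// divr_ge0 ?(ltW k0R)// mulr_ge0// ltW.
  - apply: ler_pM.
    + by rewrite divr_ge0 ?ltW.
    + by rewrite exprn_ge0// divr_ge0 ?(ltW k0R)// mulr_ge0// ltW.
    + by rewrite ler_pdivrMr// (le_trans c1M).
    + rewrite lerXn2r ?nnegrE//.
      * by rewrite divr_ge0 ?(ltW k0R)// mulr_ge0// ltW.
      * by rewrite divr_ge0 ?(ltW k0R)// mulr_ge0 ?(ltW n0R)// mulr_ge0 ?ltW.
      rewrite ler_pM2r ?invr_gt0// mulrCA ler_wpM2l ?(ltW n0R)//.
      by rewrite ler_wpM2r ?(ltW rd0).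
  - rewrite ler_expR lerN2.
    have -> : 4 * (n%:R * (b * r ^+ d)) = n%:R * r ^+ d * (4 * b) by ring.
    rewrite ler_wpM2l// -[leLHS]invrK lef_pV2 ?posrE// invr_gt0 mulr_gt0//.
move=> u nB; have [j hj] := BQ u nB.
rewrite -(ler_nat R); apply: (le_trans hj).
have fc : feasible nrm (fun y => optw w (c y)).
  rewrite (_ : (fun y => _) = (fun y => 1 * \1_(cube vzero L) y)); first exact: small_cube_feasible.
  by apply/funext => z; rewrite mul1r indicE /c; case: (z \in _).
exact: (rgg_chromatic_ge hnrm (fun i => X i u) n (vsub (y j) (vscale r vzero)) fc r0).
Qed.

End Lower.

(** * Almost sure asymptotics *)

Section Helpers.
Context {R : realType}.

Lemma root_exists (d : nat) (v : R) : (0 < d)%N -> 0 < v -> exists2 x, 0 < x & x ^+ d = v.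
Proof.
move=> d0 v0; exists (v `^ d%:R^-1); first exact: powR_gt0.
rewrite -powR_mulrn ?powR_ge0// -powRrM mulVf ?powRr1 ?ltW//.
by rewrite pnatr_eq0 -lt0n.
Qed.

Lemma ln_ge_near (A : R) : \forall n \near \oo, A <= ln (n%:R : R).
Proof.
near=> n; have h : expR A <= n%:R by near: n; exact: nbhs_infty_ger.
by rewrite -(expRK A) ler_ln ?posrE ?expR_gt0// (lt_le_trans (expR_gt0 A)).
Unshelve. all: by end_near. Qed.

Lemma sqr_ln_le_near (al A : R) : 0 < al ->
  \forall n \near \oo, A * ln (n%:R : R) ^+ 2 <= expR (al * ln (n%:R : R)).
Proof.
move=> al0; near=> n.
have x0 : 0 <= ln (n%:R : R) by near: n; exact: ln_ge_near.
have xA : 6 * A / al ^+ 3 <= ln (n%:R : R) by near: n; exact: ln_ge_near.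
set x := ln _ in x0 xA *.
have ax0 : 0 <= al * x by rewrite mulr_ge0// ltW.
apply: le_trans (expR_ge1Dxn 2 ax0); rewrite exprMn -[(2.+1)`!]/(6%N).
have : 6 * A * x ^+ 2 <= al ^+ 3 * x * x ^+ 2.
  by apply: ler_wpM2r; [rewrite sqr_ge0|rewrite [leRHS]mulrC -ler_pdivrMr ?exprn_gt0].
have -> : al ^+ 3 * x * x ^+ 2 = al ^+ 3 * x ^+ 3 by ring.
by set y := al ^+ 3 * x ^+ 3; set z := A * _; rewrite -mulrA -/z; lra.
Unshelve. all: by end_near. Qed.

Lemma expR_ln_natM (k : nat) (n : nat) : (0 < n)%N ->
  expR (k%:R * ln (n%:R : R)) = n%:R ^+ k.
Proof. by move=> n0; rewrite expRM_natl lnK// posrE ltr0n. Qed.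

Context {dO : measure_display} {Omega : measurableType dO}.
Variable P : probability Omega R.

Lemma ae_near (Q : nat -> Omega -> Prop) (c : R) : 0 <= c ->
  (\forall n \near \oo, exists B, [/\ measurable B,
     (P B <= (c * expR (- (2 * ln (n%:R : R))))%:E)%E & forall w, ~ B w -> Q n w]) ->
  {ae P, forall w, \forall n \near \oo, Q n w}.
Proof.
move=> c0 [n0 _ H]; apply: (@ae_eventually _ _ _ P Q (c * 4) n0.+1) => n nn0.
have [B [mB PB BQ]] := H n (ltnW nn0).
exists B; split => //; apply: (le_trans PB); rewrite lee_fin -mulrA ler_wpM2l//.
have n1 : (0 < n)%N by exact: leq_ltn_trans nn0.
have nR : 1 <= n%:R :> R by rewrite ler1n.
rewrite expRN -[2]/(2%:R) expR_ln_natM// -[_ ^-1]mul1r ler_pdivrMr ?exprn_gt0 ?ltr0n//.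
rewrite mulrAC ler_pdivlMr ?exprn_gt0 ?ltr0n// mul1r -natr1.
have : 0 <= (n%:R - 1) * (3 * n%:R + 1 : R) by rewrite mulr_ge0 ?subr_ge0//; lra.
lra.
Qed.

(** The tolerances [m.+1%:R^-1] suffice, so only countably many null sets are discarded. *)
Lemma ae_ratio_cvg (x : nat -> Omega -> R) (y : nat -> R) (l : R) :
  (\forall n \near \oo, 0 < y n) ->
  (forall e, 0 < e -> {ae P, forall w, \forall n \near \oo, x n w <= (l + e) * y n}) ->
  (forall e, 0 < e -> {ae P, forall w, \forall n \near \oo, (l - e) * y n <= x n w}) ->
  {ae P, forall w, x n w / y n @[n --> \oo] --> l}.
Proof.
move=> y0 up lo.
have m0 (m : nat) : 0 < m.+1%:R^-1 :> R by rewrite invr_gt0 ltr0n.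
have := ae_foralln (fun m => up _ (m0 m)); apply: filterS2 (ae_foralln (fun m => lo _ (m0 m))).
move=> w lw uw; apply/cvgrPdist_le => e e0.
have [m me] : exists m : nat, m.+1%:R^-1 <= e.
  exists (Num.truncn e^-1); rewrite -[leRHS]invrK lef_pV2 ?posrE ?invr_gt0//.
  have ei : 0 <= e^-1 by rewrite invr_ge0 ltW.
  by have /andP [_ /ltW] := truncn_itv ei.
near=> n; have yn : 0 < y n by near: n.
have h1 : x n w <= (l + m.+1%:R^-1) * y n by near: n; exact: uw m.
have h2 : (l - m.+1%:R^-1) * y n <= x n w by near: n; exact: lw m.
rewrite distrC ler_distl; apply/andP; split.
  by rewrite ler_pdivlMr//; apply: le_trans h2; rewrite ler_pM2r// lerD2l lerN2.
by rewrite ler_pdivrMr//; apply: (le_trans h1); rewrite ler_pM2r// lerD2l.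
Unshelve. all: by end_near. Qed.

End Helpers.

Lemma quartic_le (R : realType) (k : R) : 0 < k -> k <= 2^-1 ->
  (1 + k) ^+ 4 <= (1 + 32 * k) * (1 - k).
Proof.
move=> k0 k12.
have k2 : k ^+ 2 <= k / 2 by rewrite expr2 ler_pM2l.
have k3 : k ^+ 3 <= k / 4.
  rewrite exprS; apply: (@le_trans _ _ (k * (k / 2))); first by rewrite ler_pM2l.
  lra.
have k4 : k ^+ 4 <= k / 8.
  rewrite exprS; apply: (@le_trans _ _ (k * (k / 4))); first by rewrite ler_pM2l.
  lra.
have -> : (1 + k) ^+ 4 = 1 + 4 * k + 6 * k ^+ 2 + 4 * k ^+ 3 + k ^+ 4 by ring.
have -> : (1 + 32 * k) * (1 - k) = 1 + 31 * k - 32 * k ^+ 2 by ring.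
lra.
Qed.

Section Blocks.
Context {R : realType} {dO : measure_display} {Omega : measurableType dO}.
Variable P : probability Omega R.

(* A property of the [n]-th graph is derived from one event per block
   [j ^ a <= n < (j + 1) ^ a]: a large [a] turns a small polynomial decay of the
   probabilities into a summable one, while consecutive blocks keep a ratio tending to 1. *)
Lemma ae_blocks (a : nat) (Q Q' : nat -> Omega -> Prop) : (0 < a)%N ->
  {ae P, forall w, \forall j \near \oo, Q j w} ->
  (exists J, forall j n w, (J <= j)%N -> (j ^ a <= n < j.+1 ^ a)%N -> Q j w -> Q' n w) ->
  {ae P, forall w, \forall n \near \oo, Q' n w}.
Proof.
move=> a0 aeQ [J HJ]; apply: filterS aeQ => w [j0 _ Hj0].
exists (maxn (maxn j0 J) 1 ^ a)%N => // n /= jn.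
set j1 := maxn (maxn j0 J) 1 in jn.
have ex : exists j, (j ^ a <= n)%N by exists j1.
have bound j : (j ^ a <= n)%N -> (j <= n)%N.
  by move=> h; apply: leq_trans h; case: j => // j; rewrite -{1}[j.+1]expn1 leq_pexp2l.
pose j := ex_maxn ex bound.
have [jn' jmax] : (j ^ a <= n)%N /\ forall i, (i ^ a <= n)%N -> (i <= j)%N.
  by rewrite /j; case: ex_maxnP.
have j1j : (j1 <= j)%N by exact: jmax.
apply: (HJ j); last by apply: Hj0; rewrite /= (leq_trans _ j1j)// /j1 !leq_max leqnn.
  by rewrite (leq_trans _ j1j)// /j1 !leq_max leqnn !orbT.
by rewrite jn' ltnNge; apply/negP => /jmax; rewrite ltnn.
Qed.

Lemma block_ratio (a : nat) (k : R) : 0 < k ->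
  \forall j \near \oo, (j.+1 ^ a)%:R <= (1 + k) * (j ^ a)%:R :> R.
Proof.
move=> k0; have l0 : 0 < ln (1 + k) by rewrite ln_gt0// ltrDl.
near=> j; have j0 : 0 < j%:R :> R by rewrite ltr0n; near: j; exact: nbhs_infty_gt.
have aj : a%:R / ln (1 + k) <= j%:R by near: j; exact: nbhs_infty_ger.
rewrite !natrX -ler_pdivrMr ?exprn_gt0// -expr_div_n.
apply: (@le_trans _ _ (expR j%:R^-1 ^+ a)).
  apply: lerXn2r; rewrite ?nnegrE ?expR_ge0 ?divr_ge0//.
  by apply: le_trans (expR_ge1Dx _); rewrite -natr1 mulrDl divff ?gt_eqF// mul1r.
rewrite -expRM_natl -[leRHS](lnK (x := 1 + k)) ?posrE ?addr_gt0// ler_expR.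
by rewrite ler_pdivrMr// mulrC -ler_pdivrMr.
Unshelve. all: by end_near. Qed.

End Blocks.

Lemma expR_ratio (R : realType) (k : nat) (a p y : R) : 0 < a -> p = expR (- y) ->
  a / p * p ^+ k = expR (ln a + y - k%:R * y).
Proof.
by move=> a0 ->; rewrite !expRD lnK ?posrE// -expRN opprK -expRM_natl mulrN.
Qed.

Lemma sparse_exponent_ge (R : realType) (alpha k x y : R) : alpha * x <= y ->
  (k - 2^-1) * y <= x -> alpha / 2 * x <= x + y - k * y.
Proof. lra. Qed.

Section Asymptotics.
Context {R : realType} {d : nat}.
Notation V := (d.-tuple R).
Hypothesis hd : (0 < d)%N.
Variable nrm : V -> R.
Hypothesis hnrm : is_norm nrm.
Variable vol : {measure set V -> \bar R}.
Hypothesis hvol : is_lebesgue vol.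
Variable f : V -> R.
Hypothesis mf : measurable_fun setT f.
Hypothesis f0 : forall x, 0 <= f x.
Hypothesis fbdd : exists M : R, forall x, f x <= M.
Hypothesis fint : (\int[vol]_x (f x)%:E = 1)%E.
Context {dO : measure_display} {Omega : measurableType dO}.
Variables (P : probability Omega R) (X : nat -> Omega -> V).
Hypothesis mX : forall i, measurable_fun setT (X i).
Hypothesis hlaw : forall i (A : set V), measurable A ->
  P (X i @^-1` A) = (\int[vol]_(x in A) (f x)%:E)%E.
Hypothesis indep : mutually_independent P X.
Variable r : nat -> R.
Hypothesis r0 : forall n, 0 < r n.
Hypothesis rlim : r n @[n --> \oo] --> 0.

Notation sigma := (ess_sup_density vol f).
Notation nrd n := (n%:R * r n ^+ d).
Notation mu n := (sigma * (n%:R * r n ^+ d)).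
Notation chi w n := (chromatic n (rgg_adj nrm (fun i => X i w) (r n) n)).
Notation L n := (ln (n%:R : R)).

Let sg0 : 0 < sigma := sigma_gt0 hvol mf f0 fbdd fint.

Lemma r_lt_near h : 0 < h -> \forall n \near \oo, 0 < r n < h.
Proof.
move=> h0; near=> n; rewrite r0 /=; near: n.
exact: cvgr_lt rlim _ h0.
Unshelve. all: by end_near. Qed.

(** * Dense regime *)

Section Dense.
Hypothesis dense : L n / nrd n @[n --> \oo] --> 0.

Lemma dense_ln_le A : 0 <= A -> \forall n \near \oo, A * L n <= mu n.
Proof.
move=> A0; have A1 : 0 < sigma / (A + 1) by rewrite divr_gt0// ltr_wpDl.
near=> n.
have n0 : 0 < nrd n by rewrite mulr_gt0 ?exprn_gt0// ltr0n; near: n; exact: nbhs_infty_gt.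
have Ln : 0 <= L n by near: n; exact: ln_ge_near.
have : L n / nrd n < sigma / (A + 1) by near: n; exact: cvgr_lt dense _ A1.
rewrite ltr_pdivrMr// mulrAC ltr_pdivlMr ?ltr_wpDl// => h.
by apply: le_trans (ltW h); rewrite mulrC ler_wpM2l// lerDl.
Unshelve. all: by end_near. Qed.

(** Choose [t] with [f_chi] at [t] near its limit. The failure probability, of order
    [n * expR (- (mu n / t))], is summable because [mu n] eventually exceeds [3 * t * ln n]. *)
Lemma dense_upper e : 0 < e -> {ae P, forall w, \forall n \near \oo,
  (chi w n)%:R <= (max_int nrm vol + e) * mu n}.
Proof.
move=> e0; have M0 := max_int_gt0 hnrm hd hvol.
have [t [t0 ft]] : exists t, 0 < t /\ fine (f_chi vol nrm t) <= max_int nrm vol + e / 4.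
  have /fine_cvg cv := fchi_cvg_pinfty hnrm hd hvol.
  have lt : max_int nrm vol < max_int nrm vol + e / 4 by rewrite ltrDl divr_gt0.
  have /filter_ex [t [t0 ft]] : \forall t \near +oo, 0 < t /\
      fine (f_chi vol nrm t) < max_int nrm vol + e / 4.
    by near=> t; split; near: t; [exact: nbhs_pinfty_gt|exact: cvgr_lt cv _ lt].
  by exists t; split => //; exact: ltW.
set M := max_int nrm vol in M0 ft *.
pose k := e / 4 / (M + e / 4).
have k0 : 0 < k by rewrite !divr_gt0// addr_gt0// divr_gt0.
have [D [n1 H]] := lp_upper hd hnrm hvol mX (law_same hlaw) indep sg0
  (law_le hvol mf f0 fbdd fint hlaw) k0 t0.
apply: (@ae_near _ _ _ P _ (Num.max D 0)); first by rewrite le_max lexx orbT.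
near=> n.
have n0 : (0 < n)%N by near: n; exact: nbhs_infty_gt.
have Ln : 1 <= L n by near: n; exact: ln_ge_near.
have [B [mB PB BQ]] := H n (r n) n0 (r0 n).
exists B; split => //.
  apply: (le_trans PB); rewrite lee_fin -mulrA -{1}(lnK (x := n%:R)) ?posrE ?ltr0n// -expRD.
  set E := expR _; apply: (@le_trans _ _ (Num.max D 0 * E)).
    by rewrite ler_wpM2r ?expR_ge0// le_max lexx.
  apply: ler_wpM2l; first by rewrite le_max lexx orbT.
  have h : 3 * t * L n <= mu n by near: n; apply: dense_ln_le; rewrite mulr_ge0// ltW.
  have : 3 * L n <= mu n / t by rewrite ler_pdivlMr// mulrAC.
  by rewrite /E ler_expR; lra.
move=> w nB; apply: (le_trans (BQ w nB n (r n) (leqnn n) (lexx _))).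
have n1_le : n1 <= e / 2 * mu n.
  apply: (@le_trans _ _ `|n1|); first exact: ler_norm.
  rewrite -ler_pdivrMl ?divr_gt0//; apply: (@le_trans _ _ ((e / 2)^-1 * `|n1| * L n)).
    by rewrite ler_peMr// mulr_ge0// invr_ge0 divr_ge0// ltW.
  by near: n; apply: dense_ln_le; rewrite mulr_ge0// invr_ge0 divr_ge0// ltW.
have mu0 : 0 < mu n by rewrite mulr_gt0// mulr_gt0 ?exprn_gt0// ltr0n.
have : (1 + k) * mu n * fine (f_chi vol nrm t) <= (1 + k) * mu n * (M + e / 4).
  by rewrite ler_wpM2l// mulr_ge0// ?ltW// addr_gt0.
have -> : (1 + k) * mu n * (M + e / 4) = (M + e / 2) * mu n.
  by rewrite /k; field; rewrite gt_eqF//; lra.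
lra.
Unshelve. all: by end_near. Qed.

Lemma dense_lower e : 0 < e -> {ae P, forall w, \forall n \near \oo,
  (max_int nrm vol - e) * mu n <= (chi w n)%:R}.
Proof.
move=> e0; have e2 : 0 < e / 2 by rewrite divr_gt0.
have [phi fphi Iphi] := max_int_approx hnrm hd hvol e2.
have [c [h [c0 h0 H]]] := mean_lower hd hnrm hvol mf f0 fbdd fint mX hlaw indep fphi e2.
apply: (@ae_near _ _ _ P _ 1) => //.
near=> n.
have rn : 0 < r n < h by near: n; exact: r_lt_near.
have [B [mB PB BQ]] := H n (r n) rn.
exists B; split => //.
  apply: (le_trans PB); rewrite lee_fin mul1r ler_expR lerN2.
  rewrite -ler_pdivrMl// mulrA; near: n; apply: dense_ln_le.
  by rewrite mulr_ge0// invr_ge0 ltW.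
move=> w nB; apply: le_trans (BQ w nB); apply: ler_wpM2r; last by lra.
by rewrite mulr_ge0 ?(ltW sg0)// mulr_ge0// exprn_ge0// ltW.
Unshelve. all: by end_near. Qed.

End Dense.

(** * Logarithmic regime *)

Section Logarithmic.
Variable t : R.
Hypothesis t0 : 0 < t.
Hypothesis mulim : mu n / L n @[n --> \oo] --> t.

Lemma log_near e : 0 < e -> \forall n \near \oo, (t - e) * L n <= mu n <= (t + e) * L n.
Proof.
move=> e0; near=> n.
have Ln : 0 < L n by apply: (lt_le_trans ltr01); near: n; exact: ln_ge_near.
have : `|t - mu n / L n| <= e by near: n; move/cvgrPdist_le : mulim; exact.
rewrite distrC ler_distl ler_pdivlMr// ler_pdivrMr//.
Unshelve. all: by end_near. Qed.

(** A tilt of entropy slightly below [t^-1] succeeds in a region with probability about [n] to the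
    power [- (t * g)], where [t * g < 1], and there are of order [n / ln n] regions. *)
Lemma log_lower e : 0 < e -> {ae P, forall w, \forall n \near \oo,
  (fine (f_chi vol nrm t) - e) * mu n <= (chi w n)%:R}.
Proof.
move=> e0; set F := fine (f_chi vol nrm t).
have mu_ge0 n : 0 <= mu n by rewrite mulr_ge0 ?(ltW sg0)// mulr_ge0// exprn_ge0// ltW.
have [Fe|eF] := lerP F e.
  apply: aeW => w; apply: nearW => n; apply: (@le_trans _ _ 0) => //.
  by rewrite mulr_le0_ge0// subr_le0.
have F0 : 0 < F by exact: lt_trans eF.
have F1 : 0 < 4 * (F + 1) by rewrite mulr_gt0// addr_gt0.
(* Close enough to 1 for [fchi_scale] to lose at most [e / 4] between [t] and [t * l]. *)
pose l := 1 + e / (4 * (F + 1)).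
have l1 : 1 < l by rewrite ltrDl divr_gt0.
have l0 : 0 < l by exact: lt_trans l1.
have tl0 : 0 < t * l by rewrite mulr_gt0.
have ffin u : 0 < u -> f_chi vol nrm u \is a fin_num.
  by move=> u0; exact: (fchi_fin_num hnrm hd hvol u0).
have Fl : F - e / 4 <= fine (f_chi vol nrm (t * l)).
  have := fchi_scale hnrm hd hvol tl0 (ltW l1).
  have tll : t * l / l = t by rewrite mulfK// gt_eqF.
  rewrite tll; set G := fine (f_chi vol nrm (t * l)).
  have FE : f_chi vol nrm t = F%:E by rewrite /F fineK// ffin.
  have GE : f_chi vol nrm (t * l) = G%:E by rewrite /G fineK// ffin.
  rewrite FE GE -EFinM lee_fin lerBlDr => h.
  have [FG|GF] := lerP F G; first by rewrite (le_trans FG)// lerDl divr_ge0// ltW.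
  apply: (le_trans h); rewrite /l mulrDl mul1r lerD2l mulrAC ler_pdivrMr//.
  have : e * G <= e * (F + 1) by rewrite ler_pM2l//; lra.
  lra.
have [phi fphi xphi] : exists2 phi, feasible nrm phi &
    (((fine (f_chi vol nrm (t * l)) - e / 4)%:E < xi vol phi (t * l))%E).
  have : ((fine (f_chi vol nrm (t * l)) - e / 4)%:E < f_chi vol nrm (t * l))%E.
    have GE := fineK (ffin _ tl0).
    by rewrite -[ltRHS]GE lte_fin gtrBl divr_gt0.
  by move=> /ereal_sup_gt [_ [phi fphi <-] h]; exists phi.
have mphi := feasible_measurable fphi; have phi01 := feasible_01 fphi.
have Iphi := feasible_integrable hnrm hd hvol fphi.
have I0 : 0 < (\int[vol]_x phi x)%R.
  rewrite lt_neqAle Rintegral_ge0 ?andbT; last by move=> x _; exact: feasible_ge0 fphi x.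
  apply/negP => /eqP/esym I0; move: xphi; rewrite xi_int0// lte_fin; lra.
have [s s0 [Gs Ts]] := xi_spec mphi phi01 Iphi I0 tl0.
rewrite {}Ts lte_fin in xphi.
pose g := (t^-1 + (t * l)^-1) / 2.
have tti : (t * l)^-1 < t^-1 by rewrite ltf_pV2 ?posrE// ltr_pMr.
have Gg : tilted_entropy vol phi s < g by rewrite Gs /g; lra.
have e2 : 0 < e / 2 by rewrite divr_gt0.
have [c [h [m0 [c0 h0 H]]]] := tilt_lower hd hnrm hvol mf f0 fbdd fint mX hlaw indep fphi s0 e2 Gg.
have g0 : 0 < g by rewrite divr_gt0// addr_gt0// invr_gt0.
have tg : t * g < 1 by rewrite -ltr_pdivlMl// mulr1 /g; lra.
pose de := (1 - t * g) / 2; have de0 : 0 < de by rewrite divr_gt0// subr_gt0.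
have tde : t * g + de <= 1 - de by rewrite /de; lra.
have tt2 : t - t / 2 = t / 2 by field.
apply: (@ae_near _ _ _ P _ 1) => //.
near=> n.
have n0 : (0 < n)%N by near: n; exact: nbhs_infty_gt.
have nR : 0 < n%:R :> R by rewrite ltr0n.
have rn : 0 < r n < h by near: n; exact: r_lt_near.
have Ln : 0 < L n by apply: (lt_le_trans ltr01); near: n; exact: ln_ge_near.
have h1 : (t - t / 2) * L n <= mu n <= (t + t / 2) * L n.
  by near: n; apply: log_near; rewrite divr_gt0.
have h2 : (t - de / g) * L n <= mu n <= (t + de / g) * L n.
  by near: n; apply: log_near; rewrite divr_gt0.
have Lm0 : m0 / (t / 2) <= L n by near: n; exact: ln_ge_near.
have m0mu : m0 <= mu n.
  case/andP: h1 => h1 _; apply: le_trans h1.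
  by rewrite tt2 mulrC -ler_pdivrMr ?divr_gt0.
have [B [mB PB BQ]] := H n (r n) rn m0mu.
exists B; split => //; last first.
  by move=> w nB; apply: le_trans (BQ w nB); apply: ler_wpM2r => //; lra.
apply: (le_trans PB); rewrite lee_fin mul1r ler_expR lerN2.
have mug : mu n * g <= (1 - de) * L n.
  case/andP: h2 => _ h2; apply: (@le_trans _ _ ((t + de / g) * L n * g)).
    by rewrite ler_pM2r.
  by rewrite mulrAC mulrDl divfK ?gt_eqF// ler_pM2r.
have mu0 : 0 < mu n by rewrite mulr_gt0// mulr_gt0// exprn_gt0.
have rd0 : 0 < r n ^+ d by rewrite exprn_gt0.
apply: (@le_trans _ _ (c * sigma * n%:R / mu n * expR (- ((1 - de) * L n)))); last first.
  have -> : c * sigma * n%:R / mu n = c / r n ^+ d by field; rewrite !gt_eqF.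
  by apply: ler_wpM2l; [rewrite divr_ge0 ?(ltW rd0)// ltW|rewrite ler_expR lerN2].
have -> : c * sigma * n%:R / mu n * expR (- ((1 - de) * L n)) =
    c * sigma / mu n * expR (de * L n).
  have -> : expR (de * L n) = n%:R * expR (- ((1 - de) * L n)).
    by rewrite -{2}[n%:R](lnK (x := n%:R)) ?posrE// -expRD; congr expR; ring.
  by rewrite [_ * n%:R / _]mulrAC [RHS]mulrA.
rewrite mulrAC ler_pdivlMr//.
have hA : 2 * (3 / 2 * t) / (c * sigma) * L n ^+ 2 <= expR (de * L n).
  by near: n; exact: sqr_ln_le_near.
apply: (@le_trans _ _ (c * sigma * (2 * (3 / 2 * t) / (c * sigma) * L n ^+ 2))); last first.
  by rewrite ler_pM2l// mulr_gt0.
have -> : c * sigma * (2 * (3 / 2 * t) / (c * sigma) * L n ^+ 2) =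
    2 * L n * ((t + t / 2) * L n) by field; rewrite !gt_eqF.
by case/andP: h1 => _ h1; rewrite ler_wpM2l// mulr_ge0// ltW.
Unshelve. all: by end_near. Qed.

End Logarithmic.

(** With [u = t * (1 + k)] the failure probability at the end [N j] of a block is of order [N j] to
    the power [- k], that is [j.+1] to the power [- (a * k)]; [a * k >= 2] makes it summable. *)
Lemma log_upper (t e : R) : 0 < t -> mu n / L n @[n --> \oo] --> t -> 0 < e ->
  {ae P, forall w, \forall n \near \oo, (chi w n)%:R <= (fine (f_chi vol nrm t) + e) * mu n}.
Proof.
move=> t0 mulim e0; set F := fine (f_chi vol nrm t).
have ffin u : 0 < u -> f_chi vol nrm u \is a fin_num.
  by move=> u0; exact: (fchi_fin_num hnrm hd hvol u0).
have F0 : 0 < F.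
  apply: (lt_le_trans (max_int_gt0 hnrm hd hvol)).
  by rewrite -lee_fin fineK ?fchi_ge_max_int ?ffin.
pose k := Num.min 2^-1 (e / (64 * F)).
have k0 : 0 < k by rewrite lt_min invr_gt0 ltr0n /= divr_gt0// mulr_gt0.
have k12 : k <= 2^-1 by rewrite ge_min lexx.
have kF : 64 * k * F <= e.
  by rewrite -mulrA mulrCA -ler_pdivlMr ?mulr_gt0// ge_min lexx orbT.
have k1 : 0 < 1 + k by rewrite addr_gt0.
pose u := t * (1 + k); have u0 : 0 < u by rewrite mulr_gt0.
have tu : t <= u by rewrite ler_peMr ?(ltW t0)// lerDl ltW.
have fu : fine (f_chi vol nrm u) <= F.
  exact: fine_le (ffin _ u0) (ffin _ t0) (fchi_anti hnrm hd hvol t0 tu).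
have [D [n1 H]] := lp_upper hd hnrm hvol mX (law_same hlaw) indep sg0
  (law_le hvol mf f0 fbdd fint hlaw) k0 u0.
pose a := (Num.truncn (2 / k)).+1.
have ak : 2 <= a%:R * k.
  have k2 : 0 <= 2 / k by rewrite divr_ge0// ltW.
  by have /andP [_ /ltW] := truncn_itv k2; rewrite ler_pdivrMr.
pose t' := t * (1 + k) ^+ 2.
have t'0 : 0 < t' by rewrite mulr_gt0// exprn_gt0.
pose N j := (j.+1 ^ a)%N.
have N0 j : (0 < N j)%N by rewrite expn_gt0.
(* Covers every radius that can occur in the block. The two factors [1 + k] in [t'] pay for the
   ratio of the ends of the block and for the deviation of [mu n / L n] from [t]. *)
pose Q j w := forall n r', (n <= N j)%N -> 0 <= r' -> sigma * (N j)%:R * r' ^+ d <= t' * L (N j) ->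
  (chromatic n (rgg_adj nrm (fun i => X i w) r' n))%:R <= (1 + k) * (t' * L (N j)) * F + n1.
apply: (@ae_blocks _ _ _ P a Q) => //.
  apply: (@ae_eventually _ _ _ P Q (Num.max D 0) 1) => j j1.
  have NR : 0 < (N j)%:R :> R by rewrite ltr0n.
  have LN : 0 < L (N j).
    by rewrite ln_gt0// ltr1n -(exp1n a) ltn_exp2r//.
  have v0 : 0 < t' * L (N j) / (sigma * (N j)%:R) by rewrite divr_gt0// mulr_gt0.
  have [rho rho0 rhod] := root_exists hd v0.
  have [B [mB PB BQ]] := H (N j) rho (N0 j) rho0.
  have muE : sigma * ((N j)%:R * rho ^+ d) = t' * L (N j).
    by rewrite rhod; field; rewrite !gt_eqF.
  rewrite muE in PB BQ; exists B; split => //.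
    apply: (le_trans PB); rewrite lee_fin.
    set E := expR _; apply: (@le_trans _ _ (Num.max D 0 * ((N j)%:R * E))).
      by rewrite -mulrA ler_wpM2r ?le_max ?lexx// mulr_ge0 ?expR_ge0.
    apply: ler_wpM2l; first by rewrite le_max lexx orbT.
    rewrite -{1}(lnK (x := (N j)%:R)) ?posrE// /E -expRD.
    have j0 : 0 < j.+1%:R :> R by rewrite ltr0n.
    have -> : j.+1%:R ^- 2 = expR (- (2%:R * L j.+1)) by rewrite expRN expR_ln_natM.
    rewrite ler_expR; have -> : t' * L (N j) / u = (1 + k) * L (N j).
      by rewrite /t' /u; field; rewrite !gt_eqF.
    have -> : L (N j) = a%:R * L j.+1 by rewrite natrX lnXn// mulr_natl.
    have : 2 * L j.+1 <= a%:R * k * L j.+1 by rewrite ler_wpM2r// ln_ge0// ler1n.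
    lra.
  move=> w nB n r' nN r'0 h; have rr : r' <= rho.
    rewrite -(ler_pXn2r hd) ?nnegrE ?(ltW rho0)// rhod ler_pdivlMr; last by rewrite mulr_gt0.
    by rewrite mulrC.
  apply: (le_trans (BQ w nB n r' nN rr)); rewrite lerD2r ler_wpM2l//.
  by rewrite !mulr_ge0// ltW.
have [J _ HJ] : \forall j \near \oo, forall n, (j ^ a <= n < j.+1 ^ a)%N ->
   [/\ 0 < L n, (N j)%:R <= (1 + k) * n%:R, L (N j) <= (1 + k) * L n,
    (t - t * k) * L n <= mu n <= (t + t * k) * L n & n1 <= e / 2 * mu n].
  have [n0 _ Hn] : \forall n \near \oo, [/\ 1 <= L n,
      (t - t * k) * L n <= mu n <= (t + t * k) * L n & 4 * `|n1| / (e * t) <= L n].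
    near=> n; split; near: n; try exact: ln_ge_near.
    by apply: log_near => //; exact: mulr_gt0.
  near=> j => n /andP [jn nj].
  have j0n : (n0 <= n)%N.
    apply: leq_trans jn; apply: (@leq_trans j); first by near: j; exact: nbhs_infty_ge.
    by case: (j) => // i; rewrite -{1}[i.+1]expn1 leq_pexp2l.
  have [Ln mun n1n] := Hn n j0n.
  have nR : 0 < n%:R :> R.
    by rewrite ltr0n lt0n; apply: contraTneq Ln => ->; rewrite -ltNge ln0.
  have Nn : (N j)%:R <= (1 + k) * n%:R.
    apply: (@le_trans _ _ ((1 + k) * (j ^ a)%:R)); first by near: j; exact: block_ratio.
    by rewrite ler_pM2l// ler_nat.
  split => //; first exact: lt_le_trans Ln.
  - apply: (@le_trans _ _ (ln ((1 + k) * n%:R))).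
      by rewrite ler_ln ?posrE ?mulr_gt0// ltr0n.
    rewrite lnM ?posrE// mulrDl mul1r addrC lerD2l.
    apply: (@le_trans _ _ k); last by rewrite ler_peMr// ltW.
    by rewrite -[leRHS]expRK ler_ln ?posrE ?expR_gt0// expR_ge1Dx.
  - case/andP: mun => mu1 _; apply: (@le_trans _ _ (e / 2 * (t / 2 * L n))); last first.
      rewrite ler_pM2l ?divr_gt0//; apply: le_trans mu1; apply: ler_wpM2r.
        by rewrite (le_trans _ Ln).
      have : t * k <= t * 2^-1 by rewrite ler_pM2l.
      lra.
    apply: le_trans (ler_norm n1) _.
    by move: n1n; rewrite ler_pdivrMr ?mulr_gt0//; lra.
exists J => j n w jJ nj Qj; have [Ln Nn LN /andP [mu1 mu2] n1e] := HJ j jJ n nj.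
have /andP [jn nj1] := nj.
have nR : 0 < n%:R :> R.
  by rewrite ltr0n lt0n; apply: contraTneq Ln => ->; rewrite -leNgt ln0.
apply: (le_trans (Qj n (r n) (ltnW nj1) (ltW (r0 n)) _)).
  apply: (@le_trans _ _ ((1 + k) * mu n)).
    have -> : (1 + k) * mu n = sigma * ((1 + k) * n%:R) * r n ^+ d by ring.
    by rewrite ler_wpM2r ?exprn_ge0 ?ler_wpM2l// ltW.
  apply: (@le_trans _ _ ((1 + k) * ((t + t * k) * L n))); first by rewrite ler_pM2l.
  have -> : (1 + k) * ((t + t * k) * L n) = t' * L n by rewrite /t'; ring.
  have NR : 0 < (N j)%:R :> R by rewrite ltr0n.
  by rewrite ler_pM2l// ler_ln ?posrE// ler_nat ltnW.
have mu0 : 0 < mu n by rewrite mulr_gt0// mulr_gt0// exprn_gt0.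
apply: (@le_trans _ _ ((1 + 32 * k) * F * mu n + n1)); last first.
  have : 32 * k * F * mu n <= e / 2 * mu n by rewrite ler_pM2r//; lra.
  lra.
rewrite lerD2r; apply: (@le_trans _ _ ((1 + k) * (t' * ((1 + k) * L n)) * F)).
  by rewrite ler_pM2r// ler_pM2l// ler_pM2l.
apply: (@le_trans _ _ ((1 + 32 * k) * F * ((t - t * k) * L n))); last first.
  by rewrite ler_pM2l// mulr_gt0// addr_gt0// mulr_gt0.
(* One factor comes from [lp_upper], two from [t'] and one from [L (N j)]; the factor [1 - k] on the
   other side is the lower bound on [mu n]. *)
have -> : (1 + k) * (t' * ((1 + k) * L n)) * F = (1 + k) ^+ 4 * (F * t * L n) by rewrite /t'; ring.
have -> : (1 + 32 * k) * F * ((t - t * k) * L n) = (1 + 32 * k) * (1 - k) * (F * t * L n) by ring.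
rewrite ler_pM2r ?mulr_gt0//.
exact: quartic_le.
Unshelve. all: by end_near. Qed.

(** The target [k] varies with [n] inside a block, so the events of all candidates are united, each
    with its own threshold [v k] on [r' ^+ d] and its own tilt [s k]. *)
Lemma degree_upper_family : exists2 C : R, 0 < C &
  forall (N m : nat) (A : pred nat) (v s : nat -> R) (b : R), 0 <= b ->
  (forall k, (k < m)%N -> A k -> [/\ 0 < v k, 0 <= s k &
     N%:R * C * expR (s k) *
       expR (N%:R * (sigma * v k * (C * expR (s k))) - s k * (k.+2)%:R) <= b]) ->
  exists B, [/\ measurable B, (P B <= (m%:R * b)%:E)%E &
    forall w, ~ B w -> forall k n r', (k < m)%N -> A k -> (n <= N)%N -> 0 <= r' ->
      r' ^+ d <= v k -> (chromatic n (rgg_adj nrm (fun i => X i w) r' n) <= k.+1)%N].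
Proof.
have [C C0 H] := degree_upper hd hnrm hvol mX (law_same hlaw) indep sg0
  (law_le hvol mf f0 fbdd fint hlaw).
exists C => // N m A v s b b0 Hb.
have /choice [B HB] : forall k : 'I_m, exists B, [/\ measurable B, (P B <= b%:E)%E &
    forall w, ~ B w -> forall n r', A k -> (n <= N)%N -> 0 <= r' ->
      r' ^+ d <= v k -> (chromatic n (rgg_adj nrm (fun i => X i w) r' n) <= k.+1)%N].
  move=> k; case: (boolP (A k)) => Ak; last first.
    by exists set0; split => //; rewrite measure0 lee_fin.
  have [vk sk bk] := Hb k (ltn_ord k) Ak.
  have [rho rho0 rhov] := root_exists hd vk.
  have [B [mB PB BQ]] := H N k rho (s k) rho0 sk.
  exists B; split => //; first by apply: (le_trans PB); rewrite lee_fin rhov.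
  move=> w nB n r' _ nN r'0 rv; apply: (BQ w nB n r' nN).
  by rewrite -(ler_pXn2r hd) ?nnegrE ?(ltW rho0)// rhov.
exists (\bigcup_k B k); split.
- by apply: fin_bigcup_measurable; [exact: finite_finset|move=> k _; case: (HB k)].
- apply: (le_trans (measure_bigcup_finType_le _ _)); first by move=> k; case: (HB k).
  apply: (@le_trans _ _ (\sum_(k < m) b%:E)%E); first by apply: lee_sum => k _; case: (HB k).
  by rewrite sumEFin sumr_const card_ord mulr_natl.
- move=> w nB k n r' km Ak nN r'0 rv; case: (HB (Ordinal km)) => _ _; apply => //.
  by move=> Bk; apply: nB; exists (Ordinal km).
Qed.

(** * Sparse regime *)

Section Sparse.
Variable alpha : R.
Hypothesis alpha0 : 0 < alpha.
Hypothesis sparse : forall n : nat, (0 < n)%N -> nrd n <= n%:R `^ (- alpha).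

Notation x n := (ln (nrd n)^-1).
Let kk n := Num.truncn (L n / x n + 2^-1).

Let sparse_near : \forall n \near \oo, [/\ (1 < n)%N, 1 <= L n, alpha * L n <= x n &
  nrd n = expR (- x n)].
Proof.
near=> n.
have n1 : (1 < n)%N by near: n; exact: nbhs_infty_gt.
have n0 : (0 < n)%N by exact: ltnW.
have nR : 0 < n%:R :> R by rewrite ltr0n.
have nrd0 : 0 < nrd n by rewrite mulr_gt0// exprn_gt0.
split => //.
- by near: n; exact: ln_ge_near.
- have := sparse n0; rewrite /powR gt_eqF// mulNr => h.
  rewrite -[leLHS]expRK ler_ln ?posrE ?expR_gt0 ?invr_gt0//.
  by rewrite -[leLHS]invrK -expRN lef_pV2 ?posrE ?expR_gt0.
- by rewrite lnV ?posrE// opprK lnK.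
Unshelve. all: by end_near. Qed.

Let K := Num.truncn (alpha^-1 + 2^-1).

Let kk_spec n : (1 < n)%N -> 1 <= L n -> alpha * L n <= x n ->
  [/\ 0 < x n, (kk n <= K)%N, L n <= ((kk n)%:R + 2^-1) * x n &
      ((kk n)%:R - 2^-1) * x n <= L n].
Proof.
move=> n1 Ln xn; have x0 : 0 < x n by apply: lt_le_trans xn; rewrite mulr_gt0// (lt_le_trans _ Ln).
have y0 : 0 <= L n / x n + 2^-1 by rewrite addr_ge0// divr_ge0 ?(ltW x0)// (le_trans _ Ln).
have /andP [h1 h2] := truncn_itv y0; rewrite -/(kk n) in h1 h2.
split => //.
- by apply: le_truncn; rewrite lerD2r ler_pdivrMr// ler_pdivlMl.
- rewrite -ler_pdivrMr//; apply: ltW; rewrite -(ltrD2r 2^-1) -[ltRHS]addrA.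
  by rewrite (_ : 2^-1 + 2^-1 = 1) ?natr1//; lra.
- rewrite -ler_pdivlMr//; lra.
Qed.

(** The expected number of clusters of [k + 2] points is of order [n * nrd n ^+ k.+1], which the
    rounding at one half in [kk] makes at most [expR (- (x n / 2))]: a small power of [n], summable
    along blocks. *)
Lemma sparse_upper : {ae P, forall w, \forall n \near \oo, (chi w n <= (kk n).+1)%N}.
Proof.
have [C C0 H] := degree_upper_family.
(* The bound reached below is a constant times [expR (- (s / 2))] with
   [s / 2 = a * L j / (2 * k + 1)], which is at least [2 * L j] when [a >= 4 * k + 2]. *)
pose a := (2 * K.*2.+1)%N; have ak k : (k < K.+1)%N -> (4 * k + 2 <= a)%N by rewrite /a; lia.
pose lam j := L (j ^ a).
(* With [lam j] for [L n], the value of [r n ^+ d] at [x n = L n / (k + 2^-1)], the densest case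
   with candidate [k]. *)
pose v j k := expR (- (lam j + lam j / (k%:R + 2^-1))).
pose Q j w := forall k n r', (k < K.+1)%N -> (n <= j.+1 ^ a)%N -> 0 <= r' -> r' ^+ d <= v j k ->
  (chromatic n (rgg_adj nrm (fun i => X i w) r' n) <= k.+1)%N.
have khalf k : 0 < k%:R + 2^-1 :> R by rewrite ltr_wpDl// invr_gt0.
apply: (@ae_blocks _ _ _ P a Q) => //.
  apply: (@ae_near _ _ _ P Q (K.+1%:R * (2 * C * expR (2 * (sigma * C))))).
    by rewrite !mulr_ge0 ?expR_ge0// ltW.
  near=> j.
  have j0 : (0 < j)%N by near: j; exact: nbhs_infty_gt.
  have lamE : lam j = a%:R * L j by rewrite /lam natrX lnXn ?ltr0n// mulr_natl.
  have Lj : 0 <= L j by rewrite ln_ge0// ler1n.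
  have lam0 : 0 <= lam j by rewrite lamE mulr_ge0.
  have Nj : (j.+1 ^ a)%:R <= 2 * expR (lam j).
    rewrite lnK ?posrE ?ltr0n ?expn_gt0 ?j0//.
    by near: j; have := @block_ratio R a 1 ltr01; rewrite -[1 + 1]/(2%:R).
  have [|k kK _|B [mB PB BQ]] := H (j.+1 ^ a)%N K.+1 predT (v j) (fun k => lam j / (k%:R + 2^-1))
      (2 * C * expR (2 * (sigma * C)) * expR (- (2 * L j))).
  - by rewrite !mulr_ge0 ?expR_ge0// ltW.
  - set s := lam j / _.
    have s0 : 0 <= s by rewrite divr_ge0// ltW.
    have ls : lam j = s * (k%:R + 2^-1) by rewrite divfK// gt_eqF.
    have vE : expR (lam j) * (v j k * expR s) = 1.
      by rewrite /v -/s -!expRD -[RHS]expR0; congr expR; ring.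
    split => //; first exact: expR_gt0.
    apply: (@le_trans _ _ (2 * expR (lam j) * C * expR s *
        expR (2 * (sigma * C) - s * k.+2%:R))).
      apply: ler_pM; rewrite ?expR_ge0 ?mulr_ge0 ?expR_ge0 ?(ltW C0)//.
        by rewrite ler_wpM2r ?expR_ge0// ler_wpM2r// ltW.
      rewrite ler_expR lerD2r; apply: (@le_trans _ _ (2 * expR (lam j) * (sigma * v j k * (C * expR s)))).
        by rewrite ler_wpM2r// !mulr_ge0 ?expR_ge0// ltW.
      have -> : 2 * expR (lam j) * (sigma * v j k * (C * expR s)) =
        2 * (sigma * C) * (expR (lam j) * (v j k * expR s)) by ring.
      by rewrite vE mulr1.
    have -> : 2 * expR (lam j) * C * expR s * expR (2 * (sigma * C) - s * k.+2%:R) =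
        2 * C * expR (2 * (sigma * C)) * expR (- (s / 2)).
      have -> : expR (- (s / 2)) = expR (lam j) * expR s * expR (- (s * k.+2%:R)).
        by rewrite -!expRD {1}ls -!natr1; congr expR; field.
      by rewrite expRD; ring.
    apply: ler_wpM2l; first by rewrite !mulr_ge0 ?expR_ge0// ltW.
    rewrite ler_expR lerN2 ler_pdivlMr// /s ler_pdivlMr// lamE.
    have ak' : 4 * k%:R + 2 <= a%:R :> R.
      by rewrite -natrM -natrD ler_nat; exact: ak.
    have : (4 * k%:R + 2) * L j <= a%:R * L j by rewrite ler_wpM2r.
    lra.
  exists B; split => //; first by rewrite -mulrA.
  by move=> w nB k n r' kK nN r'0 rv; exact: BQ.
have [n0 _ Hn] := sparse_near.
exists (maxn n0 1) => j n w jJ /andP [jn nj] Qj.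
have j0 : (0 < j)%N by apply: leq_trans jJ; rewrite leq_maxr.
have n0n : (n0 <= n)%N.
  apply: leq_trans jn; apply: (@leq_trans j); first by apply: leq_trans jJ; rewrite leq_maxl.
  by case: (j) j0 => // i _; rewrite -{1}[i.+1]expn1 leq_pexp2l.
have [n1 Ln xn nE] := Hn n n0n; have [x0 kK xk _] := kk_spec n1 Ln xn.
have nR : 0 < n%:R :> R by rewrite ltr0n ltnW.
apply: (Qj (kk n) n (r n)) => //; [exact: ltnW|exact: ltW|].
have -> : r n ^+ d = expR (- (L n + x n)).
  rewrite opprD expRD -nE expRN lnK ?posrE//; field.
  by rewrite gt_eqF.
have lamL : lam j <= L n by rewrite ler_ln ?posrE ?ltr0n ?expn_gt0 ?j0 ?ler_nat// ltnW.
rewrite ler_expR lerN2; apply: lerD => //.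
rewrite ler_pdivrMr//; apply: (le_trans lamL); by rewrite mulrC.
Unshelve. all: by end_near. Qed.

(** The mean number of successful regions, of order [n * nrd n ^+ k.-1], is at least of order
    [expR (x n / 2)], hence a positive power of [n]; the failure probability is summable over all
    [n]. *)
Lemma sparse_lower : {ae P, forall w, \forall n \near \oo, (kk n <= chi w n)%N}.
Proof.
have [c [h [c0 h0 H]]] := clique_lower hd hnrm hvol mf f0 fbdd fint mX hlaw indep.
pose c' := Num.min c 1; have c'0 : 0 < c' by rewrite lt_min c0 ltr01.
have c'c : c' <= c by rewrite ge_min lexx.
have c'1 : c' <= 1 by rewrite ge_min lexx orbT.
have K0 : 0 < K.+1%:R :> R by rewrite ltr0n.
(* As [kk n <= K], the factor [(c / k) ^+ k] stays above the constant [b ^+ K]. *)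
pose b := c' / K.+1%:R; have b0 : 0 < b by rewrite divr_gt0.
have b1 : b <= 1 by rewrite ler_pdivrMr// mul1r (le_trans c'1)// ler1n.
pose A := c * b ^+ K * expR (- c^-1).
have A0 : 0 < A by rewrite !mulr_gt0 ?expR_gt0// exprn_gt0.
apply: (@ae_near _ _ _ P _ 1) => //.
near=> n.
have [n1 Ln xn nE] : [/\ (1 < n)%N, 1 <= L n, alpha * L n <= x n & nrd n = expR (- x n)].
  by near: n; exact: sparse_near.
have [x0 kK _ kx] := kk_spec n1 Ln xn.
have [k0|k0] := posnP (kk n).
  by exists set0; split => //; [rewrite measure0 lee_fin mul1r expR_ge0|move=> w _; rewrite k0].
have kn : (0 < kk n <= n)%N.
  by rewrite k0 (leq_trans kK)//; near: n; exact: nbhs_infty_ge.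
have rn : 0 < r n < h by near: n; exact: r_lt_near.
have [B [mB PB BQ]] := H n (kk n) (r n) rn kn.
exists B; split => //; apply: (le_trans PB); rewrite lee_fin mul1r ler_expR lerN2.
set k := kk n in k0 kK kx *; set y := x n in xn x0 kx nE; set p := nrd n in nE *.
have nR : 0 < n%:R :> R by rewrite ltr0n ltnW.
have p0 : 0 < p by rewrite nE expR_gt0.
have p1 : p <= 1 by rewrite nE -expR0 ler_expR oppr_le0 ltW.
have rd0 : 0 < r n ^+ d by rewrite exprn_gt0.
have kR : 0 < k%:R :> R by rewrite ltr0n.
have hA : 2 / A * L n ^+ 2 <= expR (alpha / 2 * L n).
  by near: n; apply: sqr_ln_le_near; rewrite divr_gt0.
have E1 : c / r n ^+ d = c * (n%:R / p) by rewrite /p; field; rewrite !gt_eqF.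
have E2 : b ^+ K * p ^+ k <= (c * p / k%:R) ^+ k.
  apply: (@le_trans _ _ ((b * p) ^+ k)).
    by rewrite [leRHS]exprMn ler_wpM2r ?exprn_ge0 ?(ltW p0)// ler_wiXn2l// ltW.
  apply: lerXn2r; rewrite ?nnegrE.
  - by apply: mulr_ge0; exact: ltW.
  - by apply: divr_ge0; [apply: mulr_ge0|]; exact: ltW.
  rewrite [leRHS]mulrAC ler_pM2r// /b; apply: ler_pM => //; rewrite ?invr_ge0 ?(ltW c'0)//.
  by rewrite lef_pV2 ?posrE// ler_nat (leq_trans kK).
have E3 : expR (- c^-1) <= expR (- (p / c)).
  by rewrite ler_expR lerN2 ler_piMl// invr_ge0 ltW.
have E4 : expR (alpha / 2 * L n) <= n%:R / p * p ^+ k.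
  rewrite (expR_ratio k nR nE).
  by rewrite ler_expR; exact: sparse_exponent_ge xn kx.
apply: (@le_trans _ _ (A * expR (alpha / 2 * L n))).
  apply: (@le_trans _ _ (A * (2 / A * L n ^+ 2))); last by rewrite ler_pM2l.
  have -> : A * (2 / A * L n ^+ 2) = 2 * L n ^+ 2 by field; rewrite gt_eqF.
  by rewrite ler_pM2l// expr2 ler_peMr// (le_trans _ Ln).
apply: (@le_trans _ _ (c * (n%:R / p) * (b ^+ K * p ^+ k) * expR (- c^-1))).
  have -> : c * (n%:R / p) * (b ^+ K * p ^+ k) * expR (- c^-1) = A * (n%:R / p * p ^+ k).
    rewrite /A; move: (b ^+ K) (p ^+ k) (n%:R / p) (expR _) => u1 u2 u3 u4.
    by rewrite !mulrA [c * u3]mulrC; ring.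
  by rewrite ler_pM2l.
rewrite E1; apply: ler_pM E3; rewrite ?expR_ge0//.
  by rewrite !mulr_ge0 ?invr_ge0 ?exprn_ge0 ?(ltW p0) ?(ltW c0) ?(ltW b0).
by rewrite ler_wpM2l// !mulr_ge0 ?invr_ge0 ?(ltW p0) ?(ltW c0).
Unshelve. all: by end_near. Qed.

End Sparse.

(** * Intermediate regime *)

Section Intermediate.
Hypothesis above : forall eps : R, 0 < eps -> n%:R `^ (- eps) / nrd n @[n --> \oo] --> 0.
Hypothesis below : nrd n / L n @[n --> \oo] --> 0.

Notation y n := (ln (L n / nrd n)).

(** [below] makes [y n] large and [above] makes it negligible against [L n]; hence [L n / y n] tends
    to infinity and rounding it is harmless. *)
Lemma inter_near (e A : R) : 0 < e -> \forall n \near \oo,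
  [/\ (1 < n)%N, 1 <= L n, A <= y n, y n <= e * L n & nrd n = L n * expR (- y n)].
Proof.
move=> e0; near=> n.
have n1 : (1 < n)%N by near: n; exact: nbhs_infty_gt.
have nR : 0 < n%:R :> R by rewrite ltr0n ltnW.
have nrd0 : 0 < nrd n by rewrite mulr_gt0// exprn_gt0.
have Ln : 1 <= L n by near: n; exact: ln_ge_near.
have L0 : 0 < L n by exact: lt_le_trans Ln.
have q0 : 0 < L n / nrd n by rewrite divr_gt0.
split => //.
- have h : nrd n / L n < expR (- A) by near: n; exact: (cvgr_lt 0 below _ (expR_gt0 _)).
  rewrite -[leLHS]expRK ler_ln ?posrE ?expR_gt0//.
  by rewrite -[leLHS]invrK -expRN -[leRHS]invf_div lef_pV2 ?posrE ?expR_gt0 ?divr_gt0// ltW.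
- have h : n%:R `^ (- (e / 2)) / nrd n < 1.
    near: n; apply: (cvgr_lt 0) => //; apply: above; exact: divr_gt0.
  have h2 : 1 * L n ^+ 2 <= expR (e / 2 * L n).
    by near: n; apply: sqr_ln_le_near; exact: divr_gt0.
  rewrite -[leRHS]expRK ler_ln ?posrE ?expR_gt0// ler_pdivrMr//.
  apply: (@le_trans _ _ (expR (e / 2 * L n))).
    by apply: le_trans h2; rewrite mul1r expr2 ler_peMr// ltW.
  have -> : e * L n = e / 2 * L n + e / 2 * L n by field.
  rewrite expRD -[leRHS]mulrA ler_peMr ?expR_ge0//.
  move: h; rewrite /powR gt_eqF// ltr_pdivrMr// mul1r mulNr expRN => /ltW h.
  by rewrite -ler_pdivrMl ?expR_gt0// mulr1.
- by rewrite -lnV ?posrE// lnK ?posrE ?invr_gt0// invf_div [RHS]mulrC divfK// gt_eqF.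
Unshelve. all: by end_near. Qed.

(** For [k] just above [(1 - e) * L n / y n], the mean number of regions with [k] points is about
    [expR (L n - k * y n)]; rounding [k] and the factor [expR (- (nrd n / c))] each cost
    [e / 4 * L n], which leaves [e / 2 * L n] in the exponent. *)
Lemma inter_lower (e : R) : 0 < e -> e <= 1 ->
  {ae P, forall w, \forall n \near \oo, (1 - e) * (L n / y n) <= (chi w n)%:R}.
Proof.
move=> e0 e1.
have [c [h [c0 h0 H]]] := clique_lower hd hnrm hvol mf f0 fbdd fint mX hlaw indep.
have ce0 : 0 < c * e by rewrite mulr_gt0.
apply: (@ae_near _ _ _ P _ 1) => //.
pose A := Num.max 1 (Num.max c^-1 (4 / (c * e))).
near=> n.
have [n1 Ln yA ye nE] : [/\ (1 < n)%N, 1 <= L n, A <= y n, y n <= e / 4 * L n &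
    nrd n = L n * expR (- y n)].
  by near: n; apply: inter_near; exact: divr_gt0.
have [y1 yc yce] : [/\ 1 <= y n, c^-1 <= y n & 4 / (c * e) <= y n].
  by move: yA; rewrite !ge_max => /and3P [].
have rn : 0 < r n < h by near: n; exact: r_lt_near.
have hA : 2 / c * L n ^+ 2 <= expR (e / 2 * L n).
  by near: n; apply: sqr_ln_le_near; rewrite divr_gt0.
have nR : 0 < n%:R :> R by rewrite ltr0n ltnW.
have p0 : 0 < nrd n by rewrite mulr_gt0// exprn_gt0.
have rd0 : 0 < r n ^+ d by rewrite exprn_gt0.
have cr : c / r n ^+ d = c * (n%:R / nrd n) by field; rewrite !gt_eqF.
have nL : expR (L n) = n%:R by rewrite lnK.
have yy0 : 0 < y n by exact: lt_le_trans y1.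
have LL0 : 0 < L n by exact: lt_le_trans Ln.
have Lnn : L n <= n%:R by rewrite -{2}nL (le_trans _ (expR_ge1Dx _))// lerDr.
pose K0 := L n / y n; pose k := (Num.truncn ((1 - e) * K0)).+1.
have K00 : 0 <= (1 - e) * K0 by rewrite mulr_ge0 ?subr_ge0// divr_ge0// ltW.
have /andP [k1 /ltW k2] := truncn_itv K00.
have kK : k%:R <= K0.
  have h1 : k%:R <= (1 - e) * K0 + 1 by rewrite /k -natr1 lerD2r.
  have h2 : 1 <= e * K0.
    rewrite /K0 mulrA ler_pdivlMr// mul1r (le_trans ye)// ler_pM2r// ler_piMr ?(ltW e0)//.
    by rewrite invf_le1// ler1n.
  by apply: (le_trans h1); rewrite -lerBrDl mulrBl mul1r opprB [e * K0 - K0]addrC addrA subrr add0r.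
have K0L : K0 <= L n by rewrite ler_pdivrMr// ler_peMr// ltW.
have kn : (0 < k <= n)%N by rewrite /= -(ler_nat R) (le_trans kK)// (le_trans K0L).
have [B [mB PB BQ]] := H n k (r n) rn kn.
exists B; split => //; last first.
  by move=> w nB; apply: (le_trans k2); rewrite ler_nat; exact: BQ.
apply: (le_trans PB); rewrite lee_fin mul1r ler_expR lerN2 cr.
have k0 : 0 < k%:R :> R by rewrite ltr0n.
have ky : k%:R * y n <= (1 - e) * L n + e / 4 * L n.
  apply: (@le_trans _ _ (((1 - e) * K0 + 1) * y n)).
    by rewrite ler_pM2r// /k -natr1 lerD2r.
  rewrite mulrDl mul1r lerD// -mulrA divfK// gt_eqF//.
move: nE yc yce ye y1 yy0 ky kK; rewrite /K0; clearbody k.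
set p := nrd n in p0 *; set z := y n; set l := L n in Ln LL0 hA nL *.
move=> pE yc yce ye y1 yy0 ky kK.
have E1 : expR (- (k%:R * z)) <= (c * p / k%:R) ^+ k.
  rewrite -mulrN expRM_natl; apply: lerXn2r; rewrite ?nnegrE ?expR_ge0//.
    by rewrite divr_ge0// mulr_ge0// ltW.
  rewrite ler_pdivlMr// pE mulrC mulrA ler_wpM2r ?expR_ge0//.
  apply: (le_trans kK); rewrite mulrC ler_wpM2r ?(ltW LL0)//.
  by rewrite -[leRHS]invrK lef_pV2 ?posrE ?invr_gt0.
have E2 : p / c <= e / 4 * l.
  rewrite pE -mulrA [leRHS]mulrC ler_pM2l// ler_pdivrMr// expRN.
  have -> : e / 4 * c = (4 / (c * e))^-1 by field; rewrite !gt_eqF.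
  rewrite lef_pV2 ?posrE ?expR_gt0 ?divr_gt0//.
  by rewrite (le_trans yce)// (le_trans _ (expR_ge1Dx _))// lerDr.
have pl : p <= l by rewrite pE ler_piMr ?(ltW LL0)// -expR0 ler_expR oppr_le0 ltW.
have E3 : c / l * expR (e / 2 * l) <= c * (n%:R / p) * (c * p / k%:R) ^+ k * expR (- (p / c)).
  apply: (@le_trans _ _ (c * (n%:R / l) * expR (- (k%:R * z)) * expR (- (e / 4 * l)))).
    rewrite -nL; have -> : c * (expR l / l) * expR (- (k%:R * z)) * expR (- (e / 4 * l)) =
       c / l * (expR l * expR (- (k%:R * z)) * expR (- (e / 4 * l))) by ring.
    rewrite -!expRD ler_wpM2l ?divr_ge0 ?(ltW c0) ?(ltW LL0)// ler_expR; lra.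
  apply: ler_pM; rewrite ?expR_ge0 ?mulr_ge0 ?invr_ge0 ?expR_ge0 ?(ltW c0) ?(ltW LL0)//; last first.
    by rewrite ler_expR lerN2.
  apply: ler_pM; rewrite ?expR_ge0 ?mulr_ge0 ?invr_ge0 ?expR_ge0 ?(ltW c0) ?(ltW LL0)//.
  by rewrite ler_pM2l// ler_pM2l// lef_pV2 ?posrE.
apply: le_trans E3; apply: (@le_trans _ _ (c / l * (2 / c * l ^+ 2))).
  have -> : c / l * (2 / c * l ^+ 2) = 2 * l by field; rewrite !gt_eqF.
  by [].
by rewrite ler_pM2l// divr_gt0.
Unshelve. all: by end_near. Qed.

Lemma inter_upper (e : R) : 0 < e -> e <= 1 ->
  {ae P, forall w, \forall n \near \oo, (chi w n)%:R <= (1 + e) * (L n / y n)}.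
Proof.
move=> e0 e1; have [C C0 H] := degree_upper_family.
pose a := (Num.truncn (16 / e)).+1.
have ae : 16 <= a%:R * e.
  have k2 : 0 <= 16 / e by rewrite divr_ge0// ltW.
  by have /andP [_ /ltW] := truncn_itv k2; rewrite ler_pdivrMr.
(* Makes the mean term of the Chernoff exponent at most [e / 8 * lam j]. With [a * e >= 16], the
   final [expR (- (e / 8 * lam j))] is at most [expR (- (2 * L j))]. *)
pose de := e ^+ 2 / (128 * (sigma * C)).
have sC : 0 < sigma * C by rewrite mulr_gt0.
have de0 : 0 < de by rewrite divr_gt0 ?exprn_gt0// mulr_gt0.
(* The number of candidates grows like [lam j]; the actual [k] stays below [m j] since [y n] tends
   to infinity. *)
pose lam j := L (j ^ a); pose m j := Num.truncn (de * lam j).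
(* With [lam j] for [L n], the value of [r n ^+ d] at [y n = (1 + e) * L n / (k + 2)]; the factor 2
   covers the growth of [L n] inside a block. *)
pose v j k := 2 * lam j * expR (- (lam j + (1 + e) * (lam j / k.+2%:R))).
pose A k := 16 / e <= k.+2%:R :> R.
pose Q j w := forall k n r', (k < m j)%N -> A k -> (n <= j.+1 ^ a)%N -> 0 <= r' ->
  r' ^+ d <= v j k -> (chromatic n (rgg_adj nrm (fun i => X i w) r' n) <= k.+1)%N.
have cst0 : 0 <= 16 * de * C / e.
  by apply: divr_ge0 (ltW e0); apply: mulr_ge0 (ltW C0); apply: mulr_ge0 (ltW de0).
have lamE j : lam j = a%:R * L j.
  by case: j => [|j]; rewrite /lam natrX; [rewrite expr0n /= ln0// mulr0|rewrite lnXn// mulr_natl].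
apply: (@ae_blocks _ _ _ P a Q) => //.
  apply: (@ae_near _ _ _ P Q (16 * de * C / e)).
    exact: cst0.
  near=> j.
  have Lj : 1 <= L j by near: j; exact: ln_ge_near.
  have Ljd : de^-1 <= L j by near: j; exact: ln_ge_near.
  have j0 : (0 < j)%N by near: j; exact: nbhs_infty_gt.
  have a1 : 1 <= a%:R :> R by rewrite ler1n.
  have lj : L j <= lam j by rewrite lamE ler_peMl// (le_trans _ Lj).
  have lam0 : 0 < lam j by rewrite (lt_le_trans _ lj)// (lt_le_trans _ Lj).
  have dl : 1 <= de * lam j by rewrite -ler_pdivrMl// mulr1 (le_trans Ljd).
  have Nj : (j.+1 ^ a)%:R <= 2 * expR (lam j).
    rewrite lnK ?posrE ?ltr0n ?expn_gt0 ?j0//.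
    by near: j; have := @block_ratio R a 1 ltr01; rewrite -[1 + 1]/(2%:R).
  have /andP [mdl _] : (m j)%:R <= de * lam j < (m j).+1%:R.
    by apply: truncn_itv; rewrite mulr_ge0// ltW.
  (* This tilt [s] gives [s * k.+2%:R = (1 + e / 2) * lam j], enough to beat the number of points,
     at most [2 * expR (lam j)], while [v j k * expR s] remains small. *)
  have [|k km Ak|B [mB PB BQ]] := H (j.+1 ^ a)%N (m j) A (v j)
      (fun k => (1 + e / 2) * (lam j / k.+2%:R)) (2 * C * expR (- (e / 4 * lam j))).
  - by rewrite !mulr_ge0 ?expR_ge0// ltW.
  - have T0 : 0 < k.+2%:R :> R by rewrite ltr0n.
    set q := lam j / k.+2%:R.
    have q0 : 0 < q by rewrite divr_gt0.
    have qT : q * k.+2%:R = lam j by rewrite divfK// gt_eqF.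
    have qe : q <= e / 16 * lam j.
      rewrite ler_pdivrMr// mulrC mulrA ler_peMl ?(ltW lam0)//.
      by move: Ak; rewrite /A ler_pdivrMr// => h; rewrite mulrA ler_pdivlMr// mul1r.
    have qd : 1 <= 2 * de * q.
      rewrite mulrA ler_pdivlMr// mul1r.
      have : k.+1%:R <= de * lam j by rewrite (le_trans _ mdl)// ler_nat.
      by rewrite -[k.+2%:R]natr1 => h; rewrite -mulrA; lra.
    have e20 : 0 <= 1 + e / 2 by rewrite addr_ge0// divr_ge0// ltW.
    split.
    + by rewrite !mulr_gt0 ?expR_gt0.
    + by rewrite mulr_ge0// ltW.
    have vE : expR (lam j) * (v j k * expR ((1 + e / 2) * q)) = 2 * lam j * expR (- (e / 2 * q)).
      have -> : expR (- (e / 2 * q)) = expR (lam j) * expR (- (lam j + (1 + e) * q)) *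
         expR ((1 + e / 2) * q) by rewrite -!expRD; congr expR; field.
      by rewrite /v -/q; ring.
    have eq2 : expR (- (e / 2 * q)) <= 4 * de / e.
      have e4 : 0 < 4 * de / e by apply: divr_gt0 => //; apply: mulr_gt0.
      have h0 : 0 < e / 2 * q by rewrite mulr_gt0// divr_gt0.
      rewrite expRN -[leRHS]invrK lef_pV2 ?posrE ?invr_gt0 ?expR_gt0//.
      apply: (@le_trans _ _ (e / 2 * q)); last by rewrite (le_trans _ (expR_ge1Dx _))// lerDr.
      have d4 : 0 < 4 * de by apply: mulr_gt0.
      rewrite invf_div ler_pdivrMr//.
      have -> : e / 2 * q * (4 * de) = e * (2 * de * q) by field.
      by rewrite ler_peMr// ltW.
    have E1 : (j.+1 ^ a)%:R * (sigma * v j k * (C * expR ((1 + e / 2) * q))) <= e / 8 * lam j.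
      apply: (@le_trans _ _ (2 * expR (lam j) * (sigma * v j k * (C * expR ((1 + e / 2) * q))))).
        by rewrite ler_wpM2r// !mulr_ge0 ?expR_ge0 ?(ltW lam0)// ltW.
      have -> : 2 * expR (lam j) * (sigma * v j k * (C * expR ((1 + e / 2) * q))) =
        2 * (sigma * C) * (expR (lam j) * (v j k * expR ((1 + e / 2) * q))) by ring.
      rewrite vE; apply: (@le_trans _ _ (2 * (sigma * C) * (2 * lam j * (4 * de / e)))).
        have h1 : 0 <= 2 * (sigma * C) by apply: mulr_ge0 (ltW sC).
        have h2 : 0 <= 2 * lam j by apply: mulr_ge0 (ltW lam0).
        apply: (ler_wpM2l h1).
        exact: (ler_wpM2l h2).
      have -> // : 2 * (sigma * C) * (2 * lam j * (4 * de / e)) = e / 8 * lam j.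
      by rewrite /de; field; rewrite !gt_eqF.
    apply: (@le_trans _ _ (2 * expR (lam j) * C * expR ((1 + e / 2) * q) *
        expR (e / 8 * lam j - (1 + e / 2) * lam j))).
      apply: ler_pM; rewrite ?expR_ge0 ?mulr_ge0 ?expR_ge0 ?(ltW C0)//.
        by rewrite ler_wpM2r ?expR_ge0// ler_wpM2r// ltW.
      by rewrite ler_expR -[_ * q * _]mulrA qT lerD2r.
    have -> : 2 * expR (lam j) * C * expR ((1 + e / 2) * q) *
        expR (e / 8 * lam j - (1 + e / 2) * lam j) = 2 * C * expR (lam j + (1 + e / 2) * q +
        (e / 8 * lam j - (1 + e / 2) * lam j)) by rewrite !expRD; ring.
    rewrite ler_pM2l ?mulr_gt0// ler_expR.
    have : (1 + e / 2) * q <= 2 * q by rewrite ler_pM2r//; lra.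
    lra.
  exists B; split => //.
  apply: (le_trans PB); rewrite lee_fin.
  apply: (@le_trans _ _ (de * lam j * (2 * C * expR (- (e / 4 * lam j))))).
    by rewrite ler_wpM2r// !mulr_ge0 ?expR_ge0// ltW.
  have E2 : lam j <= 8 / e * expR (e / 8 * lam j).
    rewrite -ler_pdivrMl ?divr_gt0// invf_div (le_trans _ (expR_ge1Dx _))// lerDr//.
  have E3 : expR (e / 8 * lam j) * expR (- (e / 4 * lam j)) <= expR (- (2 * L j)).
    rewrite -expRD ler_expR lamE.
    have : 16 * L j <= a%:R * e * L j by rewrite ler_wpM2r// (le_trans _ Lj).
    lra.
  apply: (@le_trans _ _ (de * (8 / e * expR (e / 8 * lam j)) * (2 * C * expR (- (e / 4 * lam j))))).
    by rewrite ler_wpM2r ?ler_pM2l// !mulr_ge0 ?expR_ge0// ltW.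
  have -> : de * (8 / e * expR (e / 8 * lam j)) * (2 * C * expR (- (e / 4 * lam j))) =
    16 * de * C / e * (expR (e / 8 * lam j) * expR (- (e / 4 * lam j))) by field; rewrite gt_eqF.
  exact: ler_wpM2l.
have e160 : 0 < e / 16 by exact: divr_gt0.
have [n0 _ Hn] := inter_near (Num.max 1 (4 / de)) e160.
have [J _ HJ] : \forall j \near \oo, [/\ (0 < j)%N, 1 <= lam j & (j.+1 ^ a)%:R <= 2 * expR (lam j)].
  near=> j.
  have j0 : (0 < j)%N by near: j; exact: nbhs_infty_gt.
  have Lj : 1 <= L j by near: j; exact: ln_ge_near.
  split => //; first by rewrite lamE (le_trans Lj)// ler_peMl ?ler1n// (le_trans _ Lj).
  rewrite lnK ?posrE ?ltr0n ?expn_gt0 ?j0//.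
  by near: j; have := @block_ratio R a 1 ltr01; rewrite -[1 + 1]/(2%:R).
exists (maxn n0 J) => j n w jJ /andP [jn nj] Qj.
have [j0 lam1 Nj] := HJ j (leq_trans (leq_maxr _ _) jJ).
have n0n : (n0 <= n)%N.
  apply: leq_trans jn; apply: (@leq_trans j); first by apply: leq_trans jJ; rewrite leq_maxl.
  by case: (j) j0 => // i _; rewrite -{1}[i.+1]expn1 leq_pexp2l.
have [n1 Ln yA ye nE] := Hn n n0n.
have [y1 yd] : 1 <= y n /\ 4 / de <= y n by move: yA; rewrite ge_max => /andP [].
have nR : 0 < n%:R :> R by rewrite ltr0n ltnW.
have yy0 : 0 < y n by exact: lt_le_trans y1.
have LL0 : 0 < L n by exact: lt_le_trans Ln.
have lam0 : 0 < lam j by exact: lt_le_trans lam1.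
have lamL : lam j <= L n.
  by rewrite ler_ln ?posrE ?ler_nat// ltr0n expn_gt0 j0.
have L2 : L n <= 2 * lam j.
  apply: (@le_trans _ _ (lam j + 1)); last lra.
  rewrite -[leRHS]expRK ler_ln ?posrE ?expR_gt0// expRD.
  apply: (@le_trans _ _ (j.+1 ^ a)%:R); first by rewrite ler_nat ltnW.
  apply: (le_trans Nj); rewrite mulrC ler_wpM2l ?expR_ge0//.
  by apply: le_trans (expR_ge1Dx 1); rewrite -[1 + 1]/(2%:R).
pose K0 := L n / y n.
have K00 : 0 < K0 by exact: divr_gt0.
have KK0 : 0 <= (1 + e) * K0 by rewrite mulr_ge0 ?addr_ge0// ltW.
have /andP [t1 t2] := truncn_itv KK0.
have K16 : 16 / e <= K0.
  rewrite /K0 ler_pdivlMr// mulrC -ler_pdivlMr ?divr_gt0// invf_div.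
  by rewrite [leRHS]mulrC.
have e16 : 16 <= 16 / e by rewrite ler_peMr// invf_ge1.
have Kt : K0 <= (1 + e) * K0 by rewrite ler_peMl ?(ltW K00)// lerDl ltW.
have tg : (0 < Num.truncn ((1 + e) * K0))%N.
  by rewrite truncn_gt0 (le_trans _ Kt)// (le_trans _ K16)// (le_trans _ e16)// ler1n.
pose k := (Num.truncn ((1 + e) * K0)).-1.
have kE : k.+1 = Num.truncn ((1 + e) * K0) by rewrite prednK.
rewrite -kE in t1 t2.
apply: le_trans t1; rewrite ler_nat; apply: Qj => //.
- rewrite kE; apply: le_truncn; rewrite /K0 mulrA ler_pdivrMr//.
  apply: (@le_trans _ _ (2 * (2 * lam j))).
    apply: ler_pM => //; [by rewrite addr_ge0// ltW|exact: ltW|].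
    by rewrite -[2]/(1 + 1) lerD2l.
  have : 4 * lam j <= de * y n * lam j.
    by rewrite ler_pM2r//; move: yd; rewrite ler_pdivrMr// [de * _]mulrC.
  by rewrite [leRHS]mulrAC mulrA -natrM.
- by rewrite /A (le_trans K16)// (le_trans Kt)// ltW.
- exact: ltnW.
- exact: ltW.
have -> : r n ^+ d = L n * expR (- (L n + y n)).
  by rewrite opprD expRD mulrCA -nE expRN lnK ?posrE//; field; rewrite gt_eqF.
apply: ler_pM; rewrite ?expR_ge0 ?(ltW LL0)//.
rewrite ler_expR lerN2 lerD//.
rewrite mulrA ler_pdivrMr ?ltr0n//.
apply: (@le_trans _ _ ((1 + e) * K0 * y n)); last by rewrite mulrC ler_pM2l// ltW.
by rewrite -mulrA divfK ?gt_eqF// ler_pM2l// addr_gt0.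
Unshelve. all: by end_near. Qed.

Lemma intermediate_cvg :
  {ae P, forall w, (chi w n)%:R / (L n / y n) @[n --> \oo] --> (1 : R)}.
Proof.
apply: (@ae_ratio_cvg _ _ _ P (fun n w => (chi w n)%:R) (fun n => L n / y n)).
- near=> n; have [_ Ln y1 _ _] : [/\ (1 < n)%N, 1 <= L n, 1 <= y n, y n <= 1 * L n &
    nrd n = L n * expR (- y n)] by near: n; exact: inter_near.
  by rewrite divr_gt0// (lt_le_trans ltr01).
- move=> e e0; have m0 : 0 < Num.min e 1 by rewrite lt_min e0 ltr01.
  have m1 : Num.min e 1 <= 1 by rewrite ge_min lexx orbT.
  apply: filterS (inter_upper m0 m1) => w Hw; near=> n.
  have [_ Ln y1 _ _] : [/\ (1 < n)%N, 1 <= L n, 1 <= y n, y n <= 1 * L n &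
    nrd n = L n * expR (- y n)] by near: n; exact: inter_near.
  apply: (@le_trans _ _ ((1 + Num.min e 1) * (L n / y n))); first by near: n.
  rewrite ler_wpM2r//; last by rewrite lerD2l ge_min lexx.
  by rewrite divr_ge0// (le_trans ler01).
- move=> e e0; case: (leP e 1) => e1; first exact: inter_lower.
  have [n0 _ Hn] := @inter_near 1 1 ltr01.
  apply: aeW => w; exists n0 => // n /Hn [_ Ln y1 _ _].
  apply: (@le_trans _ _ 0) => //; rewrite mulr_le0_ge0//; first lra.
  by rewrite divr_ge0// (le_trans ler01).
Unshelve. all: by end_near. Qed.

End Intermediate.

End Asymptotics.

Theorem theorem1p1
  (R : realType) (d : nat) (hd : (0 < d)%N)
  (nrm : d.-tuple R -> R) (hnrm : is_norm nrm)
  (vol : {measure set (d.-tuple R) -> \bar R}) (hvol : is_lebesgue vol)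
  (f : d.-tuple R -> R)
  (hf_meas : measurable_fun setT f) (hf_nonneg : forall x, 0 <= f x)
  (hf_bdd : exists M : R, forall x, f x <= M)
  (hf_int : (\int[vol]_x (f x)%:E = 1)%E)
  (d0 : measure_display) (Omega : measurableType d0) (P : probability Omega R)
  (X : nat -> Omega -> d.-tuple R)
  (hX_meas : forall i, measurable_fun setT (X i))
  (hX_law : forall i (A : set (d.-tuple R)), measurable A ->
     P (X i @^-1` A) = (\int[vol]_(x in A) (f x)%:E)%E)
  (hX_indep : mutually_independent P X)
  (r : nat -> R) (hr_pos : forall n, 0 < r n) (hr_lim : r n @[n --> \oo] --> 0) :
  let sigma := ess_sup_density vol f in
  let delta := packing_density nrm vol in
  let chi := fun (n : nat) (w : Omega) => chromatic n (rgg_adj nrm (fun i => X i w) (r n) n) in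
  let nrd := fun n : nat => n%:R * r n ^+ d in
  let fchi := f_chi vol nrm in
  let limval := fine (vol (unit_ball nrm)) / (2 ^+ d * delta) in
  (* 1. sparse regime *)
  ((exists alpha : R, 0 < alpha /\ forall n : nat, (0 < n)%N -> nrd n <= n%:R `^ (- alpha)) ->
     let k := fun n : nat => Num.floor (ln (n%:R) / ln ((nrd n)^-1) + 2^-1) in
     {ae P, forall w, \forall n \near \oo,
        (chi n w)%:Z = k n \/ (chi n w)%:Z = k n + 1}) /\
  (* 2. intermediate regime *)
  ((forall eps : R, 0 < eps -> n%:R `^ (- eps) / nrd n @[n --> \oo] --> 0) ->
   nrd n / ln (n%:R) @[n --> \oo] --> 0 ->
     {ae P, forall w,
        (chi n w)%:R / (ln (n%:R) / ln (ln (n%:R) / nrd n)) @[n --> \oo] --> (1 : R)}) /\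
  (* 3. logarithmic regime *)
  (forall t : R, 0 < t -> sigma * nrd n / ln (n%:R) @[n --> \oo] --> t ->
     {ae P, forall w,
        ((chi n w)%:R / (sigma * nrd n))%:E @[n --> \oo] --> fchi t}) /\
  ((forall t : R, 0 < t -> fchi t \is a fin_num) /\
   (forall t : R, 0 < t -> {for t, continuous (fun u => fine (fchi u))}) /\
   (forall s t : R, 0 < s -> s <= t -> (fchi t <= fchi s)%E) /\
   (fchi t @[t --> +oo] --> limval%:E) /\
   (fchi t @[t --> 0^'+] --> +oo%E)) /\
  (* 4. dense regime *)
  (ln (n%:R) / nrd n @[n --> \oo] --> 0 ->
     {ae P, forall w, (chi n w)%:R / (sigma * nrd n) @[n --> \oo] --> limval}).

Proof.
move=> sigma delta chi nrd fchi limval.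
have sg0 : 0 < sigma := sigma_gt0 hvol hf_meas hf_nonneg hf_bdd hf_int.
have nrd0 n : (0 < n)%N -> 0 < nrd n by move=> n0; rewrite mulr_gt0 ?ltr0n// exprn_gt0.
have mu0 : \forall n \near \oo, 0 < sigma * nrd n.
  by near=> n; rewrite mulr_gt0// nrd0//; near: n; exact: nbhs_infty_gt.
have lE : limval = max_int nrm vol := limval_max_int hnrm hd hvol.
split; [|split; [|split; [|split]]].
- move=> [alpha [alpha0 sparse]] k.
  have up := sparse_upper hd hnrm hvol hf_meas hf_nonneg hf_bdd hf_int hX_meas hX_law hX_indep
    hr_pos alpha0 sparse.
  have lo := sparse_lower hd hnrm hvol hf_meas hf_nonneg hf_bdd hf_int hX_meas hX_law hX_indep
    hr_pos hr_lim alpha0 sparse.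
  apply: filterS2 up lo => w uw lw; near=> n.
  have n1 : (1 < n)%N by near: n; exact: nbhs_infty_gt.
  have y0 : 0 <= ln (n%:R) / ln (nrd n)^-1 + 2^-1 :> R.
    rewrite addr_ge0// divr_ge0 ?ln_ge0 ?ler1n ?(ltnW n1)//.
    rewrite invf_ge1 ?nrd0 ?(ltnW n1)//; apply: le_trans (sparse n (ltnW n1)) _.
    have L0 : 0 <= ln n%:R :> R by rewrite ln_ge0// ler1n ltnW.
    rewrite /powR gt_eqF ?ltr0n ?(ltnW n1)// -[leRHS]expR0 ler_expR mulNr oppr_le0.
    by rewrite mulr_ge0// ltW.
  (* On nonnegative arguments the integer floor of the statement and the natural truncation
     agree. *)
  have kE : k n = (Num.truncn (ln (n%:R) / ln (nrd n)^-1 + 2^-1 : R))%:Z.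
    by rewrite truncn_floor y0 gez0_abs// floor_ge0.
  have h1 : (chi n w <= (Num.truncn (ln (n%:R) / ln (nrd n)^-1 + 2^-1 : R)).+1)%N by near: n.
  have h2 : (Num.truncn (ln (n%:R) / ln (nrd n)^-1 + 2^-1 : R) <= chi n w)%N by near: n.
  by rewrite kE; move: h1 h2; clear; lia.
- move=> above below.
  exact: (intermediate_cvg hd hnrm hvol hf_meas hf_nonneg hf_bdd hf_int hX_meas hX_law hX_indep
    hr_pos hr_lim above below).
- move=> t t0 mulim.
  have : {ae P, forall w, (chi n w)%:R / (sigma * nrd n) @[n --> \oo] --> fine (fchi t)}.
    apply: (@ae_ratio_cvg _ _ _ P (fun n w => (chi n w)%:R)) => // e e0.
    + exact: (log_upper hd hnrm hvol hf_meas hf_nonneg hf_bdd hf_int hX_meas hX_law hX_indep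
        hr_pos t0 mulim e0).
    + exact: (log_lower hd hnrm hvol hf_meas hf_nonneg hf_bdd hf_int hX_meas hX_law hX_indep
        hr_pos hr_lim t0 mulim e0).
  apply: filterS => w cw; rewrite /fchi -(fineK (fchi_fin_num hnrm hd hvol t0)).
  by apply/fine_cvgP; split => //; exact: nearW.
- split; first by move=> t; exact: fchi_fin_num.
  split; first by move=> t; exact: fchi_continuous.
  split; first by move=> s t; exact: fchi_anti.
  by rewrite lE; split; [exact: fchi_cvg_pinfty|exact: fchi_cvg_0].
- move=> dense; rewrite lE.
  apply: (@ae_ratio_cvg _ _ _ P (fun n w => (chi n w)%:R)) => // e e0.
  + exact: (dense_upper hd hnrm hvol hf_meas hf_nonneg hf_bdd hf_int hX_meas hX_law hX_indep
      hr_pos dense e0).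
  + exact: (dense_lower hd hnrm hvol hf_meas hf_nonneg hf_bdd hf_int hX_meas hX_law hX_indep
      hr_pos hr_lim dense e0).
Unshelve. all: by end_near. Qed.
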